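(* Let $S\in\mathcal O_\Delta^2+\mathcal O_{\mathrm{loc}}^2$ be a generating function of a (local) symplectic groupoid, i.e. $$S(S,I)=S(I,S),\qquad S(p,0,x)=S(0,p,x)=px,\qquad S(p,-p,x)=0.$$ Let $F\in\mathcal O_\Delta^1+\mathcal O_{\mathrm{loc}}^1$ be such that $F(-p,x)=-F(p,x)$. Then $$\tilde S:=(F(S))(F^{-1},F^{-1})$$ is also a generating function of a (local) symplectic groupoid. The subset of functions that are odd in $p$ forms a subgroup of $\mathcal O_\Delta^1+\mathcal O_{\mathrm{loc}}^1$. Moreover, $\psi_F$ is a groupoid isomorphism between the local symplectic groupoid generated by $S$ and the one generated by $\tilde S$. As a consequence, $S$ and $\tilde S$ induce the same Poisson structure on the base $\mathbb R^d$.
   Context: Fix $d\ge1$. For $n\ge0$ let $B_n:=(\mathbb R^{d*})^n\times\mathbb R^d$, $B_n^0:=\{0\}\times\mathbb R^d$, $S_0^n(p_1,\dots,p_n,x):=(p_1+\dots+p_n)x$, $\mathcal O_\Delta^n:=\{S_0^n\}$. $\mathcal O_{\mathrm{loc}}^n$ is the space of germs at $B_n^0$ of smooth real functions $\tilde F$ with $\tilde F(0,x)=0$ and $\nabla_p\tilde F(0,x)=0$. $\mathcal O_\Delta+\mathcal O_{\mathrm{loc}}$ (in degree $n$: $\{S_0^n+\tilde F\}$) is a non-symmetric operad with unit $I(p,x)=px$ and composition, for $F$ of degree $n$ and $G_i$ of degree $k_i$, $$F(G_1,\dots,G_n)(p_G,x_F)=\sum_iG_i(p_{G_i},x_{G_i})+F(p_F,x_F)-x_Gp_F,$$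 where $p_G=(p_{G_1},\dots,p_{G_n})$, and $p_F\in(\mathbb R^{d*})^n$, $x_G=(x_{G_1},\dots,x_{G_n})\in(\mathbb R^d)^n$ solve $p_F=(\nabla_xG_i(p_{G_i},x_{G_i}))_{i}$, $x_G=\nabla_pF(p_F,x_F)$ (for $p_G$ near $0$, with the solution equal to $(0,(x_F,\dots,x_F))$ at $p_G=0$). All identities are identities of germs. For $F\in\mathcal O_\Delta^1+\mathcal O_{\mathrm{loc}}^1$, $\psi_F$ is the (germ of) symplectomorphism, defined on a neighborhood of $B_1^0$ in $T^*\mathbb R^d=B_1$, $\psi_F(p_1,x_1)=(p_2,x_2)$, determined by $x_1=\nabla_pF(p_1,x_2)$, $p_2=\nabla_xF(p_1,x_2)$. $F^{-1}\in\mathcal O_\Delta^1+\mathcal O_{\mathrm{loc}}^1$ is the generating function of $(\psi_F)^{-1}$, i.e. $F(F^{-1})=F^{-1}(F)=I$; the group structure on $\mathcal O_\Delta^1+\mathcal O_{\mathrm{loc}}^1$ is given by the composition $F(G)$. A generating function $S$ satisfying the three conditions of the claim generates a Poisson structure $\alpha(x)=2\big(\nabla_{p^1_k}\nabla_{p^2_l}S(0,0,x)\big)_{k,l=1}^d$ on $\mathbb R^d$ and a local symplectic groupoid over $\mathbb R^d$ (on a neighborhood of $B_1^0$ in $T^*\mathbb R^d$) integrating it, with unit map $x\mapsto(0,x)$, inverse $(p,x)\mapsto(-p,x)$, source $s(p,x)=\nabla_{p_2}S(p,0,x)$, target $t(p,x)=\nabla_{p_1}S(0,p,x)$, and multiplication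 space (graph of the multiplication) $$G^{(m)}(S)=\{((p_1,\nabla_{p_1}S),(p_2,\nabla_{p_2}S),(\nabla_xS,x))\},$$ partial derivatives being evaluated at $(p_1,p_2,x)$ near $B_2^0$. *)

(* Defs.v *)
From HB Require Import structures.
From mathcomp Require Import all_boot all_order all_algebra.
From mathcomp Require Import all_classical all_reals all_analysis.

Set Implicit Arguments.
Unset Strict Implicit.
Unset Printing Implicit Defensive.

Import Order.TTheory GRing.Theory Num.Theory.
Import numFieldNormedType.Exports.
Local Open Scope classical_set_scope.
Local Open Scope ring_scope.

(** [set_nbhs], typed so that [\near] accepts it. *)
Definition near_set {T : topologicalType} (A : set T) : set_system T :=
  set_nbhs A.

Section Smooth.
Context {R : realType} {V W : normedModType R}.

Definition iter_derive (vs : seq V) (f : V -> W) : V -> W :=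
  foldr (fun v g => 'D_v g) f vs.

(** The quantifier over [z] is outermost, so that a single neighbourhood of [A]
    serves for the derivatives of all orders. *)
Definition smooth_near (A : set V) (f : V -> W) : Prop :=
  \forall z \near near_set A, forall vs, differentiable (iter_derive vs f) z.

End Smooth.

Section Group.
Context {T : Type}.
Variables (eqv : T -> T -> Prop) (A : set T).
Variables (mul : T -> T -> T) (e : T) (inv : T -> T).

(** Groups and subgroups whose elements are classes modulo [eqv]. *)
Record is_group : Prop := IsGroup {
  group_saturated : forall a b, eqv a b -> A a -> A b;
  group_mulP : forall a b, A a -> A b -> A (mul a b);
  group_unitP : A e;
  group_invP : forall a, A a -> A (inv a);
  group_eqv_mul : forall a a' b b', A a -> A a' -> A b -> A b' ->
    eqv a a' -> eqv b b' -> eqv (mul a b) (mul a' b');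
  group_eqv_inv : forall a a', A a -> A a' -> eqv a a' -> eqv (inv a) (inv a');
  group_mulA : forall a b c, A a -> A b -> A c ->
    eqv (mul a (mul b c)) (mul (mul a b) c);
  group_mul1 : forall a, A a -> eqv (mul e a) a /\ eqv (mul a e) a;
  group_mulV : forall a, A a -> eqv (mul (inv a) a) e /\ eqv (mul a (inv a)) e
}.

Record is_subgroup (H : set T) : Prop := IsSubgroup {
  subgroup_group : is_group;
  subgroup_sub : H `<=` A;
  subgroup_saturated : forall a b, eqv a b -> H a -> H b;
  subgroup_unit : H e;
  subgroup_mul : forall a b, H a -> H b -> H (mul a b);
  subgroup_inv : forall a, H a -> H (inv a)
}.

End Group.

Section GeneratingFunctions.
Variables (R : realType) (d : nat).

(** A point of $(\mathbb R^{d*})^n\times\mathbb R^d$ is a pair [(p, x)], where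
    the i-th row of [p] is $p_i$. *)
Definition B (n : nat) : Type := ('M[R]_(n, d) * 'rV[R]_d)%type.

Definition B0 (n : nat) : set (B n) := [set z | z.1 = 0].
Arguments B0 n : clear implicits.

(** A germ at [B0 n] is given by any total function representing it near
    [B0 n]; identities of germs are stated with [germ_eq]. *)
Definition germ_eq (n : nat) (F G : B n -> R) : Prop :=
  \forall z \near near_set (B0 n), F z = G z.

Definition pairing (p x : 'rV[R]_d) : R := (p *m x^T) 0 0.

Definition grad_p (n : nat) (F : B n -> R) (z : B n) : 'M[R]_(n, d) :=
  \matrix_(i, j) 'D_(delta_mx i j, 0) F z.

Definition grad_x (n : nat) (F : B n -> R) (z : B n) : 'rV[R]_d :=
  \row_j 'D_(0, delta_mx 0 j) F z.

Definition S0 (n : nat) : B n -> R := fun z => pairing (\sum_i row i z.1) z.2.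

Definition Oloc (n : nat) : set (B n -> R) := [set F |
  [/\ smooth_near (B0 n) F,
      forall x, F (0, x) = 0
    & forall x, grad_p F (0, x) = 0]].
Arguments Oloc n : clear implicits.

(** $\mathcal O_\Delta^n+\mathcal O_{\mathrm{loc}}^n$ *)
Definition Ogen (n : nat) : set (B n -> R) := [set F |
  exists2 Ft, Oloc n Ft & germ_eq F (fun z => S0 z + Ft z)].
Arguments Ogen n : clear implicits.

Definition unitI : B 1 -> R := fun z => pairing z.1 z.2.

(** Operadic composition. To avoid families of functions with varying numbers of
    arguments, [G i] is here $G_i$ as a function of the whole
    $p_G=(p_{G_1},\dots,p_{G_n})$, of which it only uses the block $p_{G_i}$.
    A solution [s] of the implicit equations maps $(p_G,x_F)$ to $(p_F,x_G)$;
    smoothness makes its germ unique. *)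
Definition comp_solution (n m : nat) (F : B n -> R) (G : 'I_n -> B m -> R)
    (s : B m -> 'M[R]_(n, d) * 'M[R]_(n, d)) : Prop :=
  [/\ smooth_near (B0 m) s,
      forall x, s (0, x) = (0, \matrix_(i < n) x)
    & \forall z \near near_set (B0 m),
        (s z).1 = \matrix_(i < n) grad_x (G i) (z.1, row i (s z).2) /\
        (s z).2 = grad_p F ((s z).1, z.2)].

Definition comp_sol (n m : nat) (F : B n -> R) (G : 'I_n -> B m -> R) :
    B m -> 'M[R]_(n, d) * 'M[R]_(n, d) :=
  xget (fun z => (0, \matrix_(i < n) z.2)) [set s | comp_solution F G s].

Definition ocomp (n m : nat) (F : B n -> R) (G : 'I_n -> B m -> R) : B m -> R :=
  fun z =>
    let pF := (comp_sol F G z).1 in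
    let xG := (comp_sol F G z).2 in
    \sum_i G i (z.1, row i xG) + F (pF, z.2)
    - \sum_i pairing (row i pF) (row i xG).

(** $F(G)$ *)
Definition ocomp1 (k : nat) (F : B 1 -> R) (G : B k -> R) : B k -> R :=
  ocomp F (fun=> G).

(** $F(G_1,G_2)$ *)
Definition ocomp2 (k1 k2 : nat) (F : B 2 -> R) (G1 : B k1 -> R) (G2 : B k2 -> R) :
    B (k1 + k2) -> R :=
  ocomp F (fun (i : 'I_2) (z : B (k1 + k2)) =>
    if i == 0 then G1 (usubmx z.1, z.2) else G2 (dsubmx z.1, z.2)).

Definition is_inverse (F G : B 1 -> R) : Prop :=
  [/\ Ogen 1 G, germ_eq (ocomp1 F G) unitI & germ_eq (ocomp1 G F) unitI].

Definition inverse (F : B 1 -> R) : B 1 -> R :=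
  xget unitI [set G | is_inverse F G].

Definition odd_p (F : B 1 -> R) : Prop :=
  germ_eq (fun z => F (- z.1, z.2)) (fun z => - F z).

Definition Oodd : set (B 1 -> R) := [set F | Ogen 1 F /\ odd_p F].

(** The point $(p_1,p_2,x)$ of $B_2$. *)
Definition pt2 (p1 p2 x : 'rV[R]_d) : B 2 :=
  ((col_mx p1 p2 : 'M[R]_(1 + 1, d)), x).

(** Both sides of the associativity equation are germs on $B_3$, since [2 + 1]
    and [1 + 2] are convertible. *)
Definition groupoid_gen (S : B 2 -> R) : Prop :=
  [/\ Ogen 2 S,
      germ_eq (ocomp2 S S unitI : B 3 -> R) (ocomp2 S unitI S),
      germ_eq (fun z : B 1 => S (pt2 z.1 0 z.2)) unitI,
      germ_eq (fun z : B 1 => S (pt2 0 z.1 z.2)) unitI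
    & germ_eq (fun z : B 1 => S (pt2 z.1 (- z.1) z.2)) (fun=> 0)].

(** The defining equations determine $\psi_F$ on $B_1^0$, where it is the
    identity, and hence, by continuity, its germ. *)
Definition is_psi (F : B 1 -> R) (psi : B 1 -> B 1) : Prop :=
  smooth_near (B0 1) psi /\
  \forall z \near near_set (B0 1),
    z.2 = grad_p F (z.1, (psi z).2) /\ (psi z).1 = grad_x F (z.1, (psi z).2).

Definition psi (F : B 1 -> R) : B 1 -> B 1 :=
  xget (fun z : B 1 => z) [set f | is_psi F f].

Definition omega (v w : B 1) : R := pairing v.1 w.2 - pairing w.1 v.2.

(** Germs along [B0 1] of symplectomorphisms of $T^*\mathbb R^d$ mapping the
    zero section to itself. *)
Definition germ_symplecto (f : B 1 -> B 1) : Prop :=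
  [/\ smooth_near (B0 1) f,
      (forall z, B0 1 z -> B0 1 (f z)),
      (exists g : B 1 -> B 1,
        [/\ smooth_near (B0 1) g,
            (forall z, B0 1 z -> B0 1 (g z)),
            (\forall z \near near_set (B0 1), g (f z) = z)
          & (\forall z \near near_set (B0 1), f (g z) = z)])
    & \forall z \near near_set (B0 1), forall v w : B 1,
        omega ('D_v f z) ('D_w f z) = omega v w].

Definition gpd_unit (x : 'rV[R]_d) : B 1 := (0, x).

Definition gpd_inv (z : B 1) : B 1 := (- z.1, z.2).

Definition gpd_source (S : B 2 -> R) (z : B 1) : 'rV[R]_d :=
  row 1 (grad_p S (pt2 z.1 0 z.2)).

Definition gpd_target (S : B 2 -> R) (z : B 1) : 'rV[R]_d :=
  row 0 (grad_p S (pt2 0 z.1 z.2)).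

Definition gpd_mult (S : B 2 -> R) : set (B 1 * B 1 * B 1) :=
  [set t | exists p1 p2 x : 'rV[R]_d, let z := pt2 p1 p2 x in
    t = ((p1, row 0 (grad_p S z)), (p2, row 1 (grad_p S z)), (grad_x S z, x))].

Definition unit_triples : set (B 1 * B 1 * B 1) :=
  [set t | exists x, t = (gpd_unit x, gpd_unit x, gpd_unit x)].

(** Isomorphisms, over the identity of $\mathbb R^d$, of the local symplectic
    groupoids generated by [S] and [S']. The parameters $(p_1,p_2,x)$ of a point
    of the multiplication space are among its coordinates, so they are near
    $B_2^0$ as soon as the point is near [unit_triples]. *)
Definition groupoid_iso (f : B 1 -> B 1) (S S' : B 2 -> R) : Prop :=
  [/\ germ_symplecto f,
      (forall x, f (gpd_unit x) = gpd_unit x),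
      (\forall z \near near_set (B0 1), f (gpd_inv z) = gpd_inv (f z)),
      (\forall z \near near_set (B0 1),
        gpd_source S' (f z) = gpd_source S z /\
        gpd_target S' (f z) = gpd_target S z)
    & \forall t \near near_set unit_triples,
        gpd_mult S t <-> gpd_mult S' (f t.1.1, f t.1.2, f t.2)].

Definition poisson (S : B 2 -> R) (x : 'rV[R]_d) : 'M[R]_d :=
  \matrix_(k, l)
    (2 * 'D_(delta_mx 0 k, 0) ('D_(delta_mx 1 l, 0) S) ((0, x) : B 2)).

End GeneratingFunctions.

Arguments B0 R d n : clear implicits.
Arguments Oloc R d n : clear implicits.
Arguments Ogen R d n : clear implicits.
Arguments unitI R d : clear implicits.
Arguments Oodd R d : clear implicits.
Arguments unit_triples R d : clear implicits.

(* Main.v *)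
From HB Require Import structures.
Require Import Defs.
From mathcomp Require Import all_boot all_order all_algebra.
From mathcomp Require Import all_classical all_reals all_analysis.
From mathcomp Require Import lra ring.
Import Order.TTheory GRing.Theory Num.Theory.
Import numFieldNormedType.Exports.
Local Open Scope classical_set_scope.
Local Open Scope ring_scope.

Set Implicit Arguments.
Unset Strict Implicit.
Unset Printing Implicit Defensive.

(** Near the zero section [p = 0] a generating function [F] amounts to the
Lagrangian relation that it generates, written [lag F z w] below: [w = (q, x)] is
related to the [n] points [z = (p, y)] when [y] and [q] are the gradients of [F]
at [(p, x)] in [p] and in [x]. Two facts make this a faithful dictionary. First,
[F] is recovered from its gradient in [p], because it vanishes on the zero section
([germ_eq_grad_p]). Secondly, the implicit variables of the operadic composition
are critical points of the expression that defines it, so the gradients of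
[ocomp F G] are read off from those of [F] and of the [G i] ([ocomp_grad]), and
operadic composition becomes composition of relations ([ocomp1_split],
[ocomp1_join], [ocomp2_split], [ocomp2_join]).

In degree one the relation is the graph of [psi F]. Hence [psi] turns composition
of functions into composition of maps and is injective on germs ([psi_ocomp1],
[psi_inj]), and the group laws are those of maps under composition. The inverse of
[psi F] is generated by the Legendre transform of [F] ([right_inverse]). A function
is odd in [p] exactly when its map commutes with [(p, x) |-> (- p, x)]
([odd_psi]), a condition preserved by products and inverses of maps; this is the
subgroup.

In degree two the relation is the graph of the groupoid multiplication. For
[S' := (F(S))(F^-1, F^-1)] the dictionary says that the relation of [S'] is the
image of that of [S] under [psi F] applied to all three points ([push_lag],
[pull_lag]): this is the isomorphism of multiplications. Associativity, the unit
laws and the inverse law of [S'] follow, since each of them is a property of the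
relation; for the last one [psi F] has to commute with the inversion, which is
where oddness enters. The sources agree because the source of [z] is the point
that multiplies [z] from the right without changing it, and [psi F] is symplectic
because the Hessian of [F] is symmetric. Finally the Poisson structure is twice the
derivative of the source map in the direction of [p] along the zero section, and
[psi F] is tangent to the identity in these directions because [F] is odd.

All the implicit equations are treated by one theorem, [fixpoint_along]. Each can
be written [y = K (z, y)] where the differential of [K] in [y] vanishes over the
zero section, so that [K (z, .)] is a contraction nearby. The zero section is not
compact, so the size of the contracting neighbourhoods varies along it and the
local solutions have to be glued. *)

(** * Convergence, and differentiability classes on an open set *)

Section Limits.
Variables T U W : topologicalType.
Implicit Types (a : T) (b : U) (c : W).

Lemma near_all a (P : T -> Prop) : (forall z, P z) -> \forall z \near a, P z.
Proof. exact: nearW. Qed.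

Lemma near_and a (P Q : T -> Prop) :
  (\forall z \near a, P z) -> (\forall z \near a, Q z) -> \forall z \near a, P z /\ Q z.
Proof. exact: filterI. Qed.

Lemma near_cvg (f : T -> U) a b (P : U -> Prop) :
  f z @[z --> a] --> b -> (\forall w \near b, P w) -> \forall z \near a, P (f z).
Proof. by move=> cf; exact: cf. Qed.

Lemma near_pull (f : T -> U) a (P : U -> Prop) :
  {for a, continuous f} -> (\forall w \near f a, P w) -> \forall z \near a, P (f z).
Proof. exact: near_cvg. Qed.

Lemma cvg_cont (f : T -> U) (g : U -> W) a b :
  {for b, continuous g} -> f z @[z --> a] --> b -> g (f z) @[z --> a] --> g b.
Proof. by move=> cg cf; exact: (cvg_comp _ _ cf cg). Qed.

Lemma cvg_both (f : T -> U) (g : T -> W) a b c :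
  f z @[z --> a] --> b -> g z @[z --> a] --> c -> (f z, g z) @[z --> a] --> (b, c).
Proof. by move=> cf cg; exact: cvg_pair. Qed.

Lemma cvg_fst2 (f : T -> U * W) a b c : f z @[z --> a] --> (b, c) -> (f z).1 @[z --> a] --> b.
Proof. by move=> cf; apply: (cvg_comp _ _ cf); exact: cvg_fst. Qed.

Lemma cvg_snd2 (f : T -> U * W) a b c : f z @[z --> a] --> (b, c) -> (f z).2 @[z --> a] --> c.
Proof. by move=> cf; apply: (cvg_comp _ _ cf); exact: cvg_snd. Qed.

Lemma cvg_idt a : z @[z --> a] --> a.
Proof. exact: cvg_id. Qed.
End Limits.
Arguments cvg_idt {T} a.

Section Calc.
Context {R : realType}.

(** Implicit functions are differentiated through this criterion: the candidate [L]
    is the solution of the linearized equation. *)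
Lemma differentiable_littleoP (V W : normedModType R) (f : V -> W) (x : V) :
  differentiable f x <-> exists L : {linear V -> W}, continuous L /\
    forall e, 0 < e -> \forall h \near (0:V), `|f (h + x) - f x - L h| <= e * `|h|.
Proof.
split=> [/[dup] fx /diff_locallyP[cf /eqaddoP fe]|[L [cL Le]]].
  exists ('d f x); split => // e e0.
  by have := fe e e0; apply: filterS => h /=; rewrite !fctE opprD addrA.
have E : f \o shift x = cst (f x) + L +o_ 0 id.
  by apply/eqaddoP => e e0; have := Le e e0; apply: filterS => h /=; rewrite !fctE opprD addrA.
apply/diff_locallyP; rewrite (diff_unique cL E); split => //.
Qed.

Definition mklin (V W : normedModType R) (f : V -> W) (fl : linear f) : {linear V -> W} :=
  HB.pack f (GRing.isLinear.Build R V W *:%R f fl).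

Lemma sum_pairE (V W : nmodType) (I : finType) (g : I -> V * W) :
  \sum_i g i = (\sum_i (g i).1, \sum_i (g i).2).
Proof.
rewrite [LHS]surjective_pairing; congr (_, _).
  exact: (big_morph fst).
exact: (big_morph snd).
Qed.

(** Finite dimension, through coordinates with respect to a spanning family: this is
    what reduces a statement about vectors to finitely many scalar ones. *)
Class findim (V : normedModType R) : Prop := Findim {
  findimP : exists (I : finType) (e : I -> V) (c : I -> V -> R),
    [/\ forall i, linear (c i), forall i, continuous (c i) & forall v, v = \sum_i c i v *: e i] }.

Global Instance findim_mx m n : findim 'M[R]_(m, n).
Proof.
split; exists ('I_m * 'I_n)%type, (fun ij => delta_mx ij.1 ij.2), (fun ij (A :
  'M[R]_(m,n)) => A ij.1 ij.2).
split => [i a u v|i|v]; first by rewrite !mxE.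
- exact: coord_continuous.
- by rewrite [LHS]matrix_sum_delta pair_big.
Qed.

Global Instance findim_prod (V W : normedModType R) : findim V -> findim W -> findim (V * W)%type.
Proof.
move=> [[I [e [c [lc cc Ec]]]]] [[J [f [d [ld cd Ed]]]]].
split; exists (I + J)%type, (fun k => match k with inl i => (e i, 0) | inr j => (0, f j) end),
  (fun k z => match k with inl i => c i z.1 | inr j => d j z.2 end); split.
- by case=> [i|j] a u v /=; rewrite ?lc ?ld.
- case=> [i|j] z.
    by apply: (continuous_comp (f := fst)); [exact: cvg_fst | exact: cc].
  by apply: (continuous_comp (f := snd)); [exact: cvg_snd | exact: cd].
- case=> v w; rewrite big_sumType /=.
  rewrite [in LHS](Ec v) [in LHS](Ed w).
  rewrite !sum_pairE /=; congr (_, _).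
    by rewrite [X in _ + X]big1 ?addr0 // => i _; rewrite scaler0.
  by rewrite [X in X + _]big1 ?add0r // => i _; rewrite scaler0.
Qed.

Global Instance findim_scalar : findim R.
Proof.
split; exists unit, (fun=> 1), (fun _ (t : R) => t); split => [//|i x|v].
  exact: cvg_id.
by rewrite big_const cardT enumT unlock /= addr0 [RHS]mulr1.
Qed.

Lemma pointwise_sum_ind (T : Type) (W : zmodType) (P : (T -> W) -> Prop) (I : finType) (f :
  I -> T -> W) :
  P (fun=> 0) -> (forall g h, P g -> P h -> P (fun x => g x + h x)) ->
  (forall i, P (f i)) -> P (fun x => \sum_i f i x).
Proof.
move=> P0 PD Pf; elim: (index_enum I) => [|i s IH].
  by rewrite (_ : (fun _ => _) = fun=> 0) //; apply/funext => x; rewrite big_nil.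
rewrite (_ : (fun _ => _) = fun x => f i x + \sum_(j <- s) f j x); first exact: PD.
by apply/funext => x; rewrite big_cons.
Qed.

Lemma linear_findim_continuous (V W : normedModType R) {fV : findim V} (f : V -> W) :
  linear f -> continuous f.
Proof.
case: fV => [[I [e [c [lc cc Ec]]]]] fl.
rewrite (_ : f = fun v => \sum_i c i v *: f (e i)).
  apply: (pointwise_sum_ind (P := fun g : V -> W => continuous g)) => [|g h cg ch|i] x.
  - exact: cvg_cst.
  - by apply: cvgD; [exact: cg | exact: ch].
  - by apply: cvgZr_tmp; exact: cc.
apply/funext => v; rewrite {1}(Ec v) -[f]/(mklin fl : V -> W) linear_sum.
by under eq_bigr do rewrite linearZ.
Qed.

(** Level [k] asks for [k + 1] derivatives: at level 0, [f] is differentiable on [U].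
    The levels serve for inductions, since a derivative of a composite map involves
    a composite again, one level down. *)
Fixpoint Ck (V W : normedModType R) (U : set V) (k : nat) (f : V -> W) : Prop :=
  (forall z, U z -> differentiable f z) /\
  (if k is k'.+1 then forall v, Ck U k' ('D_v f) else True).

Section Ck.
Variables (V : normedModType R) (U : set V).
Hypothesis oU : open U.
Implicit Types W : normedModType R.

Lemma Ck_diff W k (f : V -> W) z : Ck U k f -> U z -> differentiable f z.
Proof. by case: k => [|k] [H _]; exact: H. Qed.

Lemma Ck_der W k (f : V -> W) v : Ck U k.+1 f -> Ck U k ('D_v f).
Proof. by move=> [_ H]; exact: H. Qed.

Lemma CkS W k (f : V -> W) : Ck U k.+1 f -> Ck U k f.
Proof. by elim: k f => [|k IH] f [fd fD]; split => // v; apply: IH; exact: fD. Qed.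

Lemma differentiable_near_eq W (f g : V -> W) x :
  (\forall z \near x, f z = g z) -> differentiable f x -> differentiable g x.
Proof.
move=> fg /differentiable_littleoP[L [cL Lf]]; apply/differentiable_littleoP.
exists L; split=> // e e0.
have fg0 : \forall h \near (0 : V), f (h + x) = g (h + x).
  have : (h + x) @[h --> (0 : V)] --> 0 + x by apply: cvgD; [exact: cvg_id|exact: cvg_cst].
  by rewrite add0r => /(_ _ fg).
have fgx : f x = g x by exact: nbhs_singleton fg.
near=> h; rewrite -fgx -(near fg0 h) //; near: h; exact: Lf.
Unshelve. all: by end_near. Qed.

Lemma Ck_ext W k (f g : V -> W) : (forall z, U z -> f z = g z) -> Ck U k f -> Ck U k g.
Proof.
elim: k f g => [|k IH] f g fg Cf; have fgn z : U z -> \forall w \near z, f w = g w.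
- by move=> Uz; apply: filterS (open_nbhs_nbhs (conj oU Uz)).
- by split => // z Uz; apply: differentiable_near_eq (fgn z Uz) _; exact: Ck_diff Cf Uz.
- by move=> Uz; apply: filterS (open_nbhs_nbhs (conj oU Uz)).
split => [z Uz|v]; first by apply: differentiable_near_eq (fgn z Uz) _; exact: Ck_diff Cf Uz.
apply: (IH ('D_v f)); last exact: Ck_der.
by move=> z Uz; apply: near_eq_derive; exact: fgn.
Qed.

Lemma Ck_cst W k (w : W) : Ck U k (fun=> w).
Proof.
elim: k w => [|k IH] w; split; try by [move=> z _; exact: differentiable_cst|].
move=> v.
by rewrite (_ : 'D_v _ = fun=> 0) //; apply/funext => z; exact: derive_cst.
Qed.

Lemma CkD W k (f g : V -> W) : Ck U k f -> Ck U k g -> Ck U k (fun z => f z + g z).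
Proof.
elim: k f g => [|k IH] f g Cf Cg; split;
  try by [|move=> z Uz;apply: differentiableD; [exact: Ck_diff Cf Uz|exact: Ck_diff Cg Uz]].
move=> v.
apply: (@Ck_ext _ _ (fun z => 'D_v f z + 'D_v g z)); last by apply: IH; exact: Ck_der.
by move=> z Uz; rewrite deriveD //;
  apply: diff_derivable;[exact: Ck_diff Cf Uz|exact: Ck_diff Cg Uz].
Qed.

Lemma CkM k (f g : V -> R) : Ck U k f -> Ck U k g -> Ck U k (fun z => f z * g z).
Proof.
elim: k f g => [|k IH] f g Cf Cg; split;
  try by [|move=> z Uz;apply: differentiableM; [exact: Ck_diff Cf Uz|exact: Ck_diff Cg Uz]].
move=> v.
apply: (@Ck_ext _ _ (fun z => f z * 'D_v g z + g z * 'D_v f z)).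
  by move=> z Uz; rewrite deriveM //;
    apply: diff_derivable;[exact: Ck_diff Cf Uz|exact: Ck_diff Cg Uz].
by apply: CkD; apply: IH; (exact: Ck_der || exact: CkS).
Qed.

Lemma derive_comp (X W : normedModType R) (f : X -> V) (g : V -> W) z v :
  differentiable f z -> differentiable g (f z) ->
  'D_v (g \o f) z = 'D_('D_v f z) g (f z).
Proof.
move=> df dg; rewrite (deriveE v (differentiable_comp df dg)) (deriveE v df).
by rewrite (deriveE _ dg) (diff_comp df dg).
Qed.
End Ck.

Lemma Ck_lin_post (V W W' : normedModType R) (U : set V) k (l : W -> W') (f : V -> W) : open U ->
  linear l -> continuous l -> Ck U k f -> Ck U k (fun z => l (f z)).
Proof.
move=> oU ll cl; have dl w : differentiable l w by exact: (linear_differentiable (f := mklin ll)).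
elim: k f => [|k IH] f Cf; split;
  try by [|move=> z Uz;apply: (differentiable_comp (g := l)); [exact: Ck_diff Cf Uz|]].
move=> v.
apply: (@Ck_ext _ _ oU _ _ (fun z => l ('D_v f z))); last by apply: IH; exact: Ck_der.
move=> z Uz; have df := Ck_diff Cf Uz.
rewrite [RHS](derive_comp v df (dl _)) [RHS]deriveE //.
by rewrite (diff_lin (f := mklin ll)).
Qed.

Lemma Ck_lin (V W : normedModType R) (U : set V) k (l : V -> W) : open U -> linear l ->
  continuous l -> Ck U k l.
Proof.
move=> oU ll cl; have dl w : differentiable l w by exact: (linear_differentiable (f := mklin ll)).
case: k => [|k]; split => // v; apply: (@Ck_ext _ _ oU _ _ (fun=> l v)); last exact: Ck_cst.
by move=> z Uz; rewrite deriveE // (diff_lin (f := mklin ll)).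
Qed.

Lemma Ck_findim (V W : normedModType R) (U : set V) k (I : finType) (c : I -> W -> R) (e :
  I -> W) (f : V -> W) :
  open U -> (forall w, w = \sum_i c i w *: e i) -> (forall i, Ck U k (fun z => c i (f z))) ->
    Ck U k f.
Proof.
move=> oU Ec Cf; rewrite (_ : f = fun z => \sum_i c i (f z) *: e i); last by apply/funext => z.
apply: (pointwise_sum_ind (P := Ck U k)) => [|g h|i]; first exact: Ck_cst.
  exact: CkD.
apply: (Ck_lin_post (l := fun t : R => t *: e i)) => //.
  by move=> a u v; rewrite scalerDl scalerA.
by move=> t; apply: cvgZr_tmp; exact: cvg_id.
Qed.

Lemma derive_findim (V W : normedModType R) (I : finType) (c : I -> V -> R) (e : I -> V) (f :
  V -> W) z v :
  (forall v, v = \sum_i c i v *: e i) -> differentiable f z ->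
  'D_v f z = \sum_i c i v *: 'D_(e i) f z.
Proof.
move=> Ec df; rewrite deriveE // {1}(Ec v) linear_sum.
by apply: eq_bigr => i _; rewrite linearZ /= deriveE.
Qed.

(** In coordinates the chain rule writes a derivative of the composite as a sum of
    products of derivatives of [f] and of derivatives of [g] composed with [f]; the
    latter are of the same form at the level below. *)
Lemma Ck_comp (V V' W : normedModType R) {fV : findim V'} {fW : findim W} (U : set V) (U' :
  set V') k (f : V -> V') (g : V' -> W) :
  open U -> open U' -> (forall z, U z -> U' (f z)) -> Ck U k f -> Ck U' k g ->
  Ck U k (fun z => g (f z)).
Proof.
move=> oU oU' fU Cf Cg; case: fW => [[J [e' [c' [lc' cc' Ec']]]]].
apply: (Ck_findim oU Ec') => j.
move: (Ck_lin_post oU' (lc' j) (cc' j) Cg) => {Cg}.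
set h := (fun z => c' j (g z)) => Ch.
rewrite -[fun _ => _]/(fun z => h (f z)).
move: h Ch => {}g Cg.
case: fV => [[I [e [c [lc cc Ec]]]]].
elim: k f g fU Cf Cg => [|k IH] f g fU Cf Cg; split;
  try by [|move=> z Uz;apply: (differentiable_comp (g := g));
    [exact: Ck_diff Cf Uz|apply: (Ck_diff Cg); exact: fU]].
move=> v.
apply: (@Ck_ext _ _ oU _ _ (fun z => \sum_i c i ('D_v f z) * 'D_(e i) g (f z))).
  move=> z Uz; have df := Ck_diff Cf Uz; have dg := Ck_diff Cg (fU _ Uz).
  by rewrite [RHS](derive_comp v df dg) (derive_findim _ Ec dg).
apply: (pointwise_sum_ind (P := Ck U k)) => [|h h'|i]; first exact: Ck_cst.
  exact: CkD.
apply: CkM => //.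
  by apply: Ck_lin_post => //; exact: Ck_der.
exact: (IH f ('D_(e i) g) fU (CkS Cf) (Ck_der (e i) Cg)).
Qed.

Lemma Ck_inv (V : normedModType R) (U : set V) k (f : V -> R) : open U -> (forall z, U z ->
  f z != 0) ->
  Ck U k f -> Ck U k (fun z => (f z)^-1).
Proof.
move=> oU f0; elim: k f f0 => [|k IH] f f0 Cf; split;
  try by [|move=> z Uz;apply: differentiableV; [exact: Ck_diff Cf Uz|exact: f0]].
move=> v.
apply: (@Ck_ext _ _ oU _ _ (fun z => (-1) * ((f z)^-1 * (f z)^-1 * 'D_v f z))).
  move=> z Uz; rewrite deriveV ?f0 //; last by apply: diff_derivable; exact: Ck_diff Cf Uz.
  by rewrite scaleNr mulN1r expr2 invfM.
apply: CkM => //; first exact: Ck_cst.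
by do ?apply: CkM => //; try exact: Ck_der; apply: IH => //; exact: CkS.
Qed.
Lemma Ck_sum (V W : normedModType R) (U : set V) k (I : finType) (f : I -> V -> W) : open U ->
  (forall i, Ck U k (f i)) -> Ck U k (fun z => \sum_i f i z).
Proof.
move=> oU Cf; apply: (pointwise_sum_ind (P := Ck U k)) => [|g h|//]; first exact: Ck_cst.
exact: CkD.
Qed.

Lemma Ck_prod (V : normedModType R) (U : set V) k (I : finType) (f : I -> V -> R) : open U ->
  (forall i, Ck U k (f i)) -> Ck U k (fun z => \prod_i f i z).
Proof.
move=> oU Cf; elim: (index_enum I) => [|i s IH].
  by rewrite (_ : (fun _ => _) = fun=> 1) ?funeqE; [exact: Ck_cst|move=> z; rewrite big_nil].
rewrite (_ : (fun _ => _) = fun z => f i z * \prod_(j <- s) f j z); first exact: CkM.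
by apply/funext => z; rewrite big_cons.
Qed.

Lemma Ck_det (V : normedModType R) (U : set V) k n (f : V -> 'M[R]_n) : open U ->
  (forall i j, Ck U k (fun z => f z i j)) -> Ck U k (fun z => \det (f z)).
Proof.
move=> oU Cf; apply: Ck_sum => // s; apply: CkM => //; first exact: Ck_cst.
exact: Ck_prod.
Qed.

(** Cramer's rule: the entries of the inverse are rational functions of the entries. *)
Lemma Ck_invmx (V : normedModType R) (U : set V) k n (f : V -> 'M[R]_n) : open U ->
  (forall z, U z -> f z \in unitmx) ->
  (forall i j, Ck U k (fun z => f z i j)) -> forall i j, Ck U k (fun z => invmx (f z) i j).
Proof.
move=> oU ua Cf i j.
apply: (@Ck_ext _ _ oU _ _ (fun z =>
  (\det (f z))^-1 * ((-1) ^+ (j + i) * \det (row' j (col' i (f z)))))).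
  by move=> z /ua uz; rewrite /invmx uz !mxE.
apply: CkM => //.
  by apply: Ck_inv => //; [move=> z /ua; rewrite unitmxE unitfE|exact: Ck_det].
apply: CkM => //; first exact: Ck_cst.
apply: Ck_det => // i' j'.
rewrite (_ : (fun _ => _) = fun z => f z (lift j i') (lift i j')); first exact: Cf.
by apply/funext => z; rewrite !mxE.
Qed.
End Calc.

(** * Smoothness at a point *)

Section SmoothAt.
Context {R : realType}.
Implicit Types V W X : normedModType R.

Lemma Ck_sub V W (U U' : set V) k (f : V -> W) : U' `<=` U -> Ck U k f -> Ck U' k f.
Proof.
move=> sU; elim: k f => [|k IH] f Cf; split; try by [|move=> z /sU; exact: (Ck_diff Cf)].
by move=> v; apply: IH; exact: Ck_der.
Qed.

(** One open set serves for all the levels. *)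
Definition smooth_at V W (f : V -> W) (a : V) : Prop :=
  exists2 U, open_nbhs a U & forall k, Ck U k f.

(** The neighbourhoods of a set are those of all its points, so that smoothness near
    a set can be checked point by point. *)
Lemma smooth_nearP V W (A : set V) (f : V -> W) :
  smooth_near A f <-> forall a, A a -> smooth_at f a.
Proof.
split=> [sf a Aa|sf a /sf[U [oU Ua] Cf]].
  have := sf a Aa; rewrite nbhsE => -[U oU Uf]; exists U => // k.
  elim: k f {sf} Uf => [|k IH] f Uf; split; try by [|move=> z /Uf H; exact: (H [::])].
  move=> v; apply: IH => z /Uf H vs.
  have := H (rcons vs v); rewrite /iter_derive foldr_rcons; exact.
apply: filterS (open_nbhs_nbhs (conj oU Ua)) => z Uz vs.
have : forall k, Ck U k (iter_derive vs f).
  by elim: vs => [//|v vs IH] k /=; apply: Ck_der; exact: IH.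
by move=> /(_ 0); case=> /(_ z Uz).
Qed.

Lemma smooth_at_near V W (f : V -> W) a : smooth_at f a -> \forall z \near a, smooth_at f z.
Proof.
move=> [U [oU Ua] Cf]; apply: filterS (open_nbhs_nbhs (conj oU Ua)) => z Uz.
by exists U.
Qed.

Lemma smooth_at_diff V W (f : V -> W) a : smooth_at f a -> differentiable f a.
Proof. by move=> [U [oU Ua] Cf]; exact: (Ck_diff (Cf 0) Ua). Qed.

Lemma smooth_at_cont V W (f : V -> W) a : smooth_at f a -> {for a, continuous f}.
Proof. by move/smooth_at_diff; exact: differentiable_continuous. Qed.

Lemma smooth_at_ext V W (f g : V -> W) a : (\forall z \near a, f z = g z) -> smooth_at f a ->
  smooth_at g a.
Proof.
move=> fg [U [oU Ua] Cf].
have : nbhs a [set z | f z = g z] by exact: fg.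
rewrite nbhsE => -[U' [oU' U'a] {}fg].
have oI : open (U `&` U') by exact: openI.
exists (U `&` U') => [|k]; first by split.
apply: (@Ck_ext _ _ _ oI _ _ f); first by move=> z [_ /fg].
by apply: Ck_sub (Cf k) => z [].
Qed.

Lemma smooth_at_cst V W (w : W) (a : V) : smooth_at (fun=> w) a.
Proof. by exists setT => [|k]; [split => //; exact: openT | apply: Ck_cst; exact: openT]. Qed.

Lemma smooth_at_lin V W {fV : findim V} (l : V -> W) a : linear l -> smooth_at l a.
Proof.
move=> ll; exists setT => [|k]; first by split => //; exact: openT.
by apply: Ck_lin => //; [exact: openT|exact: linear_findim_continuous].
Qed.

Let smooth_at2 V W1 W2 W3 (f : V -> W1) (g : V -> W2) (h : V -> W3) a :
  (forall U k, open U -> Ck U k f -> Ck U k g -> Ck U k h) ->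
  smooth_at f a -> smooth_at g a -> smooth_at h a.
Proof.
move=> H [U [oU Ua] Cf] [U' [oU' U'a] Cg].
exists (U `&` U') => [|k]; first by split => //; exact: openI.
by apply: H; [exact: openI|apply: Ck_sub (Cf k) => z []|apply: Ck_sub (Cg k) => z []].
Qed.

Lemma smooth_atD V W (f g : V -> W) a : smooth_at f a -> smooth_at g a -> smooth_at (fun z =>
  f z + g z) a.
Proof. by apply: smooth_at2 => U k oU; exact: CkD. Qed.

Lemma smooth_atM V (f g : V -> R) a : smooth_at f a -> smooth_at g a -> smooth_at (fun z =>
  f z * g z) a.
Proof. by apply: smooth_at2 => U k oU; exact: CkM. Qed.

Lemma smooth_at_comp V W X {fW : findim W} {fX : findim X} (f : V -> W) (g : W -> X) a :
  smooth_at f a -> smooth_at g (f a) -> smooth_at (fun z => g (f z)) a.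
Proof.
move=> [U [oU Ua] Cf] [U' [oU' U'a] Cg].
have oI : open (U `&` f @^-1` U').
  rewrite openE => z [Uz U'z]; apply: filterI; first exact: open_nbhs_nbhs.
  have := differentiable_continuous (Ck_diff (Cf 0) Uz); apply.
  exact: open_nbhs_nbhs.
exists (U `&` f @^-1` U') => [|k]; first by split.
apply: (Ck_comp oI oU' _ _ (Cg k)); first by move=> z [].
by apply: Ck_sub (Cf k) => z [].
Qed.

Lemma smooth_at_der V W (f : V -> W) a v : smooth_at f a -> smooth_at ('D_v f) a.
Proof. by move=> [U oU Cf]; exists U => // k; apply: Ck_der; exact: Cf. Qed.

Lemma Ck_pair V W X (U : set V) k (f : V -> W) (g : V -> X) : open U -> Ck U k f -> Ck U k g ->
  Ck U k (fun z => (f z, g z)).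
Proof.
move=> oU Cf Cg.
rewrite (_ : (fun _ => _) = fun z => ((f z, 0) : W * X) + (0, g z)).
  apply: CkD => //.
    apply: (Ck_lin_post (l := fun u : W => ((u, 0) : W * X))) => //.
      by move=> c u v; apply/pair_equal_spec; split => /=; rewrite ?scaler0 ?addr0.
    by move=> u; apply: cvg_pair; [exact: cvg_id|exact: cvg_cst].
  apply: (Ck_lin_post (l := fun u : X => ((0, u) : W * X))) => //.
    by move=> c u v; apply/pair_equal_spec; split => /=; rewrite ?scaler0 ?addr0.
  by move=> u; apply: cvg_pair; [exact: cvg_cst|exact: cvg_id].
by apply/funext => z; apply/pair_equal_spec; split => /=; rewrite ?addr0 ?add0r.
Qed.

Lemma smooth_at_pair V W X (f : V -> W) (g : V -> X) a : smooth_at f a -> smooth_at g a ->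
  smooth_at (fun z => (f z, g z)) a.
Proof. by apply: smooth_at2 => U k oU Cf Cg; exact: Ck_pair. Qed.

Lemma smooth_at_id V (a : V) : smooth_at (fun z => z) a.
Proof.
exists setT => [|k]; first by split => //; exact: openT.
by apply: Ck_lin => //; [exact: openT|move=> z; exact: cvg_id].
Qed.

Lemma smooth_at_lin_post V W X {fW : findim W} (l : W -> X) (f : V -> W) a :
  linear l -> smooth_at f a -> smooth_at (fun z => l (f z)) a.
Proof.
move=> ll [U oU Cf]; exists U => // k; apply: Ck_lin_post => //; first by case: oU.
exact: linear_findim_continuous.
Qed.

Lemma smooth_atN V W (f : V -> W) a : smooth_at f a -> smooth_at (fun z => - f z) a.
Proof.
move=> [U oU Cf]; exists U => // k; apply: (Ck_lin_post (l := fun w : W => - w)) => //;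
  first by case: oU.
  by move=> c u v; rewrite opprD scalerN.
exact: opp_continuous.
Qed.

Lemma smooth_atB V W (f g : V -> W) a : smooth_at f a -> smooth_at g a -> smooth_at (fun z =>
  f z - g z) a.
Proof. by move=> sf sg; apply: smooth_atD => //; exact: smooth_atN. Qed.

Lemma smooth_at_sum V W (I : finType) (f : I -> V -> W) a : (forall i, smooth_at (f i) a) ->
  smooth_at (fun z => \sum_i f i z) a.
Proof.
move=> sf; apply: (pointwise_sum_ind (P := fun g : V -> W => smooth_at g a)) => //.
  exact: smooth_at_cst.
by move=> g h; exact: smooth_atD.
Qed.

Lemma smooth_at_mx V m n (f : V -> 'M[R]_(m, n)) a :
  (forall i j, smooth_at (fun z => f z i j) a) -> smooth_at f a.
Proof.
move=> sf; rewrite (_ : f = fun z => \sum_(ij : 'I_m * 'I_n) f z ij.1 ij.2 *: delta_mx ij.1 ij.2).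
  apply: smooth_at_sum => -[i j] /=.
  have [U oU Cf] := sf i j; exists U => // k.
  apply: (Ck_lin_post (l := fun t : R => t *: (delta_mx i j : 'M[R]_(m,n)))) => //; first
    by case: oU.
    by move=> b u v; rewrite scalerDl scalerA.
  by move=> t; apply: cvgZr_tmp; exact: cvg_id.
by apply/funext => z; rewrite [LHS]matrix_sum_delta pair_big.
Qed.

Lemma smooth_at_entry V m n (f : V -> 'M[R]_(m, n)) a i j :
  smooth_at f a -> smooth_at (fun z => f z i j) a.
Proof.
by apply: (smooth_at_lin_post (l := fun A : 'M[R]_(m,n) => A i j)) => b u v; rewrite !mxE.
Qed.

End SmoothAt.

(** * The mean value theorem and the symmetry of second derivatives *)

HB.instance Definition _ (R : realType) m n := Complete.copy 'M[R]_(m, n) 'M[R]_(m, n).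

Section MVT.
Context {R : realType}.
Variable V : normedModType R.

Lemma segment_mvt (f : V -> R) (a h : V) :
  (forall t, 0 <= t <= 1 -> differentiable f (a + t *: h)) ->
  exists2 t, 0 <= t <= 1 & f (a + h) - f a = 'D_h f (a + t *: h).
Proof.
move=> df.
pose l (t : R) : V := a + t *: h.
have dl (t : R) : is_derive t (1 : R) l h.
  have : is_derive t (1 : R) (cst a + (fun t : R => t *: h)) (0 + h).
    apply: is_deriveD.
    apply: DeriveDef; first exact/diff_derivable.
    rewrite deriveE //.
    by have -> : 'd (fun t : R => t *: h) t = (fun t => t *: h) :> (R -> V);
      [exact: diff_val|rewrite scale1r].
  by rewrite add0r.
have dlt (t : R) : differentiable l t by apply/derivable1_diffP; have [] := dl t.
have dg (t : R) : 0 <= t <= 1 -> is_derive t (1 : R) (f \o l) ('D_h f (l t)).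
  move=> t01; have d1 := dlt t; have d2 := df t t01.
  apply: DeriveDef; first by apply: diff_derivable; exact: differentiable_comp.
  by rewrite derive_comp //; have [_ ->] := dl t.
have [] := @MVT_segment R (f \o l) (fun t => 'D_h f (l t)) 0 1 ler01.
- by move=> x /[!in_itv]/= /andP[x0 x1]; apply: dg; rewrite !ltW.
- apply: derivable_within_continuous => x /[!in_itv]/= x01.
  by have [] := dg x x01.
- move=> t /[!in_itv]/= t01; rewrite /= /l scale1r scale0r addr0 subr0 mulr1 => E.
  by exists t.
Qed.

(** The mean value theorem is applied to [z |-> f (z + v) - f z] in the direction
    [u], then to ['D_u f] in the direction [v]. *)
Lemma second_difference (f : V -> R) (a u v : V) :
  (forall s t, 0 <= s <= 1 -> 0 <= t <= 1 -> differentiable f (a + s *: u + t *: v)) ->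
  (forall s t, 0 <= s <= 1 -> 0 <= t <= 1 -> differentiable ('D_u f) (a + s *: u + t *: v)) ->
  exists s t, [/\ 0 <= s <= 1, 0 <= t <= 1 &
    f (a + u + v) - f (a + u) - (f (a + v) - f a) = 'D_v ('D_u f) (a + s *: u + t *: v)].
Proof.
move=> df dDf.
have z01 : 0 <= (0 : R) <= 1 by rewrite lexx ler01.
have o01 : 0 <= (1 : R) <= 1 by rewrite lexx ler01.
have dsh s : 0 <= s <= 1 -> differentiable (f \o shift v) (a + s *: u).
  move=> s01; apply: differentiable_comp.
    by apply: differentiableD => //; exact: differentiable_cst.
  by have := df s 1 s01 o01; rewrite scale1r.
have dn s : 0 <= s <= 1 -> differentiable f (a + s *: u).
  by move=> s01; have := df s 0 s01 z01; rewrite scale0r addr0.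
have [s s01 E] := @segment_mvt (fun z => (f \o shift v) z - f z) a u
  (fun s s01 => differentiableB (dsh s s01) (dn s s01)).
have [t t01 E'] := @segment_mvt ('D_u f) (a + s *: u) v (fun t t01 => dDf s t s01 t01).
exists s, t; split => //.
apply: (etrans E); rewrite -E'.
apply: (etrans (deriveB (diff_derivable (v := u) (dsh _ s01)) (diff_derivable (v :=
  u) (dn _ s01)))).
congr (_ - _).
have dv : differentiable (shift v) (a + s *: u).
  by apply: differentiableD => //; exact: differentiable_cst.
have dv' : differentiable f (shift v (a + s *: u)).
  by have := df s 1 s01 o01; rewrite scale1r.
rewrite (derive_comp u dv dv').
suff -> : 'D_u (shift v) (a + s *: u) = u by [].
have -> : shift v = (id + cst v) :> (V -> V) by [].
by rewrite deriveD // derive_id derive_cst addr0.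
Qed.

Lemma derive_scale (W : normedModType R) (f : V -> W) z s u : differentiable f z ->
  'D_(s *: u) f z = s *: 'D_u f z.
Proof. by move=> df; rewrite !deriveE // linearZ. Qed.

(** The second difference of [f] over a small parallelogram is symmetric in [u] and
    [v], while [second_difference] equates it to either mixed derivative at some
    point of the parallelogram; the points tend to [a] with the parallelogram. *)
Lemma smooth_schwarz (f : V -> R) a u v : smooth_at f a -> 'D_u ('D_v f) a = 'D_v ('D_u f) a.
Proof.
move=> sf.
apply/eqP; rewrite -subr_eq0 -normr_le0; apply/ler_addgt0Pl => e e0; rewrite addr0.
have suv := smooth_at_der u (smooth_at_der v sf).
have svu := smooth_at_der v (smooth_at_der u sf).
have e20 : 0 < e / 2 by rewrite divr_gt0.
have n1 : \forall z \near a, `|'D_u ('D_v f) a - 'D_u ('D_v f) z| < e / 2.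
  by have /cvgrPdist_lt := smooth_at_cont suv; apply.
have n2 : \forall z \near a, `|'D_v ('D_u f) a - 'D_v ('D_u f) z| < e / 2.
  by have /cvgrPdist_lt := smooth_at_cont svu; apply.
have [r r0 Hr] : exists2 r, 0 < r & forall z, `|a - z| < r ->
   [/\ smooth_at f z, `|'D_u ('D_v f) a - 'D_u ('D_v f) z| < e / 2 &
       `|'D_v ('D_u f) a - 'D_v ('D_u f) z| < e / 2].
  have := smooth_at_near sf; move/(filterI n1)/(filterI n2)/nbhs_ballP => [r /= r0 Hr].
  by exists r => // z; rewrite -ball_normE in Hr => /Hr [H2 [H1 H0]].
(* the parallelogram with sides [q *: u] and [q *: v] stays within distance [r] of [a] *)
pose q := r / (1 + `|u| + `|v|).
have D0 : 0 < 1 + `|u| + `|v| by rewrite -addrA ltr_wpDr // addr_ge0.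
have q0 : 0 < q by rewrite divr_gt0.
have near_s x y s t : `|x| + `|y| = `|u| + `|v| ->  0 <= s <= 1 -> 0 <= t <= 1 ->
  `|a - (a + s *: (q *: x) + t *: (q *: y))| < r.
  move=> xy /andP[s0 s1] /andP[t0 t1]; rewrite -addrA opprD addrA subrr add0r normrN.
  apply: le_lt_trans (ler_normD _ _) _; rewrite !normrZ !ger0_norm //; try exact: ltW.
  apply: (@le_lt_trans _ _ (q * (`|x| + `|y|))).
    rewrite mulrDr lerD //; first by rewrite ler_piMl // mulr_ge0 // ltW.
    by rewrite ler_piMl // mulr_ge0 // ltW.
  rewrite xy /q mulrAC ltr_pdivrMr // ltr_pM2l //.
  by rewrite -addrA ltrDr.
have scal x y z : smooth_at f z -> 'D_(q *: x) ('D_(q *: y) f) z = q * q * 'D_x ('D_y f) z.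
  move=> sz; rewrite derive_scale; last by apply: smooth_at_diff; exact: smooth_at_der.
  rewrite (near_eq_derive (g := q *: 'D_y f)); last first.
    by apply: filterS (smooth_at_near sz) => w sw; rewrite derive_scale //; exact: smooth_at_diff.
  rewrite deriveZ; last by apply: diff_derivable; apply: smooth_at_diff; exact: smooth_at_der.
  by rewrite scalerA.
have main x y : `|x| + `|y| = `|u| + `|v| -> exists2 z, `|a - z| < r &
  f (a + q *: x + q *: y) - f (a + q *: x) - (f (a + q *: y) - f a) = q * q * 'D_y ('D_x f) z.
  move=> xy.
  have [s t s01 t01|s t s01 t01|s [t [s01 t01 E]]] := @second_difference f a (q *: x) (q *: y).
  - by apply: smooth_at_diff; have [] := Hr _ (near_s x y _ _ xy s01 t01).
  - by apply: smooth_at_diff; apply: smooth_at_der; have [] := Hr _ (near_s x y _ _ xy s01 t01).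
  - have Hz := near_s x y _ _ xy s01 t01; exists (a + s *: (q *: x) + t *: (q *: y)) => //.
    by rewrite E scal //; have [] := Hr _ Hz.
have [z1 z1r E1] := main u v erefl.
have [z2 z2r E2] := main v u (addrC _ _).
have E12 : 'D_v ('D_u f) z1 = 'D_u ('D_v f) z2.
  apply: (@mulfI _ (q * q)); first by rewrite mulf_neq0 // gt_eqF.
  apply: (etrans (esym E1)); apply: etrans E2; rewrite (addrAC a).
  by move: (f (a + q *: v + q *: u)) (f (a + q *: u)) (f (a + q *: v)) (f a) => x1 x2 x3 x4; ring.
have [_ _ H1] := Hr _ z1r; have [_ H2 _] := Hr _ z2r.
move: H1 H2; rewrite E12.
move: ('D_u ('D_v f) a) ('D_v ('D_u f) a) ('D_u ('D_v f) z2) => A B w Bw Aw.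
apply: le_trans (ler_distD w _ _) _.
rewrite distrC in Bw; rewrite [leRHS](splitr e).
exact: (lerD (ltW Aw) (ltW Bw)).
Qed.
End MVT.

(** * Contractions depending on a parameter *)

Section Contraction.
Context {R : realType}.

Lemma findim_ord (V : normedModType R) {fV : findim V} :
  exists (n : nat) (e : 'I_n -> V) (c : 'I_n -> V -> R),
    [/\ forall i, linear (c i), forall i, continuous (c i) & forall v, v = \sum_i c i v *: e i].
Proof.
case: fV => [[I [e [c [lc cc Ec]]]]].
exists #|I|, (fun k => e (enum_val k)), (fun k => c (enum_val k)); split=> // v.
by rewrite [LHS]Ec big_enum_val.
Qed.

Variables (Z : normedModType R) (Y : completeNormedModType R).
Context {fZ : findim Z} {fY : findim Y}.
Variable K : Z * Y -> Y.

(** The bound on the differential makes the linearized equation solvable, the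
    Lipschitz bound gives existence and uniqueness of fixed points; both hold on
    the same box, inside an open set on which [K] is smooth. *)
Definition contracting_box (z0 : Z) (y0 : Y) (r : R) : Prop :=
  [/\ 0 < r,
    exists2 U, open U & (forall k, Ck U k K) /\ forall z y, `|z0 - z| < r -> `|y0 - y| < r ->
      U (z, y),
    forall z y h, `|z0 - z| < r -> `|y0 - y| < r -> `|'D_(0, h) K (z, y)| <= 2^-1 * `|h|
    & forall z y y', `|z0 - z| < r -> `|y0 - y| < r -> `|y0 - y'| < r ->
       `|K (z, y) - K (z, y')| <= 2^-1 * `|y - y'|].

Lemma near_prod_box (z0 : Z) (y0 : Y) (P : Z * Y -> Prop) :
  (\forall w \near (z0, y0), P w) ->
  exists2 r, 0 < r & forall z y, `|z0 - z| < r -> `|y0 - y| < r -> P (z, y).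
Proof.
move=> /nbhs_ballP [r /= r0 Hr]; exists r => // z y zr yr; apply: Hr.
by split; rewrite -ball_normE.
Qed.

(** The coefficients of the differential of [K] in the second variable vanish at the
    base point, so they are small nearby, and the mean value theorem turns this
    smallness into a Lipschitz constant. *)
Lemma contracting_box_exists z0 y0 : smooth_at K (z0, y0) -> (forall h, 'D_(0, h) K (z0, y0) = 0) ->
  exists r, contracting_box z0 y0 r.
Proof.
move=> sK DK0.
have [I [e [c [lc cc Ec]]]] := findimP (V := Y).
have Cb i : exists2 C, 0 < C & forall y, `|c i y| <= C * `|y|.
  exact: (@linear_lipschitz R Y R (mklin (lc i)) (cc i)).
have {Cb}[C HC] := @choice _ _ (fun i C => 0 < C /\ forall y, `|c i y| <= C * `|y|)
   (fun i => let: ex_intro2 C H1 H2 := Cb i in ex_intro _ C (conj H1 H2)).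
pose q (ij : I * I) (w : Z * Y) : R := `|e ij.1| * C ij.2 * `|c ij.1 ('D_(0, e ij.2) K w)|.
have Cge0 j : 0 <= C j by have [/ltW] := HC j.
(* there are [#|{: I * I}|] coefficients to be bounded; 1 is added so as to cover dimension 0 *)
have N0 : 0 < 2^-1 / (1 + #|{: I * I}|%:R) :> R by rewrite divr_gt0 ?invr_gt0 // ltr_pwDl.
have nq ij : \forall w \near (z0, y0), q ij w < 2^-1 / (1 + #|{: I * I}|%:R).
  have sD := smooth_at_der (0, e ij.2) sK.
  have cq : {for (z0, y0), continuous (q ij)}.
    apply: cvgM; first exact: cvg_cst.
    apply: cvg_norm.
    exact: (continuous_comp (smooth_at_cont sD) (cc ij.1 _)).
  have q0 : q ij (z0, y0) = 0.
    by rewrite /q DK0 -[c ij.1]/(mklin (lc ij.1) : Y -> R) linear0 normr0 mulr0.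
  apply: (near_pull (P := fun t => t < _) cq); rewrite q0.
  exact: (lt_nbhsl N0).
have nq' : \forall w \near (z0, y0), forall ij, q ij w < 2^-1 / (1 + #|{: I * I}|%:R)
  by exact: (filter_forall _ nq).
have [U [oU Uzy] CU] := sK.
have [r r0 Hr] := near_prod_box (filterI (open_nbhs_nbhs (conj oU Uzy)) nq').
have key (xi : I -> Z * Y) h : (forall i, exists z y, [/\ xi i = (z, y), `|z0 - z| < r &
  `|y0 - y| < r]) ->
   `|\sum_i (\sum_j c j h * c i ('D_(0, e j) K (xi i))) *: e i| <= 2^-1 * `|h|.
  move=> Hxi; apply: le_trans (ler_norm_sum _ _ _) _.
  apply: (@le_trans _ _ (\sum_(i : I) \sum_(j : I) (2^-1 / (1 + #|{: I * I}|%:R)) * `|h|)).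
    apply: ler_sum => i _; rewrite normrZ mulrC.
    apply: le_trans (ler_wpM2l (normr_ge0 _) (ler_norm_sum _ _ _)) _.
    rewrite mulr_sumr; apply: ler_sum => j _; rewrite normrM.
    have [z [y [-> zr yr]]] := Hxi i; have [_ /(_ (i, j)) qlt] := Hr _ _ zr yr.
    apply: (@le_trans _ _ (q (i, j) (z, y) * `|h|)); last by rewrite ler_wpM2r // ltW.
    rewrite /q /= -!mulrA ler_wpM2l // [leLHS]mulrC [leRHS]mulrCA ler_wpM2l //.
    by have [_] := HC j; exact.
  rewrite pair_bigA /= sumr_const -[leLHS]mulr_natr mulrAC ler_wpM2r // -mulrA.
  by rewrite ler_piMr // ?invr_ge0 // mulrC ler_pdivrMr ?ltr_pwDl // mul1r lerDr.
have DcK i z y h : `|z0 - z| < r -> `|y0 - y| < r ->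
    'D_(0, h) (fun w => c i (K w)) (z, y) = c i ('D_(0, h) K (z, y)).
  move=> zr yr; have [Uw _] := Hr _ _ zr yr; have dK := Ck_diff (CU 0) Uw.
  have lin : differentiable (c i) (K (z, y)) by exact: (linear_differentiable (f :=
    mklin (lc i)) _ (cc i)).
  rewrite (derive_comp (f := K) (g := c i) _ dK lin) deriveE //.
  by rewrite (diff_lin (f := mklin (lc i)) _ (cc i)).
have Dlin z y h : `|z0 - z| < r -> `|y0 - y| < r ->
    'D_(0, h) K (z, y) = \sum_j c j h *: 'D_(0, e j) K (z, y).
  move=> zr yr; have [Uw _] := Hr _ _ zr yr; have dK := Ck_diff (CU 0) Uw.
  rewrite deriveE // (_ : (0, h) = \sum_j c j h *: ((0, e j) : Z * Y)).
    by rewrite linear_sum; apply: eq_bigr => j _; rewrite linearZ /= deriveE.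
  by rewrite sum_pairE /= -Ec big1 // => j _; rewrite scaler0.
exists r; split => //.
- by exists U => //; split => // z y zr yr; have [] := Hr _ _ zr yr.
- move=> z y h zr yr.
  rewrite [X in `|X|]Ec.
  under eq_bigr => i _.
    rewrite Dlin // -[c i]/(mklin (lc i) : Y -> R) linear_sum.
    under eq_bigr do rewrite linearZ /=.
    over.
  by apply: (key (fun=> (z, y))) => i; exists z, y.
- move=> z y y' zr yr y'r.
  have sg t : 0 <= t <= 1 -> `|y0 - (y' + t *: (y - y'))| < r.
    move=> /andP[t0 t1].
    have -> : y0 - (y' + t *: (y - y')) = (1 - t) *: (y0 - y') + t *: (y0 - y).
      have E : y0 - y - (y0 - y') = - (y - y').
        by rewrite opprB addrC addrA subrK opprB.
      by rewrite scalerBl scale1r -addrA [- _ + _]addrC -scalerBr E scalerN opprD addrA.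
    apply: le_lt_trans (ler_normD _ _) _; rewrite !normrZ !ger0_norm ?subr_ge0 //.
    have [->|tn0] := eqVneq t 0; first by rewrite subr0 mul1r mul0r addr0.
    have tp : 0 < t by rewrite lt_def tn0.
    apply: (@lt_le_trans _ _ ((1 - t) * r + t * r)); last by rewrite -mulrDl subrK mul1r.
    by rewrite ler_ltD // ?ltr_pM2l // ler_wpM2l ?subr_ge0 // ltW.
  have mv i : exists2 t, 0 <= t <= 1 & c i (K (z, y) - K (z, y')) = c i ('D_(0, y - y') K (z,
    y' + t *: (y - y'))).
    have [t t01|t t01 E] := @segment_mvt R (Z * Y)%type (fun w => c i (K w)) (z, y') (0, y - y').
      have -> : (z, y') + t *: (0, y - y') = (z, y' + t *: (y - y')) :> Z * Y.
        by apply/pair_equal_spec; rewrite /= scaler0 addr0.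
      have [Uw _] := Hr _ _ zr (sg t t01); have dK := Ck_diff (CU 0) Uw.
      by apply: (differentiable_comp (g := c i)) => //; exact: (linear_differentiable (f :=
        mklin (lc i)) _ (cc i)).
    exists t => //; rewrite -[c i]/(mklin (lc i) : Y -> R) linearB /= -DcK //; last exact: sg.
    move: E; have -> : (z, y') + t *: (0, y - y') = (z, y' + t *: (y - y')) :> Z * Y.
      by apply/pair_equal_spec; rewrite /= scaler0 addr0.
    have -> : (z, y') + (0, y - y') = (z, y) :> Z * Y.
      by apply/pair_equal_spec; rewrite /= addr0 addrC subrK.
    by move=> ->.
  have [t Ht] := @choice _ _ (fun i t => 0 <= t <= 1 /\ _)
    (fun i => let: ex_intro2 t H1 H2 := mv i in ex_intro _ t (conj H1 H2)).
  rewrite [X in `|X|]Ec.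
  under eq_bigr => i _.
    have [ti Ei] := Ht i.
    rewrite Ei Dlin //; last exact: sg.
    rewrite -[c i]/(mklin (lc i) : Y -> R) linear_sum.
    under eq_bigr do rewrite linearZ /=.
    over.
  apply: (key (fun i => (z, y' + t i *: (y - y')))) => i.
  by exists z, (y' + t i *: (y - y')); split => //; apply: sg; have [] := Ht i.
Qed.
End Contraction.

(** * Smooth dependence of a fixed point on the parameter *)

Section ImplicitFunction.
Context {R : realType}.
Variables (Z : normedModType R) (Y : completeNormedModType R).
Context {fZ : findim Z} {fY : findim Y}.
Variable K : Z * Y -> Y.

Lemma box_unique z0 y0 r z y y' : contracting_box K z0 y0 r -> `|z0 - z| < r ->
  `|y0 - y| < r -> `|y0 - y'| < r ->
  y = K (z, y) -> y' = K (z, y') -> y = y'.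
Proof.
move=> [_ _ _ H] zr yr y'r Ey Ey'; have := H z y y' zr yr y'r; rewrite -Ey -Ey' => L.
apply/eqP; rewrite -subr_eq0 -normr_le0.
have := normr_ge0 (y - y'); move: `|y - y'| L => t; lra.
Qed.

(** [K (z, .)] maps the closed ball of radius [rho] into itself as soon as it moves
    the centre by at most [rho / 2]. *)
Lemma box_fixpoint z0 y0 r rho : contracting_box K z0 y0 r -> y0 = K (z0, y0) -> 0 < rho ->
  rho < r ->
  \forall z \near z0, exists2 y, `|y0 - y| <= rho & y = K (z, y).
Proof.
move=> [r0 [V oV [CV sV]] _ H] E0 rho0 rhor.
have Vzy : V (z0, y0) by apply: sV; rewrite subrr normr0.
have cK : {for (z0, y0), continuous K} := differentiable_continuous (Ck_diff (CV 0) Vzy).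
have cKz : K (z, y0) @[z --> z0] --> K (z0, y0).
  apply: (continuous_comp (f := fun z => (z, y0)) (g := K)); last exact: cK.
  by apply: cvg_pair; [exact: cvg_id|exact: cvg_cst].
have rho2 : 0 < rho / 2 by rewrite divr_gt0.
have n1 : \forall z \near z0, `|y0 - K (z, y0)| < rho / 2.
  by move/cvgrPdist_lt: cKz => /(_ _ rho2); rewrite -E0.
have n2 : \forall z \near z0, `|z0 - z| < r.
  by have /cvgrPdist_lt := @cvg_id _ (nbhs z0); apply.
near=> z.
have zr : `|z0 - z| < r by near: z.
have Kz : `|y0 - K (z, y0)| < rho / 2 by near: z.
pose U := closed_ball_ (fun y : Y => `|y|) y0 rho.
have fU : {homo (fun y => K (z, y)) : y / U y >-> U y}.
  move=> y Uy; rewrite /U /closed_ball_ /=.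
  have yr : `|y0 - y| < r by exact: le_lt_trans rhor.
  have := H z y0 y zr; rewrite subrr normr0 => /(_ r0 yr) H1.
  have -> : y0 - K (z, y) = (y0 - K (z, y0)) + (K (z, y0) - K (z, y)) by rewrite addrA subrK.
  apply: le_trans (ler_normD _ _) _.
  have Uy' : `|y0 - y| <= rho by [].
  by move: Kz H1 Uy'; move: `|_| `|_| `|_| => t1 t2 t3; lra.
have ctr : is_contraction (mkfun_fun fU).
  have h1 : 0 <= 2^-1 :> R by rewrite invr_ge0.
  exists (NngNum h1); split => /=; first by rewrite invf_lt1 // ltr1n.
  move=> -[y y'] [/= Uy Uy']; apply: H => //; exact: le_lt_trans rhor.
have cU : closed U by exact: closed_closed_ball_.
have [|y Uy Ey] := banach_fixed_point ctr cU.
  by exists y0; rewrite /U /closed_ball_ /= subrr normr0 ltW.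
by exists y.
Unshelve. all: by end_near. Qed.


Variables (n : nat) (e : 'I_n -> Y) (c : 'I_n -> Y -> R).
Hypotheses (lc : forall i, linear (c i)) (cc : forall i, continuous (c i))
  (Ec : forall v, v = \sum_i c i v *: e i).

Let dKmx (w : Z * Y) : 'M[R]_n := \matrix_(j, i) c i ('D_(0, e j) K w).
Let dKrow (v : Z) (w : Z * Y) : 'rV[R]_n := \row_i c i ('D_(v, 0) K w).
(** The solution [y] of the linearized equation ['D_(v, y) K w = y]. At
    [w = (z, s z)] it is the derivative of the implicit function [s] in the
    direction [v]. *)
Let sol (v : Z) (w : Z * Y) : Y := \sum_i (dKrow v w *m invmx (1%:M - dKmx w)) 0 i *: e i.

Let csum (I : finType) (a : I -> R) (y : I -> Y) i : c i (\sum_j a j *: y j) =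
  \sum_j a j * c i (y j).
Proof.
rewrite -[c i]/(mklin (lc i) : Y -> R) linear_sum.
by apply: eq_bigr => j _; rewrite linearZ.
Qed.

Let combc (x : 'rV[R]_n) w i : differentiable K w ->
  (x *m dKmx w) 0 i = c i ('D_(0, \sum_j x 0 j *: e j) K w).
Proof.
move=> dK; rewrite mxE deriveE //.
have -> : (0, \sum_j x 0 j *: e j) = \sum_j x 0 j *: ((0, e j) : Z * Y).
  by rewrite sum_pairE /= [in RHS]big1 // => j _; rewrite scaler0.
rewrite linear_sum.
under [X in c i X]eq_bigr do rewrite linearZ /=.
by rewrite csum; apply: eq_bigr => j _; rewrite mxE deriveE.
Qed.

Let comb (x : 'rV[R]_n) w : differentiable K w ->
  'D_(0, \sum_j x 0 j *: e j) K w = \sum_i (x *m dKmx w) 0 i *: e i.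
Proof. by move=> dK; rewrite [LHS]Ec; apply: eq_bigr => i _; rewrite combc. Qed.

(** A vector in the kernel is fixed by the differential of [K], which at least halves norms. *)
Lemma unit_dK w : differentiable K w -> (forall h, `|'D_(0, h) K w| <= 2^-1 * `|h|) ->
  1%:M - dKmx w \in unitmx.
Proof.
move=> dK H; rewrite -row_free_unit; apply: inj_row_free => x.
rewrite mulmxBr mulmx1 => /subr0_eq xE.
have := H (\sum_j x 0 j *: e j); rewrite comb // -xE => L.
have h0 : \sum_j x 0 j *: e j = 0.
  apply/eqP; rewrite -normr_le0.
  by have := normr_ge0 (\sum_j x 0 j *: e j); move: `|_| L => t; lra.
apply/rowP => i; rewrite xE [RHS]mxE combc // h0 deriveE // linear0.
exact: (linear0 (mklin (lc i))).
Qed.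

Lemma sol_eq v w : differentiable K w -> (forall h, `|'D_(0, h) K w| <= 2^-1 * `|h|) ->
  sol v w = 'D_(v, 0) K w + 'D_(0, sol v w) K w.
Proof.
move=> dK H; rewrite {2}/sol comb //.
rewrite [X in X + _]Ec -big_split /=; apply: eq_bigr => i _; rewrite -scalerDl; congr (_ *: _).
set x := dKrow v w *m _.
have E : x *m (1%:M - dKmx w) = dKrow v w by rewrite mulmxKV // unit_dK.
have : x = dKrow v w + x *m dKmx w by rewrite -[in RHS]E mulmxBr mulmx1 subrK.
by move=> /(congr1 (fun M : 'rV_n => M 0 i)) ->; rewrite mxE; congr (_ + _); rewrite mxE.
Qed.

Lemma sol_unique v w y : differentiable K w -> (forall h, `|'D_(0, h) K w| <= 2^-1 * `|h|) ->
  y = 'D_(v, 0) K w + 'D_(0, y) K w -> y = sol v w.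
Proof.
move=> dK H Ey; have Es := sol_eq v dK H.
have E : y - sol v w = 'D_(0, y - sol v w) K w.
  rewrite {1}Ey {1}Es opprD addrACA subrr add0r !deriveE // -linearB; congr ('d K w _).
  by apply/pair_equal_spec; rewrite /= subrr.
apply/eqP; rewrite -subr_eq0 -normr_le0; have := H (y - sol v w); rewrite -E.
by have := normr_ge0 (y - sol v w); move: `|_| => t; lra.
Qed.

Lemma sol_linear w : differentiable K w -> (forall h, `|'D_(0, h) K w| <= 2^-1 * `|h|) ->
  linear (sol^~ w).
Proof.
move=> dK H a u v; apply/esym/sol_unique => //.
move: (sol u w) (sol v w) (sol_eq u dK H) (sol_eq v dK H) => su sv Eu Ev.
have -> : 'D_(a *: u + v, 0) K w = a *: 'D_(u, 0) K w + 'D_(v, 0) K w.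
  rewrite !deriveE // -linearZ -linearD; congr ('d K w _).
  by apply/pair_equal_spec; rewrite /= scaler0 addr0.
have -> : 'D_(0, a *: su + sv) K w = a *: 'D_(0, su) K w + 'D_(0, sv) K w.
  rewrite !deriveE // -linearZ -linearD; congr ('d K w _).
  by apply/pair_equal_spec; rewrite /= scaler0 addr0.
by rewrite {1}Eu {1}Ev scalerDr addrACA.
Qed.

(** The remainder [r] of [s] at first order satisfies [r = 'D_(0, r) K + o(h, r)], and
    the differential of [K] at least halves norms, so [r] itself is [o(h)]. *)
Lemma fixpoint_diff (s : Z -> Y) z : differentiable K (z, s z) ->
  (forall h, `|'D_(0, h) K (z, s z)| <= 2^-1 * `|h|) ->
  {for z, continuous s} -> (\forall x \near z, s x = K (x, s x)) ->
  differentiable s z /\ forall v, 'D_v s z = sol v (z, s z).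
Proof.
move=> dK H cs sE.
pose L := mklin (sol_linear dK H).
have cL : continuous L by exact: (linear_findim_continuous (sol_linear dK H)).
suff sL : forall eps, 0 < eps -> \forall h \near (0 : Z), `|s (h + z) - s z - L h| <= eps * `|h|.
  have ds : differentiable s z by apply/differentiable_littleoP; exists L.
  split => // v; rewrite deriveE // (@diff_unique _ _ _ _ L) //.
  apply/eqaddoP => eps eps0; have := sL eps eps0; apply: filterS => h.
  by rewrite !fctE opprD addrA.
move=> eps eps0.
have [C C0 HC] := linear_lipschitz cL.
(* with this precision for [K] the remainder is at most [4 * del * (1 + C) * `|h|] *)
pose del := Num.min (4^-1) (eps / (4 * (1 + C))) : R.
have C10 : 0 < 4 * (1 + C) by rewrite mulr_gt0 // ltr_wpDl.
have del0 : 0 < del by rewrite lt_min invr_gt0 ltr0n /= divr_gt0.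
have del4 : del <= 4^-1 by rewrite ge_min lexx.
have delC : del * (4 * (1 + C)) <= eps.
  by rewrite -ler_pdivlMr // ge_min lexx orbT.
have [/= dKc /eqaddoP/(_ del del0)] := (diff_locallyP (z, s z) K).1 dK => Kd.
have sh : h + z @[h --> (0 : Z)] --> z.
  have : h + z @[h --> (0 : Z)] --> 0 + z by apply: cvgD; [exact: cvg_id|exact: cvg_cst].
  by rewrite add0r.
have csh : s (h + z) - s z @[h --> (0 : Z)] --> (0 : Y).
  rewrite -(subrr (s z)); apply: cvgB; last exact: cvg_cst.
  exact: (cvg_comp _ _ sh cs).
have cpair : (h, s (h + z) - s z) @[h --> (0 : Z)] --> ((0, 0) : Z * Y).
  by apply: cvg_pair => //; exact: cvg_id.
have n1 := cpair _ Kd.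
have n2 : \forall h \near (0 : Z), s (h + z) = K (h + z, s (h + z)) := sh _ sE.
near=> h.
have E1 : s (h + z) = K (h + z, s (h + z)) by near: h.
have : `|(K \o shift (z, s z) - (cst (K (z, s z)) + 'd K (z, s z))) (h,
  s (h + z) - s z)| <= del * `|(h, s (h + z) - s z)|.
  by near: h.
rewrite !fctE /=.
have -> : (h, s (h + z) - s z) + (z, s z) = (h + z, s (h + z)).
  by apply/pair_equal_spec; rewrite /= subrK.
rewrite -E1 -(nbhs_singleton sE).
set D := s (h + z) - s z; set r := D - L h.
have EL : L h = 'd K (z, s z) (h, 0) + 'd K (z, s z) (0, L h).
  by rewrite -!deriveE //; exact: sol_eq.
have EDh : 'd K (z, s z) (h, D) = L h + 'd K (z, s z) (0, r).
  rewrite EL -linearD -linearD; congr ('d K (z, s z) _).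
  by apply/pair_equal_spec; rewrite /= !addr0 add0r /r addrC subrK.
have -> : s (h + z) - (s z + 'd K (z, s z) (h, D)) = r - 'd K (z, s z) (0, r).
  by rewrite EDh opprD addrA -/D /r opprD addrA.
have Hr := H r; rewrite deriveE // in Hr.
move=> L1.
have L2 : `|r| <= `|r - 'd K (z, s z) (0, r)| + `|'d K (z, s z) (0, r)|.
  by rewrite -{1}(subrK ('d K (z, s z) (0, r)) r); exact: ler_normD.
have L3 : `|(h, D)| <= `|h| + (C * `|h| + `|r|).
  have D1 : `|D| <= C * `|h| + `|r|.
    by rewrite -(subrK (L h) D) addrC; apply: le_trans (ler_normD _ _) _; rewrite lerD2r.
  have -> : `|(h, D)| = Num.max `|h| `|D| by [].
  rewrite ge_max; apply/andP; split.
    by rewrite lerDl; apply: addr_ge0 => //; apply: mulr_ge0 => //; exact: ltW.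
  by apply: le_trans D1 _; rewrite lerDr.
have L4 : del * `|(h, D)| <= del * `|h| + del * C * `|h| + del * `|r|.
  apply: (@le_trans _ _ (del * (`|h| + (C * `|h| + `|r|)))); first by rewrite ler_wpM2l // ltW.
  by rewrite !mulrDr addrA mulrA.
have L5 : del * `|r| <= 4^-1 * `|r| by rewrite ler_wpM2r.
have L6 : 4 * (del * `|h|) + 4 * (del * C * `|h|) <= eps * `|h|.
  apply: (@le_trans _ _ (del * (4 * (1 + C)) * `|h|)); last by rewrite ler_wpM2r.
  by move: `|h| => t; have -> : 4 * (del * t) + 4 * (del * C * t) = del * (4 * (1 + C)) * t by ring.
move: L1 L2 L4 L5 L6 Hr.
move: (del * C * `|h|) (del * `|h|) (eps * `|h|) (del * `|(h, D)|) (del * `|r|) => t7 t8 t9 t10 t6.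
move: `|r - _| `|'d K _ _| `|r| => t1 t2 t4.
lra.
Unshelve. all: by end_near. Qed.


(** The derivatives of [s] are given by [sol] at [(z, s z)], that is, as rational
    functions of the derivatives of [K] along the graph of [s]; so [s] gains a
    level. *)
Lemma fixpoint_Ck (s : Z -> Y) (U : set Z) (U' : set (Z * Y)) : open U -> open U' ->
  (forall k, Ck U' k K) -> (forall z, U z -> U' (z, s z)) ->
  (forall z h, U z -> `|'D_(0, h) K (z, s z)| <= 2^-1 * `|h|) ->
  (forall z, U z -> {for z, continuous s}) -> (forall z, U z -> s z = K (z, s z)) ->
  forall k, Ck U k s.
Proof.
move=> oU oU' CK sU' H cs sE.
have dK z : U z -> differentiable K (z, s z) by move=> Uz; exact: Ck_diff (CK 0) (sU' _ Uz).
have ds z : U z -> differentiable s z /\ forall v, 'D_v s z = sol v (z, s z).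
  move=> Uz; apply: fixpoint_diff; [exact: dK|by move=> h; exact: H|exact: cs|].
  by apply: filterS (open_nbhs_nbhs (conj oU Uz)).
elim=> [|k IH]; split; try by [|move=> z Uz; have [] := ds z Uz].
move=> v; apply: (@Ck_ext _ _ _ oU _ _ (fun z => sol v (z, s z))).
  by move=> z Uz; have [_ ->] := ds z Uz.
have Cid : Ck U k (fun z : Z => z).
  by apply: Ck_lin => //; move=> z; exact: cvg_id.
have Czs : Ck U k (fun z => (z, s z)) by exact: Ck_pair.
have CD i w : Ck U k (fun z => c i ('D_w K (z, s z))).
  apply: (Ck_lin_post (l := c i)) => //.
  exact: (Ck_comp oU oU' sU' Czs (Ck_der w (CK k.+1))).
apply: Ck_sum => // i.
apply: (Ck_lin_post (l := fun t : R => t *: e i)) => //.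
  by move=> a x y; rewrite scalerDl scalerA.
  by move=> t; apply: cvgZr_tmp; exact: cvg_id.
rewrite (_ : (fun _ => _) = fun z => \sum_j dKrow v (z, s z) 0 j * invmx (1%:M - dKmx (z,
  s z)) j i); last first.
  by apply/funext => z; rewrite mxE.
apply: Ck_sum => // j; apply: CkM => //.
  rewrite (_ : (fun _ => _) = fun z => c j ('D_(v, 0) K (z, s z))); first exact: CD.
  by apply/funext => z; rewrite mxE.
apply: Ck_invmx => // [z Uz|i' j'].
  by apply: unit_dK; [exact: dK|move=> h; exact: H].
rewrite (_ : (fun _ => _) = fun z => (1%:M : 'M[R]_n) i' j' + - 1 * c j' ('D_(0, e i') K (z, s z))).
  by apply: CkD => //; [exact: Ck_cst|apply: CkM => //; exact: Ck_cst].
by apply/funext => z; rewrite !mxE mulN1r.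
Qed.

End ImplicitFunction.

Section FixedPointAlongSet.
Context {R : realType}.
Variables (Z : normedModType R) (Y : completeNormedModType R).
Context {fZ : findim Z} {fY : findim Y}.
Variable K : Z * Y -> Y.

(** As [A] may be non-compact, each [a] in [A] has a box of its own radius [r a], and
    [s z] is the fixed point lying in one of the boxes shrunk to radius [rho a].
    Fixed points over the same [z] in two of the small boxes coincide, because the
    larger of the two big boxes contains both. *)
Theorem fixpoint_along (A : set Z) (y0 : Z -> Y) : continuous y0 ->
  (forall a, A a -> smooth_at K (a, y0 a)) ->
  (forall a, A a -> K (a, y0 a) = y0 a) ->
  (forall a h, A a -> 'D_(0, h) K (a, y0 a) = 0) ->
  exists s : Z -> Y, forall a, A a ->
    [/\ smooth_at s a, s a = y0 a, (\forall z \near a, s z = K (z, s z))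
     & (\forall w \near (a, y0 a), w.2 = K w -> w.2 = s w.1)].
Proof.
move=> cy0 sK K0 DK.
(* the centres of two small boxes over one [z] are less than [2 * rho] apart *)
have box a : exists r rho, A a -> [/\ 0 < rho, 4 * rho <= r, contracting_box K a (y0 a) r &
    forall a', `|a - a'| < 2 * rho -> `|y0 a - y0 a'| < r / 4].
  have [Aa|nA] := pselect (A a); last by exists 0, 0.
  have [r Br] := contracting_box_exists (sK _ Aa) (fun h => DK a h Aa).
  have r0 : 0 < r by case: Br.
  have r40 : 0 < r / 4 by rewrite divr_gt0.
  have /nbhs_ballP[del /= del0 Hdel] : \forall a' \near a, `|y0 a - y0 a'| < r / 4.
    by have /cvgrPdist_lt := cy0 a; apply.
  exists r, (Num.min (r / 4) (del / 2)) => _; split => //.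
  - by rewrite lt_min r40 divr_gt0.
  - by rewrite mulrC -ler_pdivlMr // ge_min lexx.
  - move=> a' aa'; apply: Hdel; rewrite -ball_normE /=; apply: lt_le_trans aa' _.
    by rewrite mulrC -ler_pdivlMr // ge_min lexx orbT.
have [r /choice[rho Hr]] := choice box.
pose N z y := exists2 a, A a & `|a - z| < rho a /\ `|y0 a - y| < rho a.
have uniq z y y' : N z y -> N z y' -> y = K (z, y) -> y' = K (z, y') -> y = y'.
  move=> [a Aa [az ay]] [a' Aa' [a'z a'y']].
  wlog le : a a' y y' Aa az ay Aa' a'z a'y' / rho a' <= rho a => [W|].
    have [le|/ltW le] := leP (rho a') (rho a); first exact: (W a a' y y').
    by move=> Ey Ey'; apply/esym; apply: (W a' a y' y).
  have [rho0 rhor Br y0c] := Hr a Aa.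
  have rr : rho a < r a.
    by apply: lt_le_trans rhor; rewrite ltr_pMl // ltr1n.
  apply: (box_unique Br); [exact: lt_trans rr|exact: lt_trans rr|].
  have aa' : `|a - a'| < 2 * rho a.
    apply: le_lt_trans (ler_distD z _ _) _; rewrite [`|z - _|]distrC.
    by rewrite mulr_natl mulr2n ltrD //; exact: (lt_le_trans a'z le).
  have H1 := y0c _ aa'.
  apply: le_lt_trans (ler_distD (y0 a') _ _) _.
  move: H1 a'y' rhor rr le; move: `|_| `|_| (rho a) (rho a') (r a) rho0 => t1 t2 t3 t4 t5; lra.
pose s z := xget (y0 z) [set y | N z y /\ y = K (z, y)].
have sP z y : N z y -> y = K (z, y) -> y = s z.
  move=> Ny Ey; have [Ns Es] : [set y | N z y /\ y = K (z, y)] (s z).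
    by apply: (xgetPex (y0 z)); exists y.
  exact: uniq Es.
exists s => a Aa; have [rho0 rhor Br _] := Hr a Aa.
have rr : rho a < r a by apply: lt_le_trans rhor; rewrite ltr_pMl // ltr1n.
have sa : s a = y0 a.
  by apply/esym/sP; [exists a => //; rewrite !subrr !normr0|rewrite K0].
have na : \forall z \near a, `|a - z| < rho a.
  by have /cvgrPdist_lt := @cvg_id _ (nbhs a); apply.
have ns : \forall z \near a, [/\ `|a - z| < rho a, `|y0 a - s z| < rho a & s z = K (z, s z)].
  have h0 : 0 < rho a / 2 by rewrite divr_gt0.
  have hr : rho a / 2 < rho a by rewrite ltr_pdivrMr // ltr_pMr // ltr1n.
  apply: filterS2 na (box_fixpoint Br (esym (K0 a Aa)) h0 (lt_trans hr rr)) => z az [y yle Ey].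
  have ylt : `|y0 a - y| < rho a by exact: le_lt_trans hr.
  by have <- : y = s z by apply: sP => //; exists a.
split => //.
- have : nbhs a [set z | [/\ `|a - z| < rho a, `|y0 a - s z| < rho a & s z = K (z, s z)]]
  by exact: ns.
  rewrite nbhsE => -[U [oU Ua] HU].
  have [r0 [U' oU' [CK sU']] HD HK] := Br.
  have inbox z : U z -> `|a - z| < r a /\ `|y0 a - s z| < r a.
    by move=> /HU[h1 h2 _]; split; exact: lt_trans rr.
  exists U; first by split.
  have [n [e [c [lc cc Ec]]]] := findim_ord (V := Y).
  apply: (fixpoint_Ck lc cc Ec oU oU' CK).
  + by move=> z /inbox[h1 h2]; exact: sU'.
  + by move=> z h /inbox[h1 h2]; exact: HD.
  + move=> z Uz; apply/cvgrPdist_lt => eps eps0.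
    have [az sz] := inbox z Uz; have [_ _ Ez] := HU z Uz.
    have cK : {for (z, s z), continuous K} :=
      differentiable_continuous (Ck_diff (CK 0) (sU' _ _ az sz)).
    have cKz : K (x, s z) @[x --> z] --> K (z, s z).
      apply: (continuous_comp (f := fun x => (x, s z)) (g := K)); last exact: cK.
      by apply: cvg_pair; [exact: cvg_id|exact: cvg_cst].
    have e2 : 0 < eps / 2 by rewrite divr_gt0.
    have n1 : \forall x \near z, `|K (z, s z) - K (x, s z)| < eps / 2.
      by move/cvgrPdist_lt: cKz; apply.
    apply: filterS2 n1 (open_nbhs_nbhs (conj oU Uz)) => x h1 Ux.
    have [ax sx] := inbox x Ux; have [_ _ Ex] := HU x Ux.
    have h2 := HK x (s z) (s x) ax sz sx.
    have h3 : `|s z - s x| <= `|K (z, s z) - K (x, s z)| + `|K (x, s z) - K (x, s x)|.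
      by rewrite {1}Ez {1}Ex; exact: ler_distD.
    by move: h1 h2 h3; move: `|_| `|_| `|_| => t1 t2 t3; lra.
  + by move=> z /HU[].
- by apply: filterS ns => z [].
- apply/nbhs_ballP; exists (rho a) => // -[z y] [] /=; rewrite -!ball_normE /= => az ay Ey.
  by apply: sP => //; exists a.
Qed.
End FixedPointAlongSet.

(** * Rules of differentiation and gradients *)

Section Rules.
Context {R : realType}.
Implicit Types V W X : normedModType R.

Lemma derive_const_along V W (f : V -> W) z v : (forall t : R, f (t *: v + z) = f z) ->
  'D_v f z = 0.
Proof.
move=> H; rewrite /derive.
rewrite (_ : (fun h => _) = cst 0); first exact: lim_cst.
by apply/funext => h /=; rewrite H subrr scaler0.
Qed.

Lemma derive_lin V W {fV : findim V} (l : V -> W) z v : linear l -> 'D_v l z = l v.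
Proof.
move=> ll; have cl : continuous l by exact: linear_findim_continuous.
have dl : differentiable l z by exact: (linear_differentiable (f := mklin ll) z cl).
by rewrite (deriveE v dl) (diff_lin (f := mklin ll) z cl).
Qed.

Lemma derive_lin_post V W X {fW : findim W} (l : W -> X) (f : V -> W) z v : linear l ->
  differentiable f z ->
  'D_v (fun z => l (f z)) z = l ('D_v f z).
Proof.
move=> ll df; have cl : continuous l by exact: linear_findim_continuous.
have dl : differentiable l (f z) by exact: (linear_differentiable (f := mklin ll) (f z) cl).
by rewrite (derive_comp (g := l) v df dl) derive_lin.
Qed.

Lemma derive_pair V W X (f : V -> W) (g : V -> X) z v : differentiable f z -> differentiable g z ->
  'D_v (fun z => (f z, g z)) z = ('D_v f z, 'D_v g z).
Proof. by move=> df dg; rewrite !deriveE ?diff_pair //; exact: differentiable_pair. Qed.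


Lemma derive_mul V (f g : V -> R) z v : differentiable f z -> differentiable g z ->
  'D_v (fun z => f z * g z) z = f z * 'D_v g z + g z * 'D_v f z.
Proof. by move=> df dg; apply: deriveM; exact: diff_derivable. Qed.

Lemma derive_add V W (f g : V -> W) z v : differentiable f z -> differentiable g z ->
  'D_v (fun z => f z + g z) z = 'D_v f z + 'D_v g z.
Proof. by move=> df dg; apply: deriveD; exact: diff_derivable. Qed.

Lemma derive_sub V W (f g : V -> W) z v : differentiable f z -> differentiable g z ->
  'D_v (fun z => f z - g z) z = 'D_v f z - 'D_v g z.
Proof. by move=> df dg; apply: deriveB; exact: diff_derivable. Qed.

Lemma derive_bigsum V W (I : finType) (f : I -> V -> W) z v : (forall i, differentiable (f i) z) ->
  'D_v (fun z => \sum_i f i z) z = \sum_i 'D_v (f i) z.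
Proof.
move=> df; suff [] : differentiable (fun z => \sum_i f i z) z /\ 'D_v (fun z =>
  \sum_i f i z) z = \sum_i 'D_v (f i) z by [].
elim: (index_enum I) => [|i s [IH1 IH2]].
  rewrite (_ : (fun _ => _) = fun=> 0); last by apply/funext => w; rewrite big_nil.
  by rewrite big_nil; split; [exact: differentiable_cst|exact: derive_cst].
rewrite (_ : (fun _ => _) = fun w => f i w + \sum_(j <- s) f j w); last by apply/funext => w;
  rewrite big_cons.
rewrite big_cons; split; first exact: differentiableD.
by rewrite derive_add // IH2.
Qed.

Lemma derive_entry V m n (f : V -> 'M[R]_(m, n)) z v i j : differentiable f z ->
  'D_v (fun z => f z i j) z = 'D_v f z i j.
Proof.
by apply: (derive_lin_post (l := fun A : 'M[R]_(m, n) => A i j)) => a u w; rewrite !mxE.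
Qed.

(** The variation of [sigma] does not contribute, because [sigma z] is critical. *)
Lemma envelope V W (Psi : V * W -> R) (sigma : V -> W) z v :
  differentiable Psi (z, sigma z) -> differentiable sigma z ->
  (forall h, 'D_(0, h) Psi (z, sigma z) = 0) ->
  'D_v (fun z => Psi (z, sigma z)) z = 'D_(v, 0) Psi (z, sigma z).
Proof.
move=> dP ds H.
have did : differentiable (fun z : V => z) z by [].
have dp : differentiable (fun z => (z, sigma z)) z by exact: differentiable_pair.
rewrite (derive_comp (f := fun z => (z, sigma z)) (g := Psi) v dp dP) derive_pair // derive_id.
rewrite deriveE // -[RHS]addr0 -(H ('D_v sigma z)) !deriveE // -linearD; congr ('d Psi _ _).
by apply/pair_equal_spec; rewrite /= addr0 add0r.
Qed.
End Rules.

Section Gradients.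
Context {R : realType} {d : nat}.
Notation B n := (B R d n).

Lemma nearB0P n (P : B n -> Prop) :
  (\forall z \near near_set (B0 R d n), P z) <-> forall x, \forall z \near ((0, x) : B n), P z.
Proof.
split=> [H x|H [p x] /= p0]; first exact: H.
by rewrite /B0 /= in p0; rewrite p0; exact: H.
Qed.

Lemma smoothB0P n (W : normedModType R) (f : B n -> W) :
  smooth_near (B0 R d n) f <-> forall x, smooth_at f ((0, x) : B n).
Proof.
rewrite smooth_nearP; split=> [H x|H [p x] /= p0]; first exact: H.
by rewrite /B0 /= in p0; rewrite p0; exact: H.
Qed.

Lemma pairingE (p x : 'rV[R]_d) : pairing p x = \sum_j p 0 j * x 0 j.
Proof. by rewrite /pairing mxE; apply: eq_bigr => j _; rewrite mxE. Qed.

Definition dot n (A C : 'M[R]_(n, d)) : R := \sum_i pairing (row i A) (row i C).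

Lemma dotE n (A C : 'M[R]_(n, d)) : dot A C = \sum_i \sum_j A i j * C i j.
Proof. by apply: eq_bigr => i _; rewrite pairingE; apply: eq_bigr => j _; rewrite !mxE. Qed.

Lemma dot1 (p x : 'rV[R]_d) : dot p x = pairing p x.
Proof. by rewrite /dot big_ord1 !row_id. Qed.

Lemma dotC n (A C : 'M[R]_(n, d)) : dot A C = dot C A.
Proof. by rewrite !dotE; apply: eq_bigr => i _; apply: eq_bigr => j _; rewrite mulrC. Qed.

Lemma dot_linear n (C : 'M[R]_(n, d)) : linear (fun A : 'M[R]_(n, d) => dot A C : R).
Proof.
move=> a u v; rewrite !dotE scaler_sumr -big_split /=; apply: eq_bigr => i _.
rewrite scaler_sumr -big_split /=; apply: eq_bigr => j _.
by rewrite !mxE mulrDl -mulrA.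
Qed.

Lemma dot0l n (C : 'M[R]_(n, d)) : dot 0 C = 0.
Proof. exact: (linear0 (mklin (dot_linear C))). Qed.

Lemma dot0r n (C : 'M[R]_(n, d)) : dot C 0 = 0.
Proof. by rewrite dotC dot0l. Qed.

Lemma dotNl n (A C : 'M[R]_(n, d)) : dot (- A) C = - dot A C.
Proof. exact: (linearN (mklin (dot_linear C))). Qed.

Lemma dot_delta n i j (C : 'M[R]_(n, d)) : dot (delta_mx i j) C = C i j.
Proof.
rewrite dotE (bigD1 i) //= (bigD1 j) //= mxE !eqxx mul1r big1 ?addr0; last first.
  by move=> k /negPf kj; rewrite mxE kj andbF mul0r.
rewrite big1 ?addr0 // => k /negPf ki; apply: big1 => l _.
by rewrite mxE ki mul0r.
Qed.

Lemma smooth_dot (V : normedModType R) n (f g : V -> 'M[R]_(n, d)) z :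
  smooth_at f z -> smooth_at g z -> smooth_at (fun z => dot (f z) (g z)) z.
Proof.
move=> sf sg; rewrite (_ : (fun _ => _) = fun z => \sum_i \sum_j f z i j * g z i j); last first.
  by apply/funext => w; rewrite dotE.
by apply: smooth_at_sum => i; apply: smooth_at_sum => j; apply: smooth_atM; exact: smooth_at_entry.
Qed.

Lemma derive_dot (V : normedModType R) n (f g : V -> 'M[R]_(n, d)) z v :
  differentiable f z -> differentiable g z ->
  'D_v (fun z => dot (f z) (g z)) z = dot (f z) ('D_v g z) + dot ('D_v f z) (g z).
Proof.
move=> df dg.
rewrite (_ : (fun _ => _) = fun z => \sum_i \sum_j f z i j * g z i j); last first.
  by apply/funext => w; rewrite dotE.
have de (h : V -> 'M[R]_(n, d)) i j : differentiable h z -> differentiable (fun z => h z i j) z.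
  move=> dh; apply: (differentiable_comp (g := fun M : 'M[R]_(n, d) => M i j)) => //.
  exact: differentiable_coord.
have dm i j : differentiable (fun z => f z i j * g z i j) z by apply: differentiableM; exact: de.
rewrite derive_bigsum; last first.
  move=> i; rewrite (_ : (fun _ => _) = \sum_(j < d) (fun z => f z i j * g z i j));
    first exact: differentiable_sum.
  by apply/funext => w; rewrite fct_sumE.
rewrite !dotE -big_split /=; apply: eq_bigr => i _.
rewrite derive_bigsum // -big_split /=; apply: eq_bigr => j _.
by rewrite derive_mul; [rewrite !derive_entry // [X in _ + X]mulrC|exact: de|exact: de].
Qed.

Lemma derive_grad n (F : B n -> R) z h k : differentiable F z ->
  'D_(h, k) F z = dot h (grad_p F z) + dot k (grad_x F z).
Proof.
move=> dF; rewrite deriveE //.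
have -> : (h, k) = \sum_i \sum_j h i j *: ((delta_mx i j, 0) : B n) + \sum_j k 0 j *: ((0,
  delta_mx 0 j) : B n).
  apply/pair_equal_spec; rewrite !sum_pairE /=; split.
    rewrite [X in _ + X]big1 ?addr0; last by move=> j _; rewrite scaler0.
    rewrite [LHS]matrix_sum_delta; apply: eq_bigr => i _.
    by rewrite sum_pairE.
  rewrite [X in X + _]big1 ?add0r; last first.
    by move=> i _; rewrite sum_pairE /= big1 // => j _; rewrite scaler0.
  by rewrite [LHS]row_sum_delta.
rewrite linearD !linear_sum /= !dotE; congr (_ + _).
  apply: eq_bigr => i _; rewrite linear_sum; apply: eq_bigr => j _.
  by rewrite linearZ mxE /= deriveE.
by rewrite big_ord1; apply: eq_bigr => j _; rewrite linearZ mxE /= deriveE.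
Qed.

Lemma smooth_grad_p n (F : B n -> R) z : smooth_at F z -> smooth_at (grad_p F) z.
Proof.
move=> sF; apply: smooth_at_mx => i j.
rewrite (_ : (fun _ => _) = 'D_(delta_mx i j, 0) F); first exact: smooth_at_der.
by apply/funext => w; rewrite mxE.
Qed.

Lemma smooth_grad_x n (F : B n -> R) z : smooth_at F z -> smooth_at (grad_x F) z.
Proof.
move=> sF; apply: smooth_at_mx => i j.
rewrite (_ : (fun _ => _) = 'D_(0, delta_mx 0 j) F); first exact: smooth_at_der.
by apply/funext => w; rewrite mxE.
Qed.

Lemma grad_p_ext n (F G : B n -> R) z : (\forall w \near z, F w = G w) -> grad_p F z = grad_p G z.
Proof. by move=> FG; apply/matrixP => i j; rewrite !mxE; exact: near_eq_derive. Qed.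

Lemma grad_x_ext n (F G : B n -> R) z : (\forall w \near z, F w = G w) -> grad_x F z = grad_x G z.
Proof. by move=> FG; apply/matrixP => i j; rewrite !mxE; exact: near_eq_derive. Qed.

(** On the zero section [F] is constant in [x]. *)
Lemma grad_x0 n (F : B n -> R) : (forall x, F (0, x) = 0) -> forall x, grad_x F (0, x) = 0.
Proof.
move=> F0 x; apply/matrixP => i j; rewrite !mxE; apply: derive_const_along => t.
by rewrite F0 -(F0 (t *: delta_mx 0 j + x)); congr F; apply/pair_equal_spec;
  rewrite /= scaler0 addr0.
Qed.

Lemma S0E n (z : B n) : S0 z = dot z.1 (\matrix_(i < n) z.2).
Proof.
rewrite /S0 /dot pairingE; under eq_bigr do rewrite summxE mulr_suml.
rewrite exchange_big /=; apply: eq_bigr => i _; rewrite rowK pairingE.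
by apply: eq_bigr => j _; rewrite !mxE.
Qed.

Let rows_linear n : linear (fun z : B n => \matrix_(i < n) z.2).
Proof. by move=> a u v; apply/matrixP => i j; rewrite !mxE. Qed.

Lemma smooth_S0 n z : smooth_at (@S0 R d n) z.
Proof.
rewrite (_ : @S0 R d n = fun z => dot z.1 (\matrix_(i < n) z.2)); last by apply/funext => w;
  rewrite S0E.
apply: smooth_dot; apply: smooth_at_lin => //; exact: rows_linear.
Qed.

Lemma grad_p_S0 n x : grad_p (@S0 R d n) (0, x) = \matrix_(i < n) x.
Proof.
rewrite (_ : @S0 R d n = fun z => dot z.1 (\matrix_(i < n) z.2)); last by apply/funext => w;
  rewrite S0E.
have d1 : differentiable (fun z : B n => z.1) (0, x).
  by apply: smooth_at_diff; apply: smooth_at_lin.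
have d2 : differentiable (fun z : B n => \matrix_(i < n) z.2) (0, x).
  by apply: smooth_at_diff; apply: smooth_at_lin; exact: rows_linear.
apply/matrixP => i j; rewrite [LHS]mxE.
apply: (etrans (derive_dot (delta_mx i j, 0) d1 d2)); rewrite /= dot0l add0r.
by rewrite (derive_lin (l := fun z : B n => z.1)) // dot_delta mxE.
Qed.

(** Membership prescribes the one-jet of [F] along the zero section; in this form it is
    checked and used without naming the part of [F] that lies in [Oloc]. *)
Lemma OgenP n (F : B n -> R) : Ogen R d n F <->
  [/\ forall x, smooth_at F ((0, x) : B n), forall x, F (0, x) = 0
    & forall x, grad_p F (0, x) = \matrix_(i < n) x].
Proof.
have S00 x : @S0 R d n (0, x) = 0 by rewrite S0E dot0l.
have sS x : smooth_at (@S0 R d n) ((0, x) : B n) by exact: smooth_S0.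
have dsum F' G' x : differentiable F' ((0, x) : B n) -> differentiable G' ((0, x) : B n) ->
    grad_p (fun z => F' z + G' z) ((0, x) : B n) = grad_p F' (0, x) + grad_p G' (0, x).
  by move=> dF dG; apply/matrixP => i j; rewrite !mxE derive_add.
split=> [[Ft [/smoothB0P sF F0 DF] /nearB0P FE]|[sF F0 DF]].
  split=> x.
  - apply: (@smooth_at_ext _ _ _ (fun z => S0 z + Ft z)); last exact: smooth_atD.
    by apply: filterS (FE x) => z ->.
  - by rewrite (nbhs_singleton (FE x)) S00 F0 addr0.
  - rewrite (grad_p_ext (FE x)) dsum; [|exact: smooth_at_diff|exact: smooth_at_diff].
    by rewrite DF grad_p_S0 addr0.
exists (fun z => F z - S0 z); last by apply/nearB0P => x; apply: near_all => z; rewrite addrC subrK.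
split.
- by apply/smoothB0P => x; exact: smooth_atB.
- by move=> x; rewrite F0 S00 subrr.
- move=> x; apply/(addrI (grad_p (@S0 R d n) (0, x))).
  rewrite -dsum; [|exact: smooth_at_diff|apply: smooth_at_diff; exact: smooth_atB].
  rewrite addr0 grad_p_S0 -DF; apply: grad_p_ext; apply: near_all => z.
  by rewrite addrC subrK.
Qed.
End Gradients.

(** * Operadic composition and its gradients *)

Section Composition.
Context {R : realType} {d : nat}.
Notation B n := (B R d n).
Notation rows n x := (\matrix_(i < n) x : 'M[R]_(n, d)).

Lemma smooth_rows (V : normedModType R) n (f : 'I_n -> V -> 'rV[R]_d) z :
  (forall i, smooth_at (f i) z) -> smooth_at (fun z => \matrix_(i < n) f i z) z.
Proof.
move=> sf; apply: smooth_at_mx => i j.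
rewrite (_ : (fun _ => _) = fun w => f i w 0 j); first exact: smooth_at_entry.
by apply/funext => w; rewrite mxE.
Qed.

Lemma smooth_row (V : normedModType R) n (f : V -> 'M[R]_(n, d)) i z :
  smooth_at f z -> smooth_at (fun z => row i (f z)) z.
Proof.
apply: (smooth_at_lin_post (l := fun A : 'M[R]_(n, d) => row i A)).
by move=> a u v; rewrite linearP.
Qed.

Lemma smooth_fst (V W X : normedModType R) (f : X -> V * W) {fV : findim V} {fW : findim W} z :
  smooth_at f z -> smooth_at (fun z => (f z).1) z.
Proof. exact: (smooth_at_lin_post (l := fun w : V * W => w.1)). Qed.

Lemma smooth_snd (V W X : normedModType R) (f : X -> V * W) {fV : findim V} {fW : findim W} z :
  smooth_at f z -> smooth_at (fun z => (f z).2) z.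
Proof. exact: (smooth_at_lin_post (l := fun w : V * W => w.2)). Qed.

Variables (n m : nat) (F : B n -> R) (G : 'I_n -> B m -> R).
Hypothesis OF : Ogen R d n F.
Hypothesis sG : forall i x, smooth_at (G i) ((0, x) : B m).
Hypothesis G0 : forall i x, G i (0, x) = 0.

Let sF : forall x, smooth_at F ((0, x) : B n). Proof. by have [] := (OgenP F).1 OF. Qed.
Let F0 : forall x, F (0, x) = 0. Proof. by have [] := (OgenP F).1 OF. Qed.
Let DF : forall x, grad_p F (0, x) = rows n x. Proof. by have [] := (OgenP F).1 OF. Qed.

Definition compA (w : B m * 'M[R]_(n, d)) : 'M[R]_(n, d) :=
  \matrix_(i < n) grad_x (G i) (w.1.1, row i w.2).

Lemma compA0 x y : compA ((0, x), y) = 0.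
Proof. by apply/row_matrixP => i; rewrite rowK row0 grad_x0. Qed.

Lemma smooth_compA x : smooth_at compA ((0, x) : B m, rows n x).
Proof.
apply: smooth_rows => i.
apply: (smooth_at_comp (f := fun w : B m * 'M[R]_(n, d) => (w.1.1, row i w.2) : B m)).
  apply: smooth_at_pair; last by apply: smooth_row; apply: smooth_snd; exact: smooth_at_id.
  by apply: smooth_fst; apply: smooth_fst; exact: smooth_at_id.
by rewrite /= rowK; apply: smooth_grad_x; exact: sG.
Qed.

Definition compK (w : B m * 'M[R]_(n, d)) : 'M[R]_(n, d) := grad_p F (compA w, w.1.2).

(** Inserting the first implicit equation into the second leaves an equation for the
    positions alone. On the zero section [compA] vanishes whatever the positions, so
    [compK] is constant in them. *)
Lemma comp_fixpoint : exists y : B m -> 'M[R]_(n, d), forall x,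
  [/\ smooth_at y ((0, x) : B m), y (0, x) = rows n x,
   (\forall z \near ((0, x) : B m), y z = compK (z, y z)) &
   (\forall w \near (((0, x) : B m), rows n x), w.2 = compK w -> w.2 = y w.1)].
Proof.
have [|a|a|a h|y Hy] := @fixpoint_along R (_ * _)%type _ _ _ compK (B0 R d m) (fun z => rows n z.2).
- apply: linear_findim_continuous => a u v.
  by apply/matrixP => i j; rewrite !mxE.
- case: a => p x /= p0; rewrite /B0 /= in p0; rewrite p0.
  apply: (smooth_at_comp (f := fun w => (compA w, w.1.2) : B n)).
    apply: smooth_at_pair; first exact: smooth_compA.
    by apply: smooth_snd; apply: smooth_fst; exact: smooth_at_id.
  by rewrite /= compA0; exact: smooth_grad_p.
- by case: a => p x /= p0; rewrite /B0 /= in p0; rewrite p0 /compK compA0 DF.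
- case: a => p x /= p0; rewrite /B0 /= in p0; rewrite p0.
  apply: derive_const_along => t; rewrite /compK.
  have -> : t *: (0, h) + (0, x, rows n x) = (0, x, t *: h + rows n x) :> B m * 'M[R]_(n, d).
    by apply/pair_equal_spec; rewrite /= scaler0 add0r.
  by rewrite !compA0.
- by exists y => x; have := Hy (0, x) erefl.
Qed.

Lemma comp_sol_solution : comp_solution F G (comp_sol F G).
Proof.
have [y Hy] := comp_fixpoint.
apply: (@xgetPex _ (fun z : B m => (0, rows n z.2)) [set s | comp_solution F G s]).
exists (fun z => (compA (z, y z), y z)); split.
- apply/smoothB0P => x; have [sy y0 _ _] := Hy x.
  apply: smooth_at_pair => //.
  apply: (smooth_at_comp (f := fun z => (z, y z))).
    by apply: smooth_at_pair => //; exact: smooth_at_id.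
  by rewrite /= y0; exact: smooth_compA.
- by move=> x; have [_ -> _ _] := Hy x; rewrite compA0.
- by apply/nearB0P => x; have [_ _ + _] := Hy x; apply: filterS => z E; split.
Qed.

Lemma comp_sol_smooth x : smooth_at (comp_sol F G) ((0, x) : B m).
Proof. by have [/smoothB0P] := comp_sol_solution. Qed.

Lemma comp_sol0 x : comp_sol F G (0, x) = (0, rows n x).
Proof. by have [_] := comp_sol_solution. Qed.

Lemma comp_sol_eq x : \forall z \near ((0, x) : B m),
  (comp_sol F G z).1 = compA (z, (comp_sol F G z).2) /\
  (comp_sol F G z).2 = grad_p F ((comp_sol F G z).1, z.2).
Proof. by have [_ _ /nearB0P] := comp_sol_solution. Qed.

Lemma comp_sol_unique x : \forall t \near (((0, x) : B m), ((0, rows n x) : 'M[R]_(n,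
  d) * 'M[R]_(n, d))),
  t.2.1 = compA (t.1, t.2.2) -> t.2.2 = grad_p F (t.2.1, t.1.2) -> t.2 = comp_sol F G t.1.
Proof.
have [y Hy] := comp_fixpoint; have [sy y0 yE yU] := Hy x.
set T := (B m * ('M[R]_(n, d) * 'M[R]_(n, d)))%type.
have c1 : {for (((0, x), (0, rows n x)) : T), continuous (fun t : T => (t.1, t.2.2))}.
  apply: smooth_at_cont; apply: smooth_at_pair.
    by apply: smooth_fst; exact: smooth_at_id.
  by apply: smooth_snd; apply: smooth_snd; exact: smooth_at_id.
have n1 := near_pull (P := fun w => w.2 = compK w -> w.2 = y w.1) c1 yU.
have c2 : {for ((0, x) : B m), continuous (fun z => (z, (comp_sol F G z).2))}.
  apply: smooth_at_cont; apply: smooth_at_pair; first exact: smooth_at_id.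
  by apply: smooth_snd; exact: comp_sol_smooth.
have n2 : \forall z \near ((0, x) : B m), (comp_sol F G z).2 = compK (z,
  (comp_sol F G z).2) -> (comp_sol F G z).2 = y z.
  apply: (near_pull (P := fun w => w.2 = compK w -> w.2 = y w.1) c2).
  by rewrite comp_sol0; exact: yU.
have c3 : {for (((0, x), (0, rows n x)) : T), continuous (fun t : T => t.1)}.
  by apply: smooth_at_cont; apply: smooth_fst; exact: smooth_at_id.
have n3 := near_pull (P := fun z => (comp_sol F G z).2 = compK (z, (comp_sol F G z).2) ->
  (comp_sol F G z).2 = y z) c3 n2.
have n4 := near_pull (P := fun z => (comp_sol F G z).1 = compA (z, (comp_sol F G z).2) /\
  (comp_sol F G z).2 = grad_p F ((comp_sol F G z).1, z.2)) c3 (comp_sol_eq x).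
apply: filterS3 n1 n3 n4 => -[z [a b]] /= H1 H2 [H3 H4] Ha Hb.
have Eb : b = (comp_sol F G z).2.
  rewrite H1; last by rewrite /compK /= -Ha.
  by rewrite H2 // {1}H4 {1}H3.
by rewrite [RHS]surjective_pairing -Eb; congr (_, _); rewrite Ha H3 -Eb.
Qed.

(** The expression defining [ocomp F G], with the implicit variables set free. *)
Let Psi (w : B m * ('M[R]_(n, d) * 'M[R]_(n, d))) : R :=
  \sum_i G i (w.1.1, row i w.2.2) + F (w.2.1, w.1.2) - dot w.2.1 w.2.2.

Lemma ocompE z : ocomp F G z = Psi (z, comp_sol F G z).
Proof. by []. Qed.

Let sPhi i (w : B m * ('M[R]_(n, d) * 'M[R]_(n, d))) :
  smooth_at (fun w : B m * ('M[R]_(n, d) * 'M[R]_(n, d)) => (w.1.1, row i w.2.2) : B m) w.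
Proof.
apply: smooth_at_pair; first by do 2!apply: smooth_fst; exact: smooth_at_id.
by apply: smooth_row; do 2!apply: smooth_snd; exact: smooth_at_id.
Qed.

Let sPhi' (w : B m * ('M[R]_(n, d) * 'M[R]_(n, d))) :
  smooth_at (fun w : B m * ('M[R]_(n, d) * 'M[R]_(n, d)) => (w.2.1, w.1.2) : B n) w.
Proof.
apply: smooth_at_pair; first by apply: smooth_fst; apply: smooth_snd; exact: smooth_at_id.
by apply: smooth_snd; apply: smooth_fst; exact: smooth_at_id.
Qed.

Let smooth_Psi w : (forall i, smooth_at (G i) (w.1.1, row i w.2.2)) -> smooth_at F (w.2.1, w.1.2) ->
  smooth_at Psi w.
Proof.
move=> sGw sFw; apply: smooth_atB; last first.
  by apply: smooth_dot; [apply: smooth_fst|apply: smooth_snd]; apply: smooth_snd;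
    exact: smooth_at_id.
apply: smooth_atD; first apply: smooth_at_sum => i.
  exact: (smooth_at_comp (sPhi i w) (sGw i)).
exact: (smooth_at_comp (sPhi' w) sFw).
Qed.

Let Psi_derive w u v h k : (forall i, smooth_at (G i) (w.1.1, row i w.2.2)) ->
  smooth_at F (w.2.1, w.1.2) ->
  'D_((u, v), (h, k)) Psi w = \sum_i (dot u (grad_p (G i) (w.1.1, row i w.2.2)) +
     dot (row i k) (grad_x (G i) (w.1.1, row i w.2.2))) +
   (dot h (grad_p F (w.2.1, w.1.2)) + dot v (grad_x F (w.2.1,
     w.1.2))) - (dot w.2.1 k + dot h w.2.2).
Proof.
move=> sGw sFw.
have d1 : differentiable (fun w : B m * ('M[R]_(n, d) * 'M[R]_(n, d)) => w.2.1) w.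
  by apply: smooth_at_diff; apply: smooth_fst; apply: smooth_snd; exact: smooth_at_id.
have d2 : differentiable (fun w : B m * ('M[R]_(n, d) * 'M[R]_(n, d)) => w.2.2) w.
  by apply: smooth_at_diff; apply: smooth_snd; apply: smooth_snd; exact: smooth_at_id.
have dG i : smooth_at (fun w : B m * ('M[R]_(n, d) * 'M[R]_(n, d)) => G i (w.1.1, row i w.2.2)) w.
  exact: (smooth_at_comp (sPhi i w) (sGw i)).
have dsG : smooth_at (fun w : B m * ('M[R]_(n, d) * 'M[R]_(n, d)) => \sum_i G i (w.1.1,
  row i w.2.2)) w.
  exact: smooth_at_sum.
have dF : smooth_at (fun w : B m * ('M[R]_(n, d) * 'M[R]_(n, d)) => F (w.2.1, w.1.2)) w.
  exact: (smooth_at_comp (sPhi' w) sFw).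
rewrite derive_sub; last 2 first.
- by apply: smooth_at_diff; exact: smooth_atD.
- by apply: smooth_at_diff; apply: smooth_dot; [apply: smooth_fst|apply: smooth_snd];
  apply: smooth_snd; exact: smooth_at_id.
rewrite derive_add; [|exact: smooth_at_diff|exact: smooth_at_diff].
congr (_ + _ - _).
- rewrite derive_bigsum; last by move=> i; exact: smooth_at_diff.
  apply: eq_bigr => i _.
  apply: (etrans (derive_comp ((u, v), (h,
    k)) (smooth_at_diff (sPhi i w)) (smooth_at_diff (sGw i)))).
  rewrite (derive_lin (l := fun w : B m * ('M[R]_(n, d) * 'M[R]_(n, d)) => (w.1.1,
    row i w.2.2) : B m)); last first.
    by move=> a x y; apply: injective_projections => //=; rewrite linearP.
  by rewrite derive_grad //=; exact: smooth_at_diff.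
- apply: (etrans (derive_comp ((u, v), (h, k)) (smooth_at_diff (sPhi' w)) (smooth_at_diff sFw))).
  rewrite (derive_lin (l := fun w : B m * ('M[R]_(n, d) * 'M[R]_(n, d)) => (w.2.1, w.1.2) :
    B n)) //.
  by rewrite derive_grad //=; exact: smooth_at_diff.
- apply: (etrans (derive_dot ((u, v), (h, k)) d1 d2)).
  by rewrite (derive_lin (l := fun w : B m * ('M[R]_(n, d) * 'M[R]_(n, d)) => w.2.2)) //
    (derive_lin (l := fun w : B m * ('M[R]_(n, d) * 'M[R]_(n, d)) => w.2.1)).
Qed.

Let near_all_smooth x : \forall z \near ((0, x) : B m),
  [/\ smooth_at (comp_sol F G) z, forall i, smooth_at (G i) (z.1, row i (comp_sol F G z).2)
    & smooth_at F ((comp_sol F G z).1, z.2)].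
Proof.
have ss := comp_sol_smooth x.
have n1 := smooth_at_near ss.
have n2 i : \forall z \near ((0, x) : B m), smooth_at (G i) (z.1, row i (comp_sol F G z).2).
  apply: (near_pull (f := fun z => (z.1, row i (comp_sol F G z).2) : B m) (P := smooth_at (G i))).
    apply: smooth_at_cont; apply: smooth_at_pair; first by apply: smooth_fst; exact: smooth_at_id.
    by apply: smooth_row; exact: smooth_snd.
  by rewrite comp_sol0 /= rowK; apply: smooth_at_near; exact: sG.
have n2' : \forall z \near ((0, x) : B m), forall i, smooth_at (G i) (z.1,
  row i (comp_sol F G z).2).
  exact: (filter_forall _ n2).
have n3 : \forall z \near ((0, x) : B m), smooth_at F ((comp_sol F G z).1, z.2).
  apply: (near_pull (f := fun z => ((comp_sol F G z).1, z.2) : B n) (P := smooth_at F)).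
    apply: smooth_at_cont; apply: smooth_at_pair; first exact: smooth_fst.
    by apply: smooth_snd; exact: smooth_at_id.
  by rewrite comp_sol0 /=; apply: smooth_at_near; exact: sF.
by apply: filterS3 n1 n2' n3 => z.
Qed.

(** The implicit equations say that [comp_sol F G z] is a critical point of [Psi]:
    only the explicit occurrences of [z] contribute to the gradients. *)
Theorem ocomp_grad x : \forall z \near ((0, x) : B m),
  grad_p (ocomp F G) z = \sum_i grad_p (G i) (z.1, row i (comp_sol F G z).2) /\
  grad_x (ocomp F G) z = grad_x F ((comp_sol F G z).1, z.2).
Proof.
apply: filterS2 (near_all_smooth x) (comp_sol_eq x) => z [ss sGz sFz] [E1 E2].
set s := comp_sol F G z in E1 E2 sGz sFz *.
have dPsi : differentiable Psi (z, s) by apply: smooth_at_diff; exact: smooth_Psi.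
have D0 h : 'D_(0, h) Psi (z, s) = 0.
  case: h => h k; rewrite -[0]/(0, 0) Psi_derive //= -E2 dot0l addr0.
  suff -> : dot s.1 k = \sum_i (dot 0 (grad_p (G i) (z.1,
    row i s.2)) + dot (row i k) (grad_x (G i) (z.1, row i s.2))).
    by rewrite subrr.
  rewrite dotC; apply: eq_bigr => i _; rewrite dot0l add0r dot1; congr pairing.
  by rewrite E1 rowK.
have Dv u v : 'D_(u, v) (ocomp F G) z = \sum_i dot u (grad_p (G i) (z.1,
  row i s.2)) + dot v (grad_x F (s.1, z.2)).
  apply: (etrans (envelope (sigma := comp_sol F G) (u, v) dPsi (smooth_at_diff ss) D0)).
  rewrite -[0]/(0, 0) Psi_derive //= !dot0l dot0r addr0 add0r subr0; congr (_ + _).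
  apply: eq_bigr => i _.
  by rewrite (_ : row i 0 = 0) ?dot0l ?addr0 //; apply/rowP => j; rewrite !mxE.
split; apply/matrixP => i j; rewrite [LHS]mxE Dv.
  by rewrite dot0l addr0 summxE; apply: eq_bigr => k _; rewrite dot_delta.
by rewrite big1 ?add0r; [rewrite dot_delta (ord1 i)|move=> k _; rewrite dot0l].
Qed.

Lemma ocomp_Ogen : (forall x, \sum_i grad_p (G i) ((0, x) : B m) = rows m x) ->
  Ogen R d m (ocomp F G).
Proof.
move=> DG; apply/OgenP; split=> x.
- apply: (smooth_at_comp (f := fun z => (z, comp_sol F G z)) (g := Psi)).
    by apply: smooth_at_pair; [exact: smooth_at_id|exact: comp_sol_smooth].
  rewrite comp_sol0; apply: smooth_Psi => /=; last exact: sF.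
  by move=> i; rewrite rowK; exact: sG.
- rewrite ocompE comp_sol0 /Psi /= F0 dot0l subr0 addr0.
  by apply: big1 => i _; rewrite rowK G0.
- have [-> _] := nbhs_singleton (ocomp_grad x).
  by rewrite comp_sol0 /= -DG; apply: eq_bigr => i _; rewrite rowK.
Qed.
End Composition.

Section Determined.
Context {R : realType} {d : nat}.
Notation B n := (B R d n).

(** The mean value theorem on the segment from [(0, x)] to [(p, x)]. *)
Lemma germ_eq_grad_p n (F F' : B n -> R) :
  (forall x, smooth_at F ((0, x) : B n)) -> (forall x, smooth_at F' ((0, x) : B n)) ->
  (forall x, F (0, x) = F' (0, x)) ->
  (forall x, \forall z \near ((0, x) : B n), grad_p F z = grad_p F' z) -> germ_eq F F'.
Proof.
move=> sF sF' E0 Eg; apply/nearB0P => x.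
have n1 : \forall z \near ((0, x) : B n), [/\ differentiable F z, differentiable F' z &
  grad_p F z = grad_p F' z].
  by apply: filterS3 (smooth_at_near (sF x)) (smooth_at_near (sF' x)) (Eg x) => z s1 s2;
    split => //; exact: smooth_at_diff.
have [r r0 Hr] := near_prod_box n1.
apply/nbhs_ballP; exists r => // -[p y] [] /=; rewrite -!ball_normE /= => pr yr.
have Hy t : 0 <= t <= 1 -> `|0 - t *: p| < r.
  move=> /andP[t0 t1]; rewrite sub0r normrN in pr *; rewrite sub0r normrN normrZ ger0_norm //.
  by apply: le_lt_trans pr; rewrite ler_piMl.
pose H z := F z - F' z.
have lineE t : (0, y) + t *: (p, 0) = (t *: p, y) :> B n.
  by apply/pair_equal_spec; rewrite /= add0r scaler0 addr0.
have [t t01|t t01] := @segment_mvt R _ H ((0, y) : B n) (p, 0).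
  rewrite lineE; have [d1 d2 _] := Hr _ _ (Hy t t01) yr.
  exact: differentiableB.
rewrite lineE; have [d1 d2 Ep] := Hr _ _ (Hy t t01) yr.
have -> : ((0, y) : B n) + (p, 0) = (p, y) by apply/pair_equal_spec; rewrite /= add0r addr0.
rewrite derive_sub // !derive_grad // Ep /H E0 subrr subr0 => /eqP.
by rewrite !(dot0l (n := 1)) subrr subr_eq0 => /eqP.
Qed.

End Determined.

(** * The map generated by a function of degree one *)

Section Psi.
Context {R : realType} {d : nat}.
Notation B n := (B R d n).
Notation rows n x := (\matrix_(i < n) x : 'M[R]_(n, d)).
Implicit Types F G : B 1 -> R.

Section CvgLin.
Context (T : topologicalType) (V W : normedModType R) {fV : findim V} {fW : findim W}.
Lemma cvg_lin (l : V -> W) (f : T -> V) (a : T) (b : V) : linear l -> f z @[z --> a] --> b ->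
  l (f z) @[z --> a] --> l b.
Proof. by move=> ll; apply: cvg_cont; exact: linear_findim_continuous. Qed.
End CvgLin.

(** The Lagrangian submanifold generated by [F], as a relation between [n] points of
    the cotangent space, with coordinates [z = (p, y)], and one point [w]. It is the
    graph of [psi F] for [n = 1] and that of a multiplication for [n = 2]. *)
Definition lag n (F : B n -> R) (z : 'M[R]_(n, d) * 'M[R]_(n, d)) (w : B 1) : Prop :=
  z.2 = grad_p F (z.1, w.2) /\ w.1 = grad_x F (z.1, w.2).

Lemma B0E n (a : B n) : B0 R d n a -> exists x, a = (0, x).
Proof. by case: a => p x; rewrite /B0 /= => ->; exists x. Qed.

Lemma rows1 (x : 'rV[R]_d) : rows 1 x = x.
Proof. by apply/rowP => j; rewrite mxE. Qed.

Lemma derive_affine_along (V W : normedModType R) (f : V -> W) z v c :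
  (forall t : R, f (t *: v + z) = t *: c + f z) -> 'D_v f z = c.
Proof.
move=> H; rewrite /derive; apply: cvg_lim => //.
apply: (@cvg_trans _ ((fun=> c) @ (0 : R)^')); last exact: cvg_cst.
apply: near_eq_cvg; near=> h; rewrite /= H addrK scalerA mulVf ?scale1r //.
by near: h; exact: nbhs_dnbhs_neq.
Unshelve. all: by end_near. Qed.

(** The equation [theta (p, x) = p'] is the fixed-point equation
    [p = p' + p - theta (p, x)], whose right-hand side is constant in [p] at first
    order. *)
Lemma param_inverse (theta : B 1 -> 'rV[R]_d) :
  (forall x, smooth_at theta ((0, x) : B 1)) -> (forall x, theta (0, x) = 0) ->
  (forall x h, 'D_(h, 0) theta ((0, x) : B 1) = h) ->
  exists sigma : B 1 -> 'rV[R]_d, forall x,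
  [/\ smooth_at sigma ((0, x) : B 1), sigma (0, x) = 0 &
    \forall z \near ((0, x) : B 1), theta (sigma z, z.2) = z.1].
Proof.
move=> st t0 Dt.
pose arg (w : B 1 * 'rV[R]_d) : B 1 := (w.2, w.1.2).
pose K (w : B 1 * 'rV[R]_d) : 'rV[R]_d := w.1.1 + w.2 - theta (arg w).
have sarg w : smooth_at arg w by exact: smooth_at_lin.
have sl w : smooth_at (fun w : B 1 * 'rV[R]_d => w.1.1 + w.2) w.
  by apply: smooth_at_lin => a u v /=; rewrite scalerDr addrACA.
have [|a|a|a h|s Hs] := @fixpoint_along R (B 1) _ _ _ K (B0 R d 1) (fun=> 0).
- by move=> z; exact: cvg_cst.
- move=> /B0E[x ->]; apply: smooth_atB => //.
  by apply: (smooth_at_comp (sarg _)); exact: st.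
- by move=> /B0E[x ->]; rewrite /K /= t0 subr0 addr0.
- move=> /B0E[x ->]; rewrite derive_sub; [|exact: smooth_at_diff|apply: smooth_at_diff;
  apply: (smooth_at_comp (sarg _)); exact: st].
  rewrite (derive_lin (l := fun w : B 1 * 'rV[R]_d => w.1.1 + w.2)); last first.
    by move=> a' u v /=; rewrite scalerDr addrACA.
  apply/eqP; rewrite /= add0r subr_eq0; apply/eqP/esym.
  pose w0 : B 1 * 'rV[R]_d := ((0, x), 0).
  have dst : differentiable theta (arg w0) by exact: smooth_at_diff (st x).
  apply: (etrans (derive_comp (f := arg) (g := theta) (0, h) (smooth_at_diff (sarg w0)) dst)).
  by rewrite (derive_lin (l := arg)) // Dt.
- exists s => x; have [ss s0 sE _] := Hs (0, x) erefl; split => //.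
  apply: filterS sE => z; rewrite /K /= => E.
  by apply/esym/eqP; rewrite -subr_eq0; apply/eqP/(addIr (s z)); rewrite add0r [RHS]E addrAC.
Qed.

Section GeneratedMap.
Variable F : B 1 -> R.
Hypothesis OF : Ogen R d 1 F.

Lemma Ogen_smooth x : smooth_at F ((0, x) : B 1). Proof. by have [] := (OgenP F).1 OF. Qed.
Lemma Ogen0 x : F (0, x) = 0. Proof. by have [] := (OgenP F).1 OF. Qed.
Lemma Ogen_grad_p0 x : grad_p F (0, x) = x. Proof. by have [_ _ ->] := (OgenP F).1 OF;
  rewrite rows1. Qed.
Lemma Ogen_grad_x0 x : grad_x F (0, x) = 0. Proof. by rewrite grad_x0 //; exact: Ogen0. Qed.

(** The first defining equation of [psi F] as a fixed-point equation for the second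
    component of its value. On the zero section [grad_p F (0, x) = x], so that [K] is
    constant in the unknown. *)
Let K (w : B 1 * 'rV[R]_d) : 'rV[R]_d := w.1.2 + w.2 - grad_p F (w.1.1, w.2).

Let psi_fixpoint : exists y : B 1 -> 'rV[R]_d, forall x,
  [/\ smooth_at y ((0, x) : B 1), y (0, x) = x,
   (\forall z \near ((0, x) : B 1), y z = K (z, y z)) &
   (\forall w \near (((0, x) : B 1), x), w.2 = K w -> w.2 = y w.1)].
Proof.
have sarg w : smooth_at (fun w : B 1 * 'rV[R]_d => (w.1.1, w.2) : B 1) w by exact: smooth_at_lin.
have [|a|a|a h|y Hy] := @fixpoint_along R (B 1) _ _ _ K (B0 R d 1) (fun z => z.2).
- by move=> z; exact: cvg_snd.
- move=> /B0E[x ->]; apply: smooth_atB.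
    by apply: smooth_at_lin => a' u v /=; rewrite scalerDr addrACA.
  by apply: (smooth_at_comp (sarg _)); apply: smooth_grad_p; exact: Ogen_smooth.
- by move=> /B0E[x ->]; rewrite /K /= Ogen_grad_p0 addrK.
- move=> /B0E[x ->]; apply: derive_const_along => t.
  have -> : t *: (0, h) + (0, x, x) = (0, x, t *: h + x) :> B 1 * 'rV[R]_d.
    by apply/pair_equal_spec; rewrite /= scaler0 add0r.
  by rewrite /K /= !Ogen_grad_p0 !addrK.
- by exists y => x; have := Hy (0, x) erefl.
Qed.

Let KP z y : y = K (z, y) <-> z.2 = grad_p F (z.1, y).
Proof.
rewrite /K /=; split=> [E|<-]; last by rewrite addrAC subrr add0r.
apply/eqP; rewrite -subr_eq0; apply/eqP/(addIr y); rewrite add0r [RHS]E.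
by rewrite addrAC.
Qed.

Lemma psi_is : is_psi F (psi F).
Proof.
have [y Hy] := psi_fixpoint.
apply: (@xgetPex _ (fun z : B 1 => z) [set f | is_psi F f]).
exists (fun z => (grad_x F (z.1, y z), y z)); split.
  apply/smoothB0P => x; have [sy y0 _ _] := Hy x; apply: smooth_at_pair => //.
  apply: (smooth_at_comp (f := fun z => (z.1, y z) : B 1)).
    by apply: smooth_at_pair => //; exact: smooth_at_lin.
  by rewrite /= y0; apply: smooth_grad_x; exact: Ogen_smooth.
apply/nearB0P => x; have [_ _ + _] := Hy x.
by apply: filterS => z E; split => //; exact/KP.
Qed.

Lemma psi_smooth x : smooth_at (psi F) ((0, x) : B 1).
Proof. by have [/smoothB0P] := psi_is. Qed.

Lemma psi_lag x : \forall z \near ((0, x) : B 1), lag F z (psi F z).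
Proof. by have [_ /nearB0P] := psi_is. Qed.

Lemma psi0 x : psi F (0, x) = (0, x).
Proof.
have [E1 E2] := nbhs_singleton (psi_lag x); rewrite /= in E1 E2.
rewrite Ogen_grad_p0 in E1; rewrite -E1 Ogen_grad_x0 in E2.
by rewrite [LHS]surjective_pairing -E1 E2.
Qed.

Lemma psi_cvg (T : topologicalType) (f : T -> B 1) (a : T) x :
  f z @[z --> a] --> ((0, x) : B 1) -> psi F (f z) @[z --> a] --> ((0, x) : B 1).
Proof.
by move=> /(cvg_cont (smooth_at_cont (psi_smooth x))); rewrite psi0.
Qed.

Lemma psi_unique x : \forall t \near (((0, x), (0, x)) : B 1 * B 1), lag F t.1 t.2 -> t.2 =
  psi F t.1.
Proof.
have [y Hy] := psi_fixpoint; have [sy y0 yE yU] := Hy x.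
have c3 : t.1 @[t --> (((0, x), (0, x)) : B 1 * B 1)] --> ((0, x) : B 1).
  by apply: (cvg_fst2 (f := fun t => t) (c := (0, x))); exact: cvg_idt.
have c0 : t.2 @[t --> (((0, x), (0, x)) : B 1 * B 1)] --> ((0, x) : B 1).
  by apply: (cvg_snd2 (f := fun t => t) (b := (0, x))); exact: cvg_idt.
have c1 : (t.1, t.2.2) @[t --> (((0, x), (0, x)) : B 1 * B 1)] --> (((0, x) : B 1), x).
  by apply: cvg_both => //; exact: cvg_snd2 c0.
have n1 := near_cvg (P := fun w => w.2 = K w -> w.2 = y w.1) c1 yU.
have c2 : (z, (psi F z).2) @[z --> ((0, x) : B 1)] --> (((0, x) : B 1), x).
  by apply: cvg_both; [exact: cvg_idt|apply: (cvg_snd2 (b := (0 : 'rV[R]_d))); apply: psi_cvg;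
    exact: cvg_idt].
have n2 := near_cvg (P := fun w => w.2 = K w -> w.2 = y w.1) c2 yU.
have n3 := near_cvg c3 n2; have n4 := near_cvg c3 (psi_lag x).
apply: filterS3 n1 n3 n4 => -[z w] /= H1 H2 [E3 E4] [E1 E2].
have Ew : w.2 = (psi F z).2 := etrans (H1 ((KP _ _).2 E1)) (esym (H2 ((KP _ _).2 E3))).
by rewrite [LHS]surjective_pairing [RHS]surjective_pairing E4 E2 Ew.
Qed.

(** From here on points are given as functions of a parameter [t] in some space, which
    converge to a point of the zero section: facts valid near that point can then be
    combined without naming neighbourhoods. *)
Lemma psi_unique_cvg (T : topologicalType) (f g : T -> B 1) (a : T) x :
  f z @[z --> a] --> ((0, x) : B 1) -> g z @[z --> a] --> ((0, x) : B 1) ->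
  \forall z \near a, lag F (f z) (g z) -> g z = psi F (f z).
Proof.
move=> cf cg.
exact: (near_cvg (f := fun z => (f z, g z)) (cvg_both cf cg) (psi_unique x)).
Qed.

Lemma psi_lag_cvg (T : topologicalType) (f : T -> B 1) (a : T) x :
  f z @[z --> a] --> ((0, x) : B 1) -> \forall z \near a, lag F (f z) (psi F (f z)).
Proof. by move=> cf; exact: (near_cvg cf (psi_lag x)). Qed.

End GeneratedMap.
End Psi.

(** * Operadic composition as composition of relations *)

Section Relations.
Context {R : realType} {d : nat}.
Notation B n := (B R d n).
Notation rows n x := (\matrix_(i < n) x : 'M[R]_(n, d)).

Lemma mx1 (f : 'I_1 -> 'rV[R]_d) : \matrix_(i < 1) f i = f 0.
Proof. by apply/row_matrixP => i; rewrite rowK ord1 row_id. Qed.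

Section Family.
Variables (n m : nat) (F : B n -> R) (G : 'I_n -> B m -> R).
Hypothesis OF : Ogen R d n F.
Hypothesis sG : forall i x, smooth_at (G i) ((0, x) : B m).
Hypothesis G0 : forall i x, G i (0, x) = 0.

Lemma comp_sol_cvg (T : topologicalType) (f : T -> B m) (a : T) x :
  f z @[z --> a] --> ((0, x) : B m) ->
  comp_sol F G (f z) @[z --> a] --> ((0, rows n x) : 'M[R]_(n, d) * 'M[R]_(n, d)).
Proof.
by move=> /(cvg_cont (smooth_at_cont (comp_sol_smooth OF sG G0 x))); rewrite comp_sol0.
Qed.

Lemma comp_sol_unique_cvg (T : topologicalType) (f : T -> B m) (g : T -> 'M[R]_(n,
  d) * 'M[R]_(n, d)) (a : T) x :
  f z @[z --> a] --> ((0, x) : B m) -> g z @[z --> a] --> ((0, rows n x) : 'M[R]_(n,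
    d) * 'M[R]_(n, d)) ->
  \forall z \near a, (g z).1 = compA G (f z, (g z).2) -> (g z).2 = grad_p F ((g z).1, (f z).2) ->
    g z = comp_sol F G (f z).
Proof.
move=> cf cg.
exact: (near_cvg (f := fun z => (f z, g z)) (cvg_both cf cg) (comp_sol_unique OF sG G0 x)).
Qed.

Lemma comp_sol_eq_cvg (T : topologicalType) (f : T -> B m) (a : T) x :
  f z @[z --> a] --> ((0, x) : B m) ->
  \forall z \near a, [/\ (comp_sol F G (f z)).1 = compA G (f z, (comp_sol F G (f z)).2),
    (comp_sol F G (f z)).2 = grad_p F ((comp_sol F G (f z)).1, (f z).2),
  grad_p (ocomp F G) (f z) = \sum_i grad_p (G i) ((f z).1, row i (comp_sol F G (f z)).2) &
  grad_x (ocomp F G) (f z) = grad_x F ((comp_sol F G (f z)).1, (f z).2)].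
Proof.
move=> cf; have n1 := near_cvg cf (comp_sol_eq OF sG G0 x).
have n2 := near_cvg cf (ocomp_grad OF sG G0 x).
by apply: filterS2 n1 n2 => z [h1 h2] [h3 h4].
Qed.
End Family.

Section OneArgument.
Variables (n : nat) (F : B 1 -> R) (S : B n -> R).
Hypotheses (OF : Ogen R d 1 F) (OS : Ogen R d n S).

Let sS x : smooth_at S ((0, x) : B n). Proof. by have [] := (OgenP S).1 OS. Qed.
Let S0 x : S (0, x) = 0. Proof. by have [] := (OgenP S).1 OS. Qed.
Let DS x : grad_p S (0, x) = rows n x. Proof. by have [] := (OgenP S).1 OS. Qed.

Lemma ocomp1_Ogen : Ogen R d n (ocomp1 F S).
Proof. by apply: ocomp_Ogen => // x; rewrite big_ord1 DS. Qed.

(** The intermediate point [w] comes from the solution of the implicit equations. *)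
Lemma ocomp1_split (T : topologicalType) (z : T -> B n) (a : T) x :
  z t @[t --> a] --> ((0, x) : B n) ->
  exists2 w : T -> B 1, w t @[t --> a] --> ((0, x) : B 1) &
  \forall t \near a, lag S ((z t).1, grad_p (ocomp1 F S) (z t)) (w t) /\
     lag F (w t) (grad_x (ocomp1 F S) (z t), (z t).2).
Proof.
move=> cz; exists (fun t => comp_sol F (fun=> S) (z t)).
  have := @comp_sol_cvg _ _ F (fun=> S) OF (fun _ => sS) (fun _ => S0) _ _ _ _ cz.
  by rewrite rows1.
apply: filterS (@comp_sol_eq_cvg _ _ F (fun=> S) OF (fun _ => sS) (fun _ => S0) _ _ _ _ cz) => t.
move: (comp_sol _ _ _) => -[p y] [/= h1 h2 h3 h4]; rewrite big_ord1 row_id in h3.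
split; split => //=.
by rewrite h1 /compA mx1 row_id.
Qed.

(** By uniqueness of the solution of the implicit equations, an intermediate point
    close to the zero section is the one that [comp_sol] gives. *)
Lemma ocomp1_join (T : topologicalType) (z : T -> 'M[R]_(n, d) * 'M[R]_(n, d)) (v w : T ->
  B 1) (a : T) x :
  (z t).1 @[t --> a] --> (0 : 'M[R]_(n, d)) ->
  v t @[t --> a] --> ((0, x) : B 1) -> w t @[t --> a] --> ((0, x) : B 1) ->
  \forall t \near a, lag S (z t) (v t) -> lag F (v t) (w t) -> lag (ocomp1 F S) (z t) (w t).
Proof.
move=> cz cv cw.
have cf : ((z t).1, (w t).2) @[t --> a] --> ((0, x) : B n).
  by apply: cvg_both => //; exact: (cvg_snd2 (b := (0 : 'rV[R]_d))).
have n1 := @comp_sol_unique_cvg _ _ F (fun=> S) OF (fun _ => sS) (fun _ => S0) T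
  (fun t => ((z t).1, (w t).2)) v a x cf.
have {}n1 := n1 ltac:(by rewrite rows1).
have n2 := @comp_sol_eq_cvg _ _ F (fun=> S) OF (fun _ => sS) (fun _ => S0) _ _ _ _ cf.
apply: filterS2 n1 n2 => t H1 [_ _ h3 h4] [/= e1 e2] [e3 e4].
have E : v t = comp_sol F (fun=> S) ((z t).1, (w t).2).
  by apply: H1 => //; rewrite /compA mx1 row_id.
rewrite -E big_ord1 row_id in h3; rewrite -E in h4.
by split => /=; [rewrite h3|rewrite h4].
Qed.
End OneArgument.

Lemma ord2P (P : 'I_2 -> Prop) : P 0 -> P 1 -> forall i, P i.
Proof.
move=> P0 P1 [[|[|//]] i2].
  by rewrite (_ : Ordinal i2 = 0) //; apply: val_inj.
by rewrite (_ : Ordinal i2 = 1) //; apply: val_inj.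
Qed.

Lemma row0_col (a b : 'rV[R]_d) : row 0 (col_mx a b) = a.
Proof. by apply/rowP => j; rewrite !mxE; case: splitP => // k _; rewrite ord1. Qed.

Lemma row1_col (a b : 'rV[R]_d) : row 1 (col_mx a b) = b.
Proof. by apply/rowP => j; rewrite !mxE; case: splitP => [[[]]//|] k _; rewrite ord1. Qed.

Lemma col_rows (A : 'M[R]_(1 + 1, d)) : A = col_mx (row 0 A) (row 1 A).
Proof. by apply/row_matrixP; apply: ord2P; rewrite ?row0_col ?row1_col. Qed.

Lemma mx2 (f : 'I_2 -> 'rV[R]_d) : \matrix_(i < 2) f i = col_mx (f 0) (f 1).
Proof. by apply/row_matrixP; apply: ord2P; rewrite ?row0_col ?row1_col rowK. Qed.

Lemma cvg_col_mx (T : topologicalType) m1 m2 n (f : T -> 'M[R]_(m1, n)) (g : T -> 'M[R]_(m2,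
  n)) (a : T) (b : 'M[R]_(m1, n)) (c : 'M[R]_(m2, n)) :
  f t @[t --> a] --> b -> g t @[t --> a] --> c -> col_mx (f t) (g t) @[t --> a] --> col_mx b c.
Proof.
move=> cf cg.
have ll : linear (fun w : 'M[R]_(m1, n) * 'M[R]_(m2, n) => col_mx w.1 w.2).
  by move=> k u v; rewrite scale_col_mx add_col_mx.
exact: (cvg_lin (l := fun w : 'M[R]_(m1, n) * 'M[R]_(m2, n) => col_mx w.1 w.2) ll (cvg_both cf cg)).
Qed.

Lemma cvg_row (T : topologicalType) n (f : T -> 'M[R]_(n, d)) (a : T) (b : 'M[R]_(n, d)) i :
  f t @[t --> a] --> b -> row i (f t) @[t --> a] --> row i b.
Proof.
by apply: (cvg_lin (l := fun A : 'M[R]_(n, d) => row i A)) => k u v; rewrite linearP.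
Qed.

Section TwoArguments.
Variables (k1 k2 : nat) (H : B 2 -> R) (G1 : B k1 -> R) (G2 : B k2 -> R).
Hypotheses (OH : Ogen R d 2 H) (O1 : Ogen R d k1 G1) (O2 : Ogen R d k2 G2).

Let G := fun (i : 'I_2) (z : B (k1 + k2)) =>
    if i == 0 then G1 (usubmx z.1, z.2) else G2 (dsubmx z.1, z.2).

Let up (z : B (k1 + k2)) : B k1 := (usubmx z.1, z.2).
Let dn (z : B (k1 + k2)) : B k2 := (dsubmx z.1, z.2).

Let up_linear : linear up.
Proof. by move=> a u v; apply: injective_projections => //=; apply/matrixP => i j;
  rewrite !mxE. Qed.
Let dn_linear : linear dn.
Proof. by move=> a u v; apply: injective_projections => //=; apply/matrixP => i j;
  rewrite !mxE. Qed.

Let G_0 : G 0 = fun z => G1 (up z). Proof. by []. Qed.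
Let G_1 : G 1 = fun z => G2 (dn z). Proof. by []. Qed.

Let up0 x : up (0, x) = (0, x). Proof. by apply: injective_projections => //=; rewrite linear0. Qed.
Let dn0 x : dn (0, x) = (0, x). Proof. by apply: injective_projections => //=; rewrite linear0. Qed.

Let sG i x : smooth_at (G i) ((0, x) : B (k1 + k2)).
Proof.
move: i; apply: ord2P.
  rewrite G_0; apply: (smooth_at_comp (smooth_at_lin _ up_linear)); rewrite up0.
  by have [] := (OgenP G1).1 O1.
rewrite G_1; apply: (smooth_at_comp (smooth_at_lin _ dn_linear)); rewrite dn0.
by have [] := (OgenP G2).1 O2.
Qed.

Let G0 i x : G i (0, x) = 0.
Proof.
move: i; apply: ord2P.
  by rewrite G_0 up0; have [] := (OgenP G1).1 O1.
by rewrite G_1 dn0; have [] := (OgenP G2).1 O2.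
Qed.

Lemma grad_p_up z : differentiable G1 (up z) -> grad_p (fun z => G1 (up z)) z =
  col_mx (grad_p G1 (up z)) 0.
Proof.
move=> dG; apply/matrixP => i j; rewrite [LHS]mxE.
have du : differentiable up z by apply: smooth_at_diff; exact: smooth_at_lin.
apply: (etrans (derive_comp (f := up) (g := G1) (delta_mx i j, 0) du dG)).
rewrite (derive_lin (l := up)) // /up /= derive_grad // dot0l addr0.
rewrite mxE; case: splitP => k ik.
  rewrite (_ : usubmx _ = delta_mx k j) ?dot_delta // .
  by apply/matrixP => i' j'; rewrite !mxE -!val_eqE /= ik.
rewrite (_ : usubmx _ = 0) ?dot0l ?mxE //.
apply/matrixP => i' j'; rewrite !mxE -!val_eqE /= ik.
by rewrite (ltn_eqF (ltn_addr _ (ltn_ord i'))).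
Qed.

Lemma grad_x_up z : differentiable G1 (up z) -> grad_x (fun z => G1 (up z)) z = grad_x G1 (up z).
Proof.
move=> dG; apply/matrixP => i j; rewrite [LHS]mxE.
have du : differentiable up z by apply: smooth_at_diff; exact: smooth_at_lin.
apply: (etrans (derive_comp (f := up) (g := G1) (0, delta_mx 0 j) du dG)).
by rewrite (derive_lin (l := up)) // /up /= linear0 mxE.
Qed.

Lemma grad_p_dn z : differentiable G2 (dn z) -> grad_p (fun z => G2 (dn z)) z =
  col_mx 0 (grad_p G2 (dn z)).
Proof.
move=> dG; apply/matrixP => i j; rewrite [LHS]mxE.
have du : differentiable dn z by apply: smooth_at_diff; exact: smooth_at_lin.
apply: (etrans (derive_comp (f := dn) (g := G2) (delta_mx i j, 0) du dG)).
rewrite (derive_lin (l := dn)) // /dn /= derive_grad // dot0l addr0.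
rewrite mxE; case: splitP => k ik.
  rewrite (_ : dsubmx _ = 0) ?dot0l ?mxE //.
  apply/matrixP => i' j'; rewrite !mxE -!val_eqE /= ik.
  by rewrite gtn_eqF // ltn_addr.
rewrite (_ : dsubmx _ = delta_mx k j) ?dot_delta // .
by apply/matrixP => i' j'; rewrite !mxE -!val_eqE /= ik eqn_add2l.
Qed.

Lemma grad_x_dn z : differentiable G2 (dn z) -> grad_x (fun z => G2 (dn z)) z = grad_x G2 (dn z).
Proof.
move=> dG; apply/matrixP => i j; rewrite [LHS]mxE.
have du : differentiable dn z by apply: smooth_at_diff; exact: smooth_at_lin.
apply: (etrans (derive_comp (f := dn) (g := G2) (0, delta_mx 0 j) du dG)).
by rewrite (derive_lin (l := dn)) // /dn /= linear0 mxE.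
Qed.

Let big2 (V : zmodType) (f : 'I_2 -> V) : \sum_i f i = f 0 + f 1.
Proof. by rewrite big_ord_recl big_ord1; congr (_ + f _); apply: val_inj. Qed.

Lemma ocomp2_Ogen : Ogen R d (k1 + k2) (ocomp2 H G1 G2).
Proof.
apply: (ocomp_Ogen (G := G)) => // x.
have [s1 _ D1] := (OgenP G1).1 O1; have [s2 _ D2] := (OgenP G2).1 O2.
rewrite big2 G_0 G_1 grad_p_up ?grad_p_dn ?up0 ?dn0; [|exact: smooth_at_diff..].
rewrite add_col_mx D1 D2 addr0 add0r; apply/matrixP => i j; rewrite !mxE.
by case: splitP => k _; rewrite mxE.
Qed.

Section Relation.
Variables (T : topologicalType) (a : T) (x : 'rV[R]_d).

Let near_grads (z : T -> B (k1 + k2)) (y : T -> 'M[R]_(1 + 1, d)) :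
  z t @[t --> a] --> ((0, x) : B (k1 + k2)) -> y t @[t --> a] --> (rows 2 x : 'M[R]_(1 + 1, d)) ->
  \forall t \near a, compA G (z t, y t) =
      col_mx (grad_x G1 (usubmx (z t).1, row 0 (y t))) (grad_x G2 (dsubmx (z t).1, row 1 (y t))) /\
    \sum_i grad_p (G i) ((z t).1, row i (y t)) =
      col_mx (grad_p G1 (usubmx (z t).1, row 0 (y t))) (grad_p G2 (dsubmx (z t).1, row 1 (y t))).
Proof.
move=> cz cy.
have cz1 : (z t).1 @[t --> a] --> (0 : 'M[R]_(k1 + k2, d)) by exact: (cvg_fst2 (c := x)).
have cr i : row i (y t) @[t --> a] --> x by have := cvg_row (i := i) cy; rewrite rowK.
have cu : (usubmx (z t).1, row 0 (y t)) @[t --> a] --> ((0, x) : B k1).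
  apply: cvg_both => //; rewrite -(linear0 (@usubmx R k1 k2 d)).
  by apply: (cvg_lin (l := @usubmx R k1 k2 d)) => // k u v; rewrite linearP.
have cd : (dsubmx (z t).1, row 1 (y t)) @[t --> a] --> ((0, x) : B k2).
  apply: cvg_both => //; rewrite -(linear0 (@dsubmx R k1 k2 d)).
  by apply: (cvg_lin (l := @dsubmx R k1 k2 d)) => // k u v; rewrite linearP.
have [s1 _ _] := (OgenP G1).1 O1; have [s2 _ _] := (OgenP G2).1 O2.
have n1 := near_cvg cu (smooth_at_near (s1 x)); have n2 := near_cvg cd (smooth_at_near (s2 x)).
apply: filterS2 n1 n2 => t /smooth_at_diff d1 /smooth_at_diff d2.
rewrite /compA mx2 big2 G_0 G_1 /=.
rewrite (grad_x_up (z := ((z t).1, row 0 (y t)))) // (grad_x_dn (z := ((z t).1, row 1 (y t)))) //.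
rewrite (grad_p_up (z := ((z t).1, row 0 (y t)))) // (grad_p_dn (z := ((z t).1, row 1 (y t)))) //.
by rewrite add_col_mx addr0 add0r.
Qed.

Lemma ocomp2_split (z : T -> B (k1 + k2)) : z t @[t --> a] --> ((0, x) : B (k1 + k2)) ->
  exists w1 w2 : T -> B 1, [/\ w1 t @[t --> a] --> ((0, x) : B 1), w2 t @[t --> a] --> ((0,
    x) : B 1) &
  \forall t \near a, [/\
     lag G1 (usubmx (z t).1, usubmx (grad_p (ocomp2 H G1 G2) (z t))) (w1 t),
     lag G2 (dsubmx (z t).1, dsubmx (grad_p (ocomp2 H G1 G2) (z t))) (w2 t)
   & lag H (col_mx (w1 t).1 (w2 t).1, col_mx (w1 t).2 (w2 t).2)
       (grad_x (ocomp2 H G1 G2) (z t), (z t).2)]].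
Proof.
move=> cz; pose s t := comp_sol H G (z t).
have cs : s t @[t --> a] --> ((0, rows 2 x) : 'M[R]_(1 + 1, d) * 'M[R]_(1 + 1, d)) :=
  comp_sol_cvg OH sG G0 cz.
have cs1 : (s t).1 @[t --> a] --> (0 : 'M[R]_(1 + 1, d)) by exact: cvg_fst2 cs.
have cs2 : (s t).2 @[t --> a] --> (rows 2 x : 'M[R]_(1 + 1, d)) by exact: cvg_snd2 cs.
have cw i : (row i (s t).1, row i (s t).2) @[t --> a] --> ((0, x) : B 1).
  apply: cvg_both; first by have := cvg_row (i := i) cs1; rewrite row0.
  by have := cvg_row (i := i) cs2; rewrite rowK.
exists (fun t => (row 0 (s t).1, row 0 (s t).2)), (fun t => (row 1 (s t).1, row 1 (s t).2)).
split; [exact: cw|exact: cw|].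
apply: filterS2 (near_grads cz cs2) (comp_sol_eq_cvg OH sG G0 cz) => t.
rewrite -/(s t) => -[E1 E2] [h1 h2 h3 h4]; rewrite E1 in h1; rewrite E2 in h3.
rewrite -[ocomp2 H G1 G2]/(ocomp H G) h3 h4 !col_mxKu !col_mxKd.
split; split => //=.
- by rewrite h1 row0_col.
- by rewrite h1 row1_col.
- by rewrite -!col_rows.
- by rewrite -!col_rows.
Qed.

Lemma ocomp2_join (z1 : T -> 'M[R]_(k1, d) * 'M[R]_(k1, d)) (z2 : T -> 'M[R]_(k2,
  d) * 'M[R]_(k2, d))
    (w1 w2 w : T -> B 1) :
  (z1 t).1 @[t --> a] --> (0 : 'M[R]_(k1, d)) -> (z2 t).1 @[t --> a] --> (0 : 'M[R]_(k2, d)) ->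
  w1 t @[t --> a] --> ((0, x) : B 1) -> w2 t @[t --> a] --> ((0, x) : B 1) ->
    w t @[t --> a] --> ((0, x) : B 1) ->
  \forall t \near a, lag G1 (z1 t) (w1 t) -> lag G2 (z2 t) (w2 t) ->
    lag H (col_mx (w1 t).1 (w2 t).1, col_mx (w1 t).2 (w2 t).2) (w t) ->
    lag (ocomp2 H G1 G2) (col_mx (z1 t).1 (z2 t).1, col_mx (z1 t).2 (z2 t).2) (w t).
Proof.
move=> c1 c2 cw1 cw2 cw.
pose z t : B (k1 + k2) := (col_mx (z1 t).1 (z2 t).1, (w t).2).
pose s t : 'M[R]_(1 + 1, d) * 'M[R]_(1 + 1, d) := (col_mx (w1 t).1 (w2 t).1,
  col_mx (w1 t).2 (w2 t).2).
have cz : z t @[t --> a] --> ((0, x) : B (k1 + k2)).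
  apply: cvg_both; last exact: (cvg_snd2 (b := (0 : 'rV[R]_d))).
  by have := cvg_col_mx c1 c2; rewrite col_mx0.
have cs2 : (s t).2 @[t --> a] --> (rows 2 x : 'M[R]_(1 + 1, d)).
  rewrite (mx2 (fun=> x)); apply: cvg_col_mx; exact: (cvg_snd2 (b := (0 : 'rV[R]_d))).
have cs : s t @[t --> a] --> ((0, rows 2 x) : 'M[R]_(1 + 1, d) * 'M[R]_(1 + 1, d)).
  apply: cvg_both => //; rewrite -(col_mx0 R 1 1 d).
  by apply: cvg_col_mx; exact: (cvg_fst2 (c := x)).
apply: filterS3 (near_grads cz cs2) (comp_sol_unique_cvg OH sG G0 cz cs) (comp_sol_eq_cvg OH sG G0 cz) => t.
move=> [E1 E2] U [_ _ h3 h4] [e1 e2] [e3 e4] [e5 e6].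
have E : s t = comp_sol H G (z t).
  apply: U => //; rewrite E1 /= col_mxKu col_mxKd row0_col row1_col.
  by rewrite -e2 -e4.
rewrite -E E2 in h3; rewrite -E in h4.
rewrite -[ocomp2 H G1 G2]/(ocomp H G); split => /=.
  by rewrite -/(z t) h3 /= col_mxKu col_mxKd row0_col row1_col -e1 -e3.
by rewrite -/(z t) h4.
Qed.
End Relation.
End TwoArguments.
End Relations.

(** * The group of generating functions and its odd elements *)

Section GroupOfGerms.
Context {R : realType} {d : nat}.
Notation B n := (B R d n).
Notation rows n x := (\matrix_(i < n) x : 'M[R]_(n, d)).
Implicit Types F G : B 1 -> R.

Lemma germ_eqP n (F F' : B n -> R) : germ_eq F F' <-> forall x, \forall z \near ((0, x) : B n),
  F z = F' z.
Proof. exact: nearB0P. Qed.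

Lemma germ_eq_grads n (F F' : B n -> R) : germ_eq F F' -> forall x, \forall z \near ((0, x) : B n),
  grad_p F z = grad_p F' z /\ grad_x F z = grad_x F' z.
Proof.
move=> /germ_eqP H x; apply: filterS (near_join (H x)) => z Hz.
by split; [exact: grad_p_ext|exact: grad_x_ext].
Qed.

Lemma Ogen_ext n (F F' : B n -> R) : germ_eq F F' -> Ogen R d n F -> Ogen R d n F'.
Proof.
move=> H [Ft OFt HF]; exists Ft => //; apply/germ_eqP => x.
move/germ_eqP: H => /(_ x) H; move/germ_eqP: HF => /(_ x) HF.
by apply: filterS2 H HF => z <-.
Qed.

Lemma lag_ext (T : topologicalType) n (F F' : B n -> R) (z : T -> 'M[R]_(n, d) * 'M[R]_(n,
  d)) (w : T -> B 1) (a : T) x :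
  germ_eq F F' -> (z t).1 @[t --> a] --> (0 : 'M[R]_(n, d)) -> w t @[t --> a] --> ((0, x) : B 1) ->
  \forall t \near a, lag F (z t) (w t) -> lag F' (z t) (w t).
Proof.
move=> E cz cw.
have c : ((z t).1, (w t).2) @[t --> a] --> ((0, x) : B n).
  by apply: cvg_both => //; exact: (cvg_snd2 (b := (0 : 'rV[R]_d))).
apply: filterS (near_cvg c (germ_eq_grads E x)) => t [E1 E2] [h1 h2].
by split; rewrite -?E1 -?E2.
Qed.

Lemma cvg_p (T : topologicalType) n (f : T -> B n) (a : T) x : f t @[t --> a] --> ((0, x) : B n) ->
  (f t).1 @[t --> a] --> (0 : 'M[R]_(n, d)).
Proof. exact: (cvg_fst2 (c := x)). Qed.

Lemma cvg_x (T : topologicalType) n (f : T -> B n) (a : T) x : f t @[t --> a] --> ((0, x) : B n) ->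
  (f t).2 @[t --> a] --> x.
Proof. exact: (cvg_snd2 (b := (0 : 'M[R]_(n, d)))). Qed.

Lemma unitI_S0 : unitI R d = @S0 R d 1.
Proof. by apply/funext => z; rewrite S0E rows1 dot1. Qed.

Lemma unitI_Ogen : Ogen R d 1 (unitI R d).
Proof.
rewrite unitI_S0; apply/OgenP; split=> x; [exact: smooth_S0|by rewrite S0E dot0l|exact: grad_p_S0].
Qed.

Lemma lag_unitI z w : lag (unitI R d) z w <-> w = z.
Proof.
have -> : unitI R d = fun z => dot z.1 z.2 by apply/funext => y; rewrite dot1.
pose q : B 1 := (z.1, w.2).
have d1 : differentiable (fun z : B 1 => z.1) q by apply: smooth_at_diff; exact: smooth_at_lin.
have d2 : differentiable (fun z : B 1 => z.2) q by apply: smooth_at_diff; exact: smooth_at_lin.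
have Dv v : 'D_v (fun z : B 1 => dot z.1 z.2) q = dot q.1 v.2 + dot v.1 q.2.
  apply: (etrans (derive_dot v d1 d2)).
  by rewrite (derive_lin (l := fun z : B 1 => z.2)) // (derive_lin (l := fun z : B 1 => z.1)).
have Ep : grad_p (fun z : B 1 => dot z.1 z.2) q = w.2.
  by apply/matrixP => i j; rewrite [LHS]mxE Dv /= dot0r add0r dot_delta.
have Ex : grad_x (fun z : B 1 => dot z.1 z.2) q = z.1.
  by apply/matrixP => i j; rewrite [LHS]mxE Dv /= dot0l addr0 dotC dot_delta (ord1 i).
rewrite /lag -/q Ep Ex; split=> [[E1 E2]|->//].
by rewrite [LHS]surjective_pairing [RHS]surjective_pairing E1 E2.
Qed.

Lemma psi_unitI x : \forall z \near ((0, x) : B 1), psi (unitI R d) z = z.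
Proof. by apply: filterS (psi_lag unitI_Ogen x) => z /lag_unitI. Qed.

Lemma psi_ext F F' : Ogen R d 1 F -> germ_eq F F' ->
  forall x, \forall z \near ((0, x) : B 1), psi F z = psi F' z.
Proof.
move=> OF E x; have OF' := Ogen_ext E OF.
have c := psi_cvg OF (cvg_idt ((0, x) : B 1)).
have n1 := lag_ext E (cvg_p (cvg_idt ((0, x) : B 1))) c.
have n2 := psi_unique_cvg OF' (cvg_idt ((0, x) : B 1)) c.
by apply: filterS3 n1 n2 (psi_lag OF x) => z h1 h2 h3; apply: h2; exact: h1.
Qed.

Lemma grad_cvg F x : Ogen R d 1 F ->
  (z.1, grad_p F z) @[z --> ((0, x) : B 1)] --> ((0, x) : B 1) /\
  (grad_x F z, z.2) @[z --> ((0, x) : B 1)] --> ((0, x) : B 1).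
Proof.
move=> OF; have ci := cvg_idt ((0, x) : B 1); split; apply: cvg_both.
- exact: cvg_p ci.
- have := smooth_at_cont (smooth_grad_p (Ogen_smooth OF x)).
  by rewrite /prop_for /continuous_at (Ogen_grad_p0 OF).
- have := smooth_at_cont (smooth_grad_x (Ogen_smooth OF x)).
  by rewrite /prop_for /continuous_at (Ogen_grad_x0 OF).
- exact: cvg_x ci.
Qed.

(** Each [z] near the zero section yields a point [(p, grad_p F z)] on which the value
    of [psi F] is known, and there [psi F'] determines [grad_p F' z]. *)
Lemma psi_inj F F' : Ogen R d 1 F -> Ogen R d 1 F' ->
  (forall x, \forall z \near ((0, x) : B 1), psi F z = psi F' z) -> germ_eq F F'.
Proof.
move=> OF OF' E; apply: germ_eq_grad_p.
- exact: Ogen_smooth.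
- exact: Ogen_smooth.
- by move=> x; rewrite !Ogen0.
move=> x; have [c1 c2] := grad_cvg x OF.
apply: filterS3 (psi_unique_cvg OF c1 c2) (near_cvg c1 (E x)) (psi_lag_cvg OF' c1).
case=> p y h1 h2 h3.
by move: h3; rewrite -h2 -(h1 (conj erefl erefl)) => -[].
Qed.

Lemma psi_ocomp1 F G x : Ogen R d 1 F -> Ogen R d 1 G ->
  \forall z \near ((0, x) : B 1), psi (ocomp1 F G) z = psi F (psi G z).
Proof.
move=> OF OG; have ci := cvg_idt ((0, x) : B 1); have c1 := psi_cvg OG ci; have c2 := psi_cvg OF c1.
have n1 := ocomp1_join OF OG (cvg_p ci) c1 c2.
have n2 := psi_unique_cvg (ocomp1_Ogen OF OG) ci c2.
have n3 := near_and (psi_lag OG x) (psi_lag_cvg OF c1).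
by apply: filterS3 n1 n2 n3 => z h1 h2 [h3 h4]; apply/esym/h2/h1.
Qed.

(** The first component of [psi F] is a gradient in [x], and the derivatives in [p] and
    [x] commute: what remains is the derivative in [x] of [grad_p F (0, x) = x]. *)
Lemma psi_derive_p F x h : Ogen R d 1 F -> 'D_(h, 0) (fun z => (psi F z).1) ((0, x) : B 1) = h.
Proof.
move=> OF; set z0 : B 1 := (0, x).
have sps : smooth_at (psi F) z0 := psi_smooth OF x.
have sX : smooth_at (fun z => (psi F z).2) z0 by exact: smooth_snd.
pose q (z : B 1) : B 1 := (z.1, (psi F z).2).
have sq : smooth_at q z0 by apply: smooth_at_pair => //; exact: smooth_at_lin.
have q0 : q z0 = z0 by rewrite /q psi0.
have sF : smooth_at F (q z0) by rewrite q0; exact: Ogen_smooth.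
rewrite (near_eq_derive (g := fun z => grad_x F (q z))); last first.
  by apply: filterS (psi_lag OF x) => z [].
apply: (etrans (derive_comp (f := q) (h,
  0) (smooth_at_diff sq) (smooth_at_diff (smooth_grad_x sF)))).
set v := 'D_(h, 0) q z0; rewrite q0.
have v1 : v.1 = h.
  rewrite /v derive_pair /=; [|by apply: smooth_at_diff;
    exact: smooth_at_lin|exact: smooth_at_diff].
  by rewrite (derive_lin (l := fun z : B 1 => z.1)).
rewrite q0 in sF; apply/matrixP => i j; rewrite (ord1 i) -derive_entry; last first.
  by apply: smooth_at_diff; exact: smooth_grad_x.
rewrite (_ : (fun z => _) = 'D_(0, delta_mx 0 j) F); last by apply/funext => w; rewrite mxE.
rewrite smooth_schwarz //; apply: derive_affine_along => t.
have Dv y : 'D_v F ((0, y) : B 1) = dot h y.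
  rewrite [v]surjective_pairing v1 derive_grad; last by apply: smooth_at_diff; exact: Ogen_smooth.
  by rewrite (Ogen_grad_p0 OF) (Ogen_grad_x0 OF) dot0r addr0.
have -> : t *: (0, delta_mx 0 j) + z0 = (0, t *: delta_mx 0 j + x) :> B 1.
  by apply/pair_equal_spec; rewrite /= scaler0 addr0.
by rewrite !Dv dotC dot_linear dot_delta dotC.
Qed.

(** The Legendre transform [Phi (p', y) = p' x + p y - F (p, x)], where [p] and [x] are
    the solutions of [p' = grad_x F (p, x)] and [y = grad_p F (p, x)], generates the
    relation of [F] read backwards. *)
Lemma right_inverse F : Ogen R d 1 F -> exists2 Phi, Ogen R d 1 Phi &
  forall x, \forall z \near ((0, x) : B 1), psi F (psi Phi z) = z.
Proof.
move=> OF.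
have [|x|x h|sg Hsg] := @param_inverse _ _ (fun z : B 1 => (psi F z).1).
- by move=> x; apply: smooth_fst; exact: psi_smooth.
- by rewrite psi0.
- exact: psi_derive_p.
have ssg x : smooth_at sg ((0, x) : B 1) by have [] := Hsg x.
have sg0 x : sg (0, x) = 0 by have [] := Hsg x.
pose q (z : B 1) : B 1 := (sg z, z.2).
have sq x : smooth_at q ((0, x) : B 1) by apply: smooth_at_pair => //; exact: smooth_at_lin.
have q0 x : q (0, x) = (0, x) by rewrite /q sg0.
pose X (z : B 1) := (psi F (q z)).2.
have sX x : smooth_at X ((0, x) : B 1).
  by apply: smooth_snd; apply: (smooth_at_comp (sq x)); rewrite q0; exact: psi_smooth.
have X0 x : X (0, x) = x by rewrite /X q0 psi0.
(* [tau (p', y)] is the point [(p, x)] of the Legendre transform, [sg] its first component *)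
pose tau (z : B 1) : B 1 := (sg z, X z).
have stau x : smooth_at tau ((0, x) : B 1) by exact: smooth_at_pair.
have tau0 x : tau (0, x) = (0, x) by rewrite /tau sg0 X0.
have cq x : q z @[z --> ((0, x) : B 1)] --> ((0, x) : B 1).
  by have := smooth_at_cont (sq x); rewrite /prop_for /continuous_at q0.
have psiq x : \forall z \near ((0, x) : B 1), psi F (q z) = (z.1, X z).
  have [_ _ E] := Hsg x; apply: filterS E => z Ez.
  by rewrite [LHS]surjective_pairing /X Ez.
have lagq x : \forall z \near ((0, x) : B 1), z.2 = grad_p F (tau z) /\ z.1 = grad_x F (tau z).
  apply: filterS2 (psiq x) (psi_lag_cvg OF (cq x)) => z ->.
  by case.
pose Psi (w : B 1 * B 1) : R := dot w.1.1 w.2.2 + dot w.2.1 w.1.2 - F w.2.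
pose Phi z := Psi (z, tau z).
have sPsi w : smooth_at F w.2 -> smooth_at Psi w.
  move=> sF; apply: smooth_atB; last first.
    by apply: (smooth_at_comp (f := fun w : B 1 * B 1 => w.2)) => //; exact: smooth_at_lin.
  by apply: smooth_atD; apply: smooth_dot; exact: smooth_at_lin.
have DPsi w v h : smooth_at F w.2 -> 'D_(v, h) Psi w =
    dot w.1.1 h.2 + dot v.1 w.2.2 + (dot w.2.1 v.2 + dot h.1 w.1.2) - 'D_h F w.2.
  move=> sF.
  have sl (l : B 1 * B 1 -> 'rV[R]_d) : linear l -> differentiable l w.
    by move=> ll; apply: smooth_at_diff; exact: smooth_at_lin.
  have l11 : linear (fun w : B 1 * B 1 => w.1.1) by [].
  have l12 : linear (fun w : B 1 * B 1 => w.1.2) by [].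
  have l21 : linear (fun w : B 1 * B 1 => w.2.1) by [].
  have l22 : linear (fun w : B 1 * B 1 => w.2.2) by [].
  have l2 : linear (fun w : B 1 * B 1 => w.2) by [].
  have d2 : differentiable (fun w : B 1 * B 1 => w.2) w by apply: smooth_at_diff;
    exact: smooth_at_lin.
  have sd1 : smooth_at (fun w : B 1 * B 1 => dot w.1.1 w.2.2) w by apply: smooth_dot;
    exact: smooth_at_lin.
  have sd2 : smooth_at (fun w : B 1 * B 1 => dot w.2.1 w.1.2) w by apply: smooth_dot;
    exact: smooth_at_lin.
  have sF' : smooth_at (fun w : B 1 * B 1 => F w.2) w.
    by apply: (smooth_at_comp (f := fun w : B 1 * B 1 => w.2)) => //; exact: smooth_at_lin.
  rewrite derive_sub; [|by apply: smooth_at_diff; exact: smooth_atD|exact: smooth_at_diff].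
  rewrite derive_add; [|exact: smooth_at_diff|exact: smooth_at_diff].
  congr (_ + _ - _).
  - apply: (etrans (derive_dot (v, h) (sl _ l11) (sl _ l22))).
    by rewrite (derive_lin (l := fun w : B 1 * B 1 => w.1.1)) // (derive_lin (l := fun w :
      B 1 * B 1 => w.2.2)).
  - apply: (etrans (derive_dot (v, h) (sl _ l21) (sl _ l12))).
    by rewrite (derive_lin (l := fun w : B 1 * B 1 => w.2.1)) // (derive_lin (l := fun w :
      B 1 * B 1 => w.1.2)).
have gradPhi x : \forall z \near ((0, x) : B 1), grad_p Phi z = X z /\ grad_x Phi z = sg z.
  have nF : \forall z \near ((0, x) : B 1), smooth_at F (tau z).
    apply: (near_pull (smooth_at_cont (stau x))); rewrite tau0.
    exact: smooth_at_near (Ogen_smooth OF x).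
  apply: filterS3 (lagq x) nF (smooth_at_near (stau x)) => z [E1 E2] sF sz.
  have D0 h : 'D_(0, h) Psi (z, tau z) = 0.
    rewrite DPsi //= [h]surjective_pairing derive_grad; last exact: smooth_at_diff.
    by rewrite -E1 -E2 /= dot0l dot0r addr0 add0r (dotC z.1) [X in X - _]addrC subrr.
  have Dv v : 'D_v Phi z = dot v.1 (X z) + dot (sg z) v.2.
    apply: (etrans (envelope (sigma := tau) v (smooth_at_diff (sPsi (z,
      tau z) sF)) (smooth_at_diff sz) D0)).
    by rewrite DPsi //= dot0r dot0l add0r addr0 derive0 subr0.
  split; apply/matrixP => i j; rewrite [LHS]mxE Dv /=.
    by rewrite dot0r addr0 dot_delta.
  by rewrite dot0l add0r dotC dot_delta (ord1 i).
have OPhi : Ogen R d 1 Phi.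
  apply/OgenP; split=> x.
  - apply: (smooth_at_comp (f := fun z => (z, tau z))).
      by apply: smooth_at_pair => //; exact: smooth_at_id.
    by rewrite tau0; apply: sPsi; exact: Ogen_smooth.
  - by rewrite /Phi /Psi tau0 /= !dot0l (Ogen0 OF) addr0 subr0.
  - by have [-> _] := nbhs_singleton (gradPhi x); rewrite X0 rows1.
exists Phi; [exact: OPhi|move=> x].
have ci := cvg_idt ((0, x) : B 1); have cPhi := psi_cvg OPhi ci.
have cz : (z.1, (psi Phi z).2) @[z --> ((0, x) : B 1)] --> ((0, x) : B 1).
  by apply: cvg_both; [exact: cvg_p ci|exact: cvg_x cPhi].
apply: filterS3 (psi_lag OPhi x) (near_cvg cz (gradPhi x)) (near_cvg cz (psiq x)) =>
  z [h1 h2] [h3 h4].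
rewrite /q /= -h4 -h2 -h3 -h1 -!surjective_pairing.
by [].
Qed.

(** A right inverse that has a right inverse itself is two-sided. *)
Lemma two_sided_inverse F : Ogen R d 1 F -> exists2 Phi, Ogen R d 1 Phi &
  forall x, (\forall z \near ((0, x) : B 1), psi F (psi Phi z) = z) /\
            (\forall z \near ((0, x) : B 1), psi Phi (psi F z) = z).
Proof.
move=> OF; have [Phi OPhi H1] := right_inverse OF; have [F' OF' H2] := right_inverse OPhi.
exists Phi; [exact: OPhi|move=> x; split; [exact: H1|]].
have ci := cvg_idt ((0, x) : B 1).
have n1 := near_cvg (psi_cvg OF' ci) (H1 x).
have n2 := near_cvg (psi_cvg OF ci) (H2 x).
have n3 : \forall z \near ((0, x) : B 1), psi F z = psi F' z.
  by apply: filterS2 n1 (H2 x) => z h1 h2; rewrite h2 in h1.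
by apply: filterS2 n3 (H2 x) => z ->.
Qed.

Lemma ocomp1_psi_inverse F G : Ogen R d 1 F -> Ogen R d 1 G ->
  (germ_eq (ocomp1 F G) (unitI R d) <-> forall x, \forall z \near ((0, x) : B 1),
    psi F (psi G z) = z).
Proof.
move=> OF OG; have OFG := ocomp1_Ogen OF OG; split=> [E x|E].
  apply: filterS3 (psi_ext OFG E x) (psi_ocomp1 x OF OG) (psi_unitI x) => z h1 h2 h3.
  by rewrite -h2 h1.
apply: psi_inj => //; first exact: unitI_Ogen.
move=> x; apply: filterS3 (E x) (psi_ocomp1 x OF OG) (psi_unitI x) => z h1 h2 h3.
by rewrite h2 h1 h3.
Qed.

Lemma inverse_is F : Ogen R d 1 F -> is_inverse F (inverse F).
Proof.
move=> OF; apply: (@xgetPex _ (unitI R d) [set G | is_inverse F G]).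
have [Phi OPhi H] := two_sided_inverse OF; exists Phi; split => //.
  by apply/ocomp1_psi_inverse => // x; have [] := H x.
by apply/ocomp1_psi_inverse => // x; have [] := H x.
Qed.

Lemma inverse_Ogen F : Ogen R d 1 F -> Ogen R d 1 (inverse F).
Proof. by move=> /inverse_is[]. Qed.

Lemma psiK F : Ogen R d 1 F -> forall x, \forall z \near ((0, x) : B 1),
  psi (inverse F) (psi F z) = z.
Proof. by move=> OF; have [OG _ /(ocomp1_psi_inverse OG OF)] := inverse_is OF. Qed.

Lemma psiVK F : Ogen R d 1 F -> forall x, \forall z \near ((0, x) : B 1),
  psi F (psi (inverse F) z) = z.
Proof. by move=> OF; have [OG /(ocomp1_psi_inverse OF OG)] := inverse_is OF. Qed.

Lemma Ogen_group : is_group (@germ_eq R d 1) (Ogen R d 1) (@ocomp1 R d 1) (unitI R d) (@inverse R d).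
Proof.
have OI := unitI_Ogen.
split=> [a b|a b|//|a|a a' b b' Oa Oa' Ob Ob' Ea Eb|a a' Oa Oa' Ea|a b c Oa Ob Oc|a Oa|a Oa].
- exact: Ogen_ext.
- exact: ocomp1_Ogen.
- exact: inverse_Ogen.
- apply: psi_inj; [exact: ocomp1_Ogen|exact: ocomp1_Ogen|] => x.
  have cb := psi_cvg Ob (cvg_idt ((0, x) : B 1)).
  have n1 := near_and (psi_ocomp1 x Oa Ob) (psi_ocomp1 x Oa' Ob').
  have n2 := near_cvg cb (psi_ext Oa Ea x).
  apply: filterS3 n1 n2 (psi_ext Ob Eb x) => z [h1 h2] h3 h4.
  by apply: (etrans h1); apply: (etrans h3); apply: (etrans _ (esym h2)); rewrite h4.
- apply: psi_inj; [exact: inverse_Ogen|exact: inverse_Ogen|] => x.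
  have ci := psi_cvg (inverse_Ogen Oa') (cvg_idt ((0, x) : B 1)).
  have n1 := near_cvg ci (psi_ext Oa Ea x).
  have n2 := near_cvg ci (psiK Oa x).
  by apply: filterS3 n1 n2 (psiVK Oa' x) => z h1 h2 h3; rewrite h1 h3 in h2.
- have Oab := ocomp1_Ogen Oa Ob; have Obc := ocomp1_Ogen Ob Oc.
  apply: psi_inj; [exact: ocomp1_Ogen|exact: ocomp1_Ogen|] => x.
  have cc := psi_cvg Oc (cvg_idt ((0, x) : B 1)).
  have n1 := near_and (psi_ocomp1 x Oa Obc) (psi_ocomp1 x Ob Oc).
  have n2 := near_cvg cc (psi_ocomp1 x Oa Ob).
  apply: filterS3 n1 n2 (psi_ocomp1 x Oab Oc) => z [h1 h2] h3 h4.
  by apply: (etrans h1); apply: (etrans _ (esym h4)); apply: (etrans _ (esym h3)); rewrite h2.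
- split; (apply: psi_inj; [exact: ocomp1_Ogen|done|]) => x.
    have n1 := near_cvg (psi_cvg Oa (cvg_idt ((0, x) : B 1))) (psi_unitI x).
    by apply: filterS2 n1 (psi_ocomp1 x OI Oa) => z h1 ->.
  by apply: filterS2 (psi_unitI x) (psi_ocomp1 x Oa OI) => z h1 ->; rewrite h1.
- by have [_ h1 h2] := inverse_is Oa.
Qed.

Lemma cvg_inv (T : topologicalType) (f : T -> B 1) (a : T) x : f t @[t --> a] --> ((0, x) : B 1) ->
  gpd_inv (f t) @[t --> a] --> ((0, x) : B 1).
Proof.
move=> cf; apply: cvg_both; last exact: cvg_x cf.
by rewrite -(oppr0 'rV[R]_d); apply: cvgN; exact: cvg_p cf.
Qed.

Let inv_linear : linear (@gpd_inv R d).
Proof. by move=> a u v; apply: injective_projections => //=; rewrite opprD scalerN. Qed.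

Lemma gpd_invK : involutive (@gpd_inv R d).
Proof. by case=> p x; rewrite /gpd_inv /= opprK. Qed.

(** [F] is odd when it agrees with its reflection, and reflecting [F] conjugates
    [psi F] by the inversion. *)
Definition reflect F : B 1 -> R := fun z => - F (gpd_inv z).

Lemma grad_reflect F z : differentiable F (gpd_inv z) ->
  grad_p (reflect F) z = grad_p F (gpd_inv z) /\ grad_x (reflect F) z = - grad_x F (gpd_inv z).
Proof.
move=> dF; have di : differentiable (@gpd_inv R d) z by apply: smooth_at_diff; exact: smooth_at_lin.
have Dv v : 'D_v (reflect F) z = dot v.1 (grad_p F (gpd_inv z)) - dot v.2 (grad_x F (gpd_inv z)).
  rewrite [LHS]deriveN; last by apply: diff_derivable; exact: differentiable_comp.
  apply: (etrans (congr1 -%R (derive_comp (f := @gpd_inv R d) v di dF))).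
  by rewrite (derive_lin (l := @gpd_inv R d)) // derive_grad //= dotNl opprD opprK.
split; apply/matrixP => i j; rewrite [LHS]mxE Dv /=.
  by rewrite dot0l subr0 dot_delta.
by rewrite dot0l add0r dot_delta (ord1 i) [RHS]mxE.
Qed.

Lemma reflect_Ogen F : Ogen R d 1 F -> Ogen R d 1 (reflect F).
Proof.
move=> OF; have i0 x : gpd_inv (0, x) = (0, x) :> B 1 by rewrite /gpd_inv /= oppr0.
apply/OgenP; split=> x.
- apply: smooth_atN; apply: (smooth_at_comp (smooth_at_lin _ inv_linear)).
  by rewrite i0; exact: Ogen_smooth.
- by rewrite /reflect i0 (Ogen0 OF) oppr0.
- have [|-> _] := @grad_reflect F (0, x); first by rewrite i0; apply: smooth_at_diff;
  exact: Ogen_smooth.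
  by rewrite i0 (Ogen_grad_p0 OF) rows1.
Qed.

Lemma psi_reflect F x : Ogen R d 1 F -> \forall z \near ((0, x) : B 1),
  psi (reflect F) z = gpd_inv (psi F (gpd_inv z)).
Proof.
move=> OF; have ci := cvg_idt ((0, x) : B 1).
have c1 := cvg_inv ci; have c2 := psi_cvg OF c1; have c3 := cvg_inv c2.
have c4 : ((gpd_inv z).1, (psi F (gpd_inv z)).2) @[z --> ((0, x) : B 1)] --> ((0, x) : B 1).
  by apply: cvg_both; [exact: cvg_p c1|exact: cvg_x c2].
have n1 := near_cvg c4 (smooth_at_near (Ogen_smooth OF x)).
apply: filterS3 n1 (psi_lag_cvg OF c1) (psi_unique_cvg (reflect_Ogen OF) ci c3) => z sF [h1 h2] h3.
apply/esym/h3; rewrite /lag /=.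
have [|-> ->] := @grad_reflect F (z.1, (psi F (gpd_inv z)).2); first exact: smooth_at_diff.
by rewrite /gpd_inv /= -h1 -h2.
Qed.

Lemma odd_psi F : Ogen R d 1 F -> (odd_p F <->
  forall x, \forall z \near ((0, x) : B 1), psi F (gpd_inv z) = gpd_inv (psi F z)).
Proof.
move=> OF.
have oddE : odd_p F <-> germ_eq F (reflect F).
  rewrite /odd_p; split=> /germ_eqP H; apply/germ_eqP => x; apply: filterS (H x) => z;
    rewrite /reflect /gpd_inv.
    by move=> ->; rewrite opprK.
  by move=> ->; rewrite opprK.
rewrite oddE; split=> [E x|E].
  apply: filterS2 (psi_ext OF E x) (psi_reflect x OF) => z -> ->.
  by rewrite gpd_invK.
apply: psi_inj => //; first exact: reflect_Ogen.
move=> x; apply: filterS2 (psi_reflect x OF) (E x) => z -> ->.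
by rewrite gpd_invK.
Qed.

Lemma Oodd_subgroup : is_subgroup (@germ_eq R d 1) (Ogen R d 1) (@ocomp1 R d 1) (unitI R d)
    (@inverse R d) (Oodd R d).
Proof.
split; first exact: Ogen_group.
- by move=> F [].
- move=> a b E [Oa oa]; have Ob := Ogen_ext E Oa; split=> //.
  apply/odd_psi => // x; move/odd_psi: oa => /(_ Oa x) oa.
  have n1 := near_cvg (cvg_inv (cvg_idt ((0, x) : B 1))) (psi_ext Oa E x).
  by apply: filterS3 n1 (psi_ext Oa E x) oa => z -> ->.
- split; first exact: unitI_Ogen.
  apply/odd_psi; first exact: unitI_Ogen.
  move=> x; have n1 := near_cvg (cvg_inv (cvg_idt ((0, x) : B 1))) (psi_unitI x).
  by apply: filterS2 n1 (psi_unitI x) => z -> ->.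
- move=> a b [Oa oa] [Ob ob]; have Oab := ocomp1_Ogen Oa Ob; split=> //.
  apply/odd_psi => // x; move/odd_psi: oa => /(_ Oa x) oa; move/odd_psi: ob => /(_ Ob x) ob.
  have ci := cvg_idt ((0, x) : B 1).
  have n1 := near_cvg (cvg_inv ci) (psi_ocomp1 x Oa Ob).
  have n2 := near_cvg (psi_cvg Ob ci) oa.
  by apply: filterS3 (near_and n1 (psi_ocomp1 x Oa Ob)) n2 ob => z [-> ->] h1 h2; rewrite h2 h1.
- move=> a [Oa oa]; have Oi := inverse_Ogen Oa; split=> //.
  apply/odd_psi => // x; move/odd_psi: oa => /(_ Oa x) oa.
  have ci := cvg_idt ((0, x) : B 1); have cp := psi_cvg Oi ci; have cvi := cvg_inv cp.
  have n1 := near_cvg cp oa.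
  have n2 := near_cvg cvi (psiK Oa x).
  apply: filterS3 n1 n2 (psiVK Oa x) => z h1 h2 h3.
  by rewrite h1 h3 in h2.
Qed.

End GroupOfGerms.

(** * Conjugation of a function of degree two *)

Section Conjugate.
Context {R : realType} {d : nat}.
Notation B n := (B R d n).
Notation rows n x := (\matrix_(i < n) x : 'M[R]_(n, d)).

(** [w] is the product of [z1] and [z2]. *)
Definition lag2 (S : B 2 -> R) (z1 z2 w : B 1) : Prop :=
  lag (n := 1 + 1) S (col_mx z1.1 z2.1, col_mx z1.2 z2.2) w.

Section SplitLag.
Variables (T : topologicalType) (a : T) (x : 'rV[R]_d).

Lemma ocomp1_split_lag n (F : B 1 -> R) (S : B n -> R) (z : T -> 'M[R]_(n, d) * 'M[R]_(n,
  d)) (w : T -> B 1) :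
  Ogen R d 1 F -> Ogen R d n S ->
  (z t).1 @[t --> a] --> (0 : 'M[R]_(n, d)) -> w t @[t --> a] --> ((0, x) : B 1) ->
  exists2 v : T -> B 1, v t @[t --> a] --> ((0, x) : B 1) &
  \forall t \near a, lag (ocomp1 F S) (z t) (w t) -> lag S (z t) (v t) /\ lag F (v t) (w t).
Proof.
move=> OF OS cz cw.
have cy : ((z t).1, (w t).2) @[t --> a] --> ((0, x) : B n) by apply: cvg_both => //;
  exact: cvg_x cw.
have [v cv H] := ocomp1_split OF OS cy; exists v => //.
by apply: filterS H => t [h1 h2] [/= e1 e2]; rewrite /= -e1 -e2 -!surjective_pairing in h1 h2.
Qed.

Lemma ocomp2_split_lag k1 k2 (H : B 2 -> R) (G1 : B k1 -> R) (G2 : B k2 -> R)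
    (z : T -> 'M[R]_(k1 + k2, d) * 'M[R]_(k1 + k2, d)) (w : T -> B 1) :
  Ogen R d 2 H -> Ogen R d k1 G1 -> Ogen R d k2 G2 ->
  (z t).1 @[t --> a] --> (0 : 'M[R]_(k1 + k2, d)) -> w t @[t --> a] --> ((0, x) : B 1) ->
  exists w1 w2 : T -> B 1, [/\ w1 t @[t --> a] --> ((0, x) : B 1), w2 t @[t --> a] --> ((0,
    x) : B 1) &
  \forall t \near a, lag (ocomp2 H G1 G2) (z t) (w t) -> [/\
     lag G1 (usubmx (z t).1, usubmx (z t).2) (w1 t),
     lag G2 (dsubmx (z t).1, dsubmx (z t).2) (w2 t) & lag2 H (w1 t) (w2 t) (w t)]].
Proof.
move=> OH O1 O2 cz cw.
have cy : ((z t).1, (w t).2) @[t --> a] --> ((0, x) : B (k1 + k2)) by apply: cvg_both => //;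
  exact: cvg_x cw.
have [w1 [w2 [c1 c2 Hs]]] := ocomp2_split OH O1 O2 cy; exists w1, w2; split => //.
apply: filterS Hs => t [h1 h2 h3] [/= e1 e2].
by rewrite /= -e1 -?e2 -?surjective_pairing in h1 h2 h3.
Qed.
End SplitLag.

Variables (S : B 2 -> R) (F : B 1 -> R).
Hypotheses (OS : Ogen R d 2 S) (OF : Ogen R d 1 F).
Let Phi := inverse F.
Let S' : B 2 -> R := ocomp2 (ocomp1 F S) Phi Phi.

Let OPhi : Ogen R d 1 Phi. Proof. exact: inverse_Ogen. Qed.
Let OFS : Ogen R d 2 (ocomp1 F S). Proof. exact: ocomp1_Ogen. Qed.

Lemma conjugate_Ogen : Ogen R d 2 S'.
Proof. exact: (ocomp2_Ogen OFS OPhi OPhi). Qed.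

Section PushPull.
Variables (T : topologicalType) (a : T) (x : 'rV[R]_d) (z1 z2 w : T -> B 1).
Hypotheses (c1 : z1 t @[t --> a] --> ((0, x) : B 1)) (c2 : z2 t @[t --> a] --> ((0, x) : B 1))
  (cw : w t @[t --> a] --> ((0, x) : B 1)).

(** [F(S)] moves the product by [psi F], and composing with the inverse of [F] in both
    arguments moves the factors by the inverse of [psi (inverse F)]. *)
Lemma push_lag : \forall t \near a, lag2 S (z1 t) (z2 t) (w t) ->
  lag2 S' (psi F (z1 t)) (psi F (z2 t)) (psi F (w t)).
Proof.
have p1 := psi_cvg OF c1; have p2 := psi_cvg OF c2; have pw := psi_cvg OF cw.
have cc : (col_mx (z1 t).1 (z2 t).1, col_mx (z1 t).2 (z2 t).2).1 @[t --> a] --> (0 :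
  'M[R]_(1 + 1, d)).
  by rewrite -(col_mx0 R 1 1 d); apply: cvg_col_mx; [exact: cvg_p c1|exact: cvg_p c2].
have n1 := @ocomp1_join R d 2 F S OF OS T (fun t => (col_mx (z1 t).1 (z2 t).1,
  col_mx (z1 t).2 (z2 t).2)) w _ a x cc cw pw.
have n2 := ocomp2_join OFS OPhi OPhi (cvg_p p1) (cvg_p p2) c1 c2 pw.
have n3 := near_and (near_cvg c1 (psiK OF x)) (near_cvg c2 (psiK OF x)).
have n4 := near_and (psi_lag_cvg OPhi p1) (psi_lag_cvg OPhi p2).
have n5 := psi_lag_cvg OF cw.
apply: filterS3 (near_and n1 n2) (near_and n3 n4) n5 => t [h1 h2] [[e1 e2] [l1 l2]] lw ls.
apply: h2; [by rewrite e1 in l1|by rewrite e2 in l2|].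
by apply: h1.
Qed.

Lemma pull_lag : \forall t \near a, lag2 S' (z1 t) (z2 t) (w t) ->
  lag2 S (psi Phi (z1 t)) (psi Phi (z2 t)) (psi Phi (w t)).
Proof.
have cc : (col_mx (z1 t).1 (z2 t).1, col_mx (z1 t).2 (z2 t).2).1 @[t --> a] --> (0 :
  'M[R]_(1 + 1, d)).
  by rewrite -(col_mx0 R 1 1 d); apply: cvg_col_mx; [exact: cvg_p c1|exact: cvg_p c2].
have [w1 [w2 [cw1 cw2 n1]]] := @ocomp2_split_lag T a x 1 1 (ocomp1 F S) Phi Phi
  (fun t => (col_mx (z1 t).1 (z2 t).1, col_mx (z1 t).2 (z2 t).2)) w OFS OPhi OPhi cc cw.
have cc' : (col_mx (w1 t).1 (w2 t).1, col_mx (w1 t).2 (w2 t).2).1 @[t --> a] --> (0 :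
  'M[R]_(1 + 1, d)).
  by rewrite -(col_mx0 R 1 1 d); apply: cvg_col_mx; [exact: cvg_p cw1|exact: cvg_p cw2].
have [v cv n2] := @ocomp1_split_lag T a x 2 F S
  (fun t => (col_mx (w1 t).1 (w2 t).1, col_mx (w1 t).2 (w2 t).2)) w OF OS cc' cw.
have n3 := near_and (psi_unique_cvg OPhi c1 cw1) (psi_unique_cvg OPhi c2 cw2).
have n4 := near_and (psi_unique_cvg OF cv cw) (near_cvg cv (psiK OF x)).
apply: filterS3 (near_and n1 n2) n3 n4 => t [h1 h2] [u1 u2] [uw k] ls.
have [l1 l2 l3] := h1 ls; have [l4 l5] := h2 l3.
rewrite /= !col_mxKu !col_mxKd -!surjective_pairing in l1 l2.
by rewrite -(u1 l1) -(u2 l2) (uw l5) k.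
Qed.
End PushPull.
End Conjugate.

(** * Associativity of the conjugate *)

Section ConjugateAssociativity.
Context {R : realType} {d : nat}.
Notation B n := (B R d n).
Notation rows n x := (\matrix_(i < n) x : 'M[R]_(n, d)).

Lemma col_mx3 n (a b c : 'rV[R]_n) :
  (col_mx (col_mx a b) c : 'M[R]_(2 + 1, n)) = (col_mx a (col_mx b c) : 'M[R]_(1 + 2, n)).
Proof.
apply/matrixP => i j; rewrite !mxE; case: splitP => k ik.
  rewrite mxE; case: splitP => k' kk'.
    case: splitP => l il; first by rewrite !ord1.
    by move: il; rewrite ik kk' (ord1 k').
  case: splitP => l il; first by move: (ltn_ord l); rewrite -il ik kk'.
  rewrite mxE; case: splitP => l' ll'; first by rewrite !ord1.
  by move: (ltn_ord k); rewrite kk' (ord1 k') => _; move: il;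
    rewrite ik kk' ll' (ord1 k') (ord1 l').
case: splitP => l il; first by move: (ltn_ord l); rewrite -il ik.
rewrite mxE; case: splitP => l' ll'; last by rewrite !ord1.
by move: il; rewrite ik ll' (ord1 k) (ord1 l').
Qed.

Section Assoc.
Variables (S : B 2 -> R) (F : B 1 -> R).
Hypotheses (OS : Ogen R d 2 S) (OF : Ogen R d 1 F).
Let S' : B 2 -> R := ocomp2 (ocomp1 F S) (inverse F) (inverse F).
Let OS' : Ogen R d 2 S' := conjugate_Ogen OS OF.
Let OI : Ogen R d 1 (inverse F) := inverse_Ogen OF.
Let phi := psi (inverse F).
Hypothesis assocS : germ_eq (ocomp2 S S (unitI R d) : B 3 -> R) (ocomp2 S (unitI R d) S).

(** Both sides generate relations made of two multiplications in a row. Pulled back by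
    [psi F] these become relations for [S], to which associativity applies, and the
    result is pushed forward again. *)
Lemma conjugate_assoc : germ_eq (ocomp2 S' S' (unitI R d) : B 3 -> R) (ocomp2 S' (unitI R d) S').
Proof.
have OU := @unitI_Ogen R d.
pose A1 : B 3 -> R := ocomp2 S' S' (unitI R d); pose A2 : B 3 -> R := ocomp2 S' (unitI R d) S'.
have O1 : Ogen R d 3 A1 := ocomp2_Ogen OS' OS' OU.
have O2 : Ogen R d 3 A2 := ocomp2_Ogen OS' OU OS'.
have [s1 z1 g1] := (OgenP A1).1 O1; have [s2 z2 g2] := (OgenP A2).1 O2.
apply: (@germ_eq_grad_p R d 3 A1 A2) => [//|//|y|x]; first by rewrite z1 z2.
pose T := B 3; pose a : T := (0, x).
have ci := cvg_idt a.
have cg : grad_p A1 z @[z --> a] --> rows 3 x.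
  by have := smooth_at_cont (smooth_grad_p (s1 x)); rewrite /prop_for /continuous_at g1.
have cgx : grad_x A1 z @[z --> a] --> (0 : 'rV[R]_d).
  by have := smooth_at_cont (smooth_grad_x (s1 x)); rewrite /prop_for /continuous_at grad_x0.
pose om (z : T) : B 1 := (grad_x A1 z, z.2).
have com : om z @[z --> a] --> ((0, x) : B 1) by apply: cvg_both => //; exact: cvg_x ci.
pose ze i (z : T) : B 1 := (row i z.1, row i (grad_p A1 z)).
have cze i : ze i z @[z --> a] --> ((0, x) : B 1).
  apply: cvg_both; first by have := cvg_row (i := i) (cvg_p ci); rewrite row0.
  by have := cvg_row (i := i) cg; rewrite rowK.
pose i0 : 'I_3 := inord 0; pose i1 : 'I_3 := inord 1; pose i2 : 'I_3 := inord 2.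
have rowsE (M : 'M[R]_(2 + 1, d)) : M = col_mx (col_mx (row i0 M) (row i1 M)) (row i2 M).
  apply/matrixP => i j; rewrite !mxE; case: splitP => k ik; rewrite mxE.
    case: splitP => l kl; rewrite mxE; congr (M _ j); apply: val_inj; rewrite /= inordK //.
      by rewrite ik kl (ord1 l).
    by rewrite ik kl (ord1 l).
  by congr (M _ j); apply: val_inj; rewrite /= inordK // ik (ord1 k).
have [w1 [w2 [cw1 cw2 n1]]] :=
  @ocomp2_split R d 2 1 S' S' (unitI R d) OS' OS' OU T a x (fun z => z) ci.
(* transport to [S] *)
have n2 := pull_lag OS OF (cze i0) (cze i1) cw1.
have n3 := pull_lag OS OF cw1 (cze i2) com.
have cphi (f : T -> B 1) : f z @[z --> a] --> ((0, x) : B 1) -> phi (f z) @[z --> a] --> ((0,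
  x) : B 1).
  by move=> cf; exact: (psi_cvg OI cf).
pose f0 z := phi (ze i0 z); pose f1 z := phi (ze i1 z); pose f2 z := phi (ze i2 z).
have cf0 : f0 z @[z --> a] --> ((0, x) : B 1) := cphi _ (cze i0).
have cf1 : f1 z @[z --> a] --> ((0, x) : B 1) := cphi _ (cze i1).
have cf2 : f2 z @[z --> a] --> ((0, x) : B 1) := cphi _ (cze i2).
have cfo := cphi _ com; have cfw := cphi _ cw1.
pose y01 z : 'M[R]_(1 + 1, d) * 'M[R]_(1 + 1, d) := (col_mx (f0 z).1 (f1 z).1,
  col_mx (f0 z).2 (f1 z).2).
have cy01 : (y01 z).1 @[z --> a] --> (0 : 'M[R]_(1 + 1, d)).
  by rewrite -(col_mx0 R 1 1 d); apply: cvg_col_mx; [exact: cvg_p cf0|exact: cvg_p cf1].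
have n4 := ocomp2_join OS OS OU cy01 (cvg_p cf2) cfw cf2 cfo.
pose y z : 'M[R]_(2 + 1, d) * 'M[R]_(2 + 1, d) := (col_mx (y01 z).1 (f2 z).1,
  col_mx (y01 z).2 (f2 z).2).
have cy : (y z).1 @[z --> a] --> (0 : 'M[R]_(2 + 1, d)).
  by rewrite -(col_mx0 R 2 1 d); apply: cvg_col_mx => //; exact: cvg_p cf2.
have n5 := @lag_ext R d T 3 _ _ y (fun z => phi (om z)) a x assocS cy cfo.
have [u1 [u2 [cu1 cu2 n6]]] := @ocomp2_split_lag R d T a x 1 2 S (unitI R d) S y _ OS OU OS cy cfo.
(* and back to [S'] *)
have n7 := push_lag OS OF cf1 cf2 cu2.
have n8 := push_lag OS OF cf0 cu2 cfo.
have k0 := near_cvg (cze i0) (psiVK OF x); have k1 := near_cvg (cze i1) (psiVK OF x).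
have k2 := near_cvg (cze i2) (psiVK OF x); have ko := near_cvg com (psiVK OF x).
pose y12 z : 'M[R]_(1 + 1, d) * 'M[R]_(1 + 1, d) :=
  (col_mx (ze i1 z).1 (ze i2 z).1, col_mx (ze i1 z).2 (ze i2 z).2).
have cy12 : (y12 z).1 @[z --> a] --> (0 : 'M[R]_(1 + 1, d)).
  by rewrite -(col_mx0 R 1 1 d); apply: cvg_col_mx; [exact: cvg_p (cze i1)|exact: cvg_p (cze i2)].
have n9 := ocomp2_join OS' OU OS' (cvg_p (cze i0)) cy12 (cze i0) (psi_cvg OF cu2) com.
apply: filterS3 (near_and (near_and n1 (near_and n2 n3)) (near_and n4 n5)) (near_and n6 (near_and n7 n8))
  (near_and (near_and k0 k1) (near_and (near_and k2 ko) n9)).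
move=> z [[[l1 l2 l3] [h2 h3]] [h4 h5]] [h6 [h7 h8]] [[e0 e1] [[e2 eo] h9]].
rewrite -/A1 in l1 l2 l3.
have Ez := rowsE z.1; have Eg := rowsE (grad_p A1 z).
have {l2} Ew2 : w2 z = ze i2 z.
  by move/lag_unitI: l2 => ->; rewrite {1}Ez {1}Eg !col_mxKd.
have {}h2 : lag2 S (f0 z) (f1 z) (phi (w1 z)).
  by apply: h2; move: l1; rewrite {1}Ez {1}Eg !col_mxKu.
have {}h3 : lag2 S (phi (w1 z)) (f2 z) (phi (om z)).
  by apply: h3; move: l3; rewrite Ew2.
have {}h4 := h4 h2 ((lag_unitI _ _).2 erefl) h3.
have [] := h6 (h5 h4).
rewrite /y /y01 /= !col_mx3 !col_mxKu !col_mxKd -!surjective_pairing => /lag_unitI Eu1 m1 m2.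
rewrite Eu1 in m2.
have {}h7 := h7 m1; have {}h8 := h8 m2.
rewrite /f1 /f2 e1 e2 in h7; rewrite /f0 e0 eo in h8.
have := h9 ((lag_unitI _ _).2 erefl) h7 h8.
case=> Ep _.
have E3 : ((col_mx (ze i0 z).1 (y12 z).1, (om z).2) : B 3) = z.
  by apply: injective_projections => //; apply: (etrans _ (esym Ez)); rewrite col_mx3.
apply: (etrans Eg); rewrite col_mx3; apply: (etrans Ep).
exact: (congr1 (grad_p A2) E3).
Qed.
End Assoc.
End ConjugateAssociativity.

(** * Units and inverses of the conjugate *)

Section Units.
Context {R : realType} {d : nat}.
Notation B n := (B R d n).
Notation rows n x := (\matrix_(i < n) x : 'M[R]_(n, d)).
Implicit Types (S : B 2 -> R) (al be : R).

(** A common form for the points [(p, 0, x)], [(0, p, x)] and [(p, - p, x)] of the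
    unit and inverse laws. *)
Definition slice al be (z : B 1) : B 2 := pt2 (al *: z.1) (be *: z.1) z.2.

Let slice_linear al be : linear (slice al be).
Proof.
move=> a u v; rewrite /slice /pt2; apply: injective_projections => //=.
apply: (@etrans _ _ (a *: col_mx (al *: u.1) (be *: u.1) + col_mx (al *: v.1) (be *: v.1)));
  last by [].
rewrite scale_col_mx add_col_mx; congr col_mx; rewrite scalerDr !scalerA; congr (_ *: _ + _);
  exact: mulrC.
Qed.

Lemma slice0 al be x : slice al be (0, x) = (0, x).
Proof. by rewrite /slice /pt2 /= !scaler0 col_mx0. Qed.

Lemma slice10 z : pt2 z.1 0 z.2 = slice 1 0 z. Proof. by rewrite /slice scale1r scale0r. Qed.
Lemma slice01 z : pt2 0 z.1 z.2 = slice 0 1 z. Proof. by rewrite /slice scale1r scale0r. Qed.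
Lemma slice1N z : pt2 z.1 (- z.1) z.2 = slice 1 (- 1) z. Proof.
  by rewrite /slice scale1r scaleN1r. Qed.

Lemma dot_col_mx (a b : 'rV[R]_d) (g : 'M[R]_(1 + 1, d)) : dot (col_mx a b) g =
  dot a (row 0 g) + dot b (row 1 g).
Proof.
rewrite {1}/dot big_ord_recl big_ord1 !dot1.
have -> : lift ord0 ord0 = (1 : 'I_(1 + 1)) by exact: val_inj.
by rewrite row0_col row1_col.
Qed.

Lemma derive_slice S al be z v : differentiable S (slice al be z) ->
  'D_v (fun z => S (slice al be z)) z = 'D_(slice al be v) S (slice al be z).
Proof.
move=> dS; have dl : differentiable (slice al be) z by apply: smooth_at_diff; exact: smooth_at_lin.
by rewrite [LHS](derive_comp v dl dS) (derive_lin (l := slice al be)).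
Qed.

Lemma grad_slice S al be z : differentiable S (slice al be z) ->
  grad_p (fun z => S (slice al be z)) z =
    al *: row 0 (grad_p S (slice al be z)) + be *: row 1 (grad_p S (slice al be z)) /\
  grad_x (fun z => S (slice al be z)) z = grad_x S (slice al be z).
Proof.
move=> dS; split; apply/matrixP => i j; rewrite [LHS]mxE derive_slice //.
  rewrite /slice /pt2 derive_grad // dot0l addr0 dot_col_mx.
  rewrite -[al *: delta_mx _ _]addr0 -[be *: delta_mx _ _]addr0 !dot_linear !dot0l !addr0 !dot_delta.
  by rewrite (ord1 i) [RHS]mxE; congr (_ + _); rewrite [RHS]mxE.
rewrite /slice /pt2 /= !scaler0 col_mx0 derive_grad // dot0l add0r dot_delta (ord1 i) //.
Qed.

Lemma cvg_slice (T : topologicalType) al be (f : T -> B 1) (a : T) x :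
  f z @[z --> a] --> ((0, x) : B 1) -> slice al be (f z) @[z --> a] --> ((0, x) : B 2).
Proof.
by move=> cf; rewrite -(slice0 al be x); exact: (cvg_lin (slice_linear al be) cf).
Qed.

Lemma smooth_slice (W : normedModType R) {fW : findim W} (f : B 2 -> W) al be x :
  smooth_at f ((0, x) : B 2) -> smooth_at (fun z => f (slice al be z)) ((0, x) : B 1).
Proof.
move=> sS; apply: (smooth_at_comp (smooth_at_lin _ (slice_linear al be))).
by rewrite slice0.
Qed.

(** By [germ_eq_grad_p] an identity along a slice is an identity between gradients,
    hence a property of the relation generated by [S]. *)
Lemma slice_germ S al be (h : B 1 -> R) : Ogen R d 2 S ->
  (forall x, smooth_at h ((0, x) : B 1)) -> (forall x, h (0, x) = 0) ->
  (germ_eq (fun z => S (slice al be z)) h <-> forall x, \forall z \near ((0, x) : B 1),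
    al *: row 0 (grad_p S (slice al be z)) + be *: row 1 (grad_p S (slice al be z)) = grad_p h z) .
Proof.
move=> /OgenP[sS S0 _] sh h0.
have nd x : \forall z \near ((0, x) : B 1), differentiable S (slice al be z).
  have := near_cvg (cvg_slice al be (cvg_idt ((0, x) : B 1))) (smooth_at_near (sS x)).
  by apply: filterS => z /smooth_at_diff.
split=> [E x|E].
  apply: filterS2 (nd x) (germ_eq_grads E x) => z dS [<- _].
  by have [-> _] := grad_slice dS.
apply: germ_eq_grad_p => // x; first exact: smooth_slice.
  by rewrite slice0 S0 h0.
apply: filterS2 (nd x) (E x) => z dS <-.
by have [-> _] := grad_slice dS.
Qed.

Lemma slice_germ_x S al be (h : B 1 -> R) x : Ogen R d 2 S ->
  germ_eq (fun z => S (slice al be z)) h -> \forall z \near ((0, x) : B 1),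
    grad_x S (slice al be z) = grad_x h z.
Proof.
move=> /OgenP[sS S0 _] E.
have := near_cvg (cvg_slice al be (cvg_idt ((0, x) : B 1))) (smooth_at_near (sS x)).
apply: filterS2 (germ_eq_grads E x) => z [_ <-] /smooth_at_diff dS.
by have [_ ->] := grad_slice dS.
Qed.

Lemma grads_unitI (z : B 1) : grad_p (unitI R d) z = z.2 /\ grad_x (unitI R d) z = z.1.
Proof.
case: z => p x; have [h1 h2] := (lag_unitI (p, x) (p, x)).2 erefl.
by split; [exact: esym h1|exact: esym h2].
Qed.

Lemma smooth_unitI x : smooth_at (unitI R d) ((0, x) : B 1).
Proof. exact: Ogen_smooth (unitI_Ogen) x. Qed.

Lemma unitI0 x : unitI R d (0, x) = 0.
Proof. exact: Ogen0 unitI_Ogen x. Qed.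

Let grow S al be x i : Ogen R d 2 S ->
  row i (grad_p S (slice al be z)) @[z --> ((0, x) : B 1)] --> x.
Proof.
move=> /OgenP[sS _ gS].
have c := cvg_slice al be (cvg_idt ((0, x) : B 1)).
have := cvg_cont (smooth_at_cont (smooth_grad_p (sS x))) c; rewrite gS => /(cvg_row (i := i)).
by rewrite rowK.
Qed.

Lemma cvg_source S x : Ogen R d 2 S -> gpd_source S z @[z --> ((0, x) : B 1)] --> x.
Proof.
move=> OS; rewrite (_ : gpd_source S = fun z => row 1 (grad_p S (slice 1 0 z))); first exact: grow.
by apply/funext => z; rewrite /gpd_source slice10.
Qed.

Lemma cvg_target S x : Ogen R d 2 S -> gpd_target S z @[z --> ((0, x) : B 1)] --> x.
Proof.
move=> OS; rewrite (_ : gpd_target S = fun z => row 0 (grad_p S (slice 0 1 z))); first exact: grow.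
by apply/funext => z; rewrite /gpd_target slice01.
Qed.

Lemma lag2E S (z1 z2 w : B 1) : lag2 S z1 z2 w <-> [/\ z1.2 = row 0 (grad_p S (pt2 z1.1 z2.1 w.2)),
  z2.2 = row 1 (grad_p S (pt2 z1.1 z2.1 w.2)) & w.1 = grad_x S (pt2 z1.1 z2.1 w.2)].
Proof.
rewrite /lag2 /lag /=; split=> [[<- ->]|[-> -> ->]]; first by rewrite row0_col row1_col.
by rewrite -col_rows.
Qed.

(** The source of [z] is the unit that can multiply [z] on the right. This describes
    the unit law and the source map by the relation alone. *)
Lemma right_unit S : Ogen R d 2 S ->
  (germ_eq (fun z : B 1 => S (pt2 z.1 0 z.2)) (unitI R d) <-> forall x, \forall z \near ((0,
    x) : B 1),
   lag2 S z (0, gpd_source S z) z).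
Proof.
move=> OS; rewrite (_ : (fun _ => _) = fun z => S (slice 1 0 z)); last by apply/funext => z;
  rewrite slice10.
have SG := slice_germ 1 0 OS smooth_unitI unitI0.
split=> [E x|E].
  apply: filterS2 (SG.1 E x) (slice_germ_x x OS E) => z.
  have [-> ->] := grads_unitI z; rewrite scale1r scale0r addr0 => E1 E2.
  by apply/lag2E; rewrite /= slice10 E1 E2; split => //; rewrite /gpd_source slice10.
apply/SG => x; apply: filterS (E x) => z /lag2E[/= E1 _ _].
by have [-> _] := grads_unitI z; rewrite scale1r scale0r addr0 -slice10 -E1.
Qed.

Lemma left_unit S : Ogen R d 2 S ->
  (germ_eq (fun z : B 1 => S (pt2 0 z.1 z.2)) (unitI R d) <-> forall x, \forall z \near ((0,
    x) : B 1),
   lag2 S (0, gpd_target S z) z z).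
Proof.
move=> OS; rewrite (_ : (fun _ => _) = fun z => S (slice 0 1 z)); last by apply/funext => z;
  rewrite slice01.
have SG := slice_germ 0 1 OS smooth_unitI unitI0.
split=> [E x|E].
  apply: filterS2 (SG.1 E x) (slice_germ_x x OS E) => z.
  have [-> ->] := grads_unitI z; rewrite scale1r scale0r add0r => E1 E2.
  by apply/lag2E; rewrite /= slice01 E1 E2; split => //; rewrite /gpd_target slice01.
apply/SG => x; apply: filterS (E x) => z /lag2E[/= _ E1 _].
by have [-> _] := grads_unitI z; rewrite scale1r scale0r add0r -slice01 -E1.
Qed.

Section Conj.
Variables (S : B 2 -> R) (F : B 1 -> R).
Hypotheses (OS : Ogen R d 2 S) (OF : Ogen R d 1 F).
Let S' : B 2 -> R := ocomp2 (ocomp1 F S) (inverse F) (inverse F).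
Let OS' : Ogen R d 2 S' := conjugate_Ogen OS OF.
Let OI : Ogen R d 1 (inverse F) := inverse_Ogen OF.
Let phi := psi (inverse F).

Let cphi x : phi z @[z --> ((0, x) : B 1)] --> ((0, x) : B 1) := psi_cvg OI (cvg_idt ((0, x) :
  B 1)).

Lemma conjugate_right_unit : germ_eq (fun z : B 1 => S (pt2 z.1 0 z.2)) (unitI R d) ->
  germ_eq (fun z : B 1 => S' (pt2 z.1 0 z.2)) (unitI R d) /\
  forall x, \forall z \near ((0, x) : B 1), gpd_source S' (psi F z) = gpd_source S z.
Proof.
move=> /(right_unit OS) H.
have H' x : \forall z \near ((0, x) : B 1), lag2 S' (psi F z) (0, gpd_source S z) (psi F z).
  have c := cvg_idt ((0, x) : B 1).
  have cs : (0, gpd_source S z) @[z --> ((0, x) : B 1)] --> ((0, x) : B 1).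
    by apply: cvg_both; [exact: cvg_cst|exact: cvg_source].
  have n := push_lag OS OF c cs c.
  by apply: filterS2 n (H x) => z h1 /h1; rewrite psi0.
have Es x : \forall z \near ((0, x) : B 1), gpd_source S' (psi F z) = gpd_source S z.
  by apply: filterS (H' x) => z /lag2E[/= _ -> _].
split => //; apply/(right_unit OS') => x.
apply: filterS3 (near_cvg (cphi (x := x)) (H' x)) (near_cvg (cphi (x :=
  x)) (Es x)) (psiVK OF x) => z.
by rewrite /phi => h1 h2 h3; rewrite -h2 h3 in h1.
Qed.

Lemma conjugate_left_unit : germ_eq (fun z : B 1 => S (pt2 0 z.1 z.2)) (unitI R d) ->
  germ_eq (fun z : B 1 => S' (pt2 0 z.1 z.2)) (unitI R d) /\
  forall x, \forall z \near ((0, x) : B 1), gpd_target S' (psi F z) = gpd_target S z.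
Proof.
move=> /(left_unit OS) H.
have H' x : \forall z \near ((0, x) : B 1), lag2 S' (0, gpd_target S z) (psi F z) (psi F z).
  have c := cvg_idt ((0, x) : B 1).
  have cs : (0, gpd_target S z) @[z --> ((0, x) : B 1)] --> ((0, x) : B 1).
    by apply: cvg_both; [exact: cvg_cst|exact: cvg_target].
  have n := push_lag OS OF cs c c.
  by apply: filterS2 n (H x) => z h1 /h1; rewrite psi0.
have Es x : \forall z \near ((0, x) : B 1), gpd_target S' (psi F z) = gpd_target S z.
  by apply: filterS (H' x) => z /lag2E[/= -> _ _].
split => //; apply/(left_unit OS') => x.
apply: filterS3 (near_cvg (cphi (x := x)) (H' x)) (near_cvg (cphi (x :=
  x)) (Es x)) (psiVK OF x) => z.
by rewrite /phi => h1 h2 h3; rewrite -h2 h3 in h1.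
Qed.

(** For [S] the law says that near the zero section [(p, y)] and [(- p, y)] multiply to
    the unit at [x], where [y] is a function of [(p, x)]. The map [psi F] sends them to
    another pair of inverse points. By [param_inverse] every [(p', x)] arises from one
    of these pairs. *)
Lemma conjugate_inverse : odd_p F ->
  germ_eq (fun z : B 1 => S (pt2 z.1 (- z.1) z.2)) (fun=> 0) ->
  germ_eq (fun z : B 1 => S' (pt2 z.1 (- z.1) z.2)) (fun=> 0).
Proof.
move=> /(odd_psi OF) oF.
have fE (S0 : B 2 -> R) : (fun z : B 1 => S0 (pt2 z.1 (- z.1) z.2)) = fun z => S0 (slice 1 (-1) z).
  by apply/funext => z; rewrite slice1N.
rewrite !fE => E.
have s0 x : smooth_at (fun _ : B 1 => 0 : R) ((0, x) : B 1) by exact: smooth_at_cst.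
have g0 (z : B 1) : grad_p (fun=> 0 : R) z = 0 /\ grad_x (fun=> 0 : R) z = 0.
  by split; apply/matrixP => i j; rewrite !mxE derive_cst.
have SG := slice_germ 1 (-1) OS s0 (fun=> erefl).
(* both positions are [y z], since the derivative of [S (p, - p, x)] in [p] vanishes *)
pose y (z : B 1) := row 0 (grad_p S (slice 1 (-1) z)).
have lagS x : \forall z \near ((0, x) : B 1), lag2 S (z.1, y z) (gpd_inv (z.1, y z)) (0, z.2).
  apply: filterS2 (SG.1 E x) (slice_germ_x x OS E) => z; have [-> ->] := g0 z.
  rewrite scale1r scaleN1r => /subr0_eq E1 E2.
  apply/lag2E; rewrite /gpd_inv /= slice1N; split => //.
have [sS S0 gS] := (OgenP S).1 OS.
have sy x : smooth_at y ((0, x) : B 1).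
  apply: smooth_row; apply: (smooth_at_comp (smooth_at_lin _ (slice_linear 1 (-1)))).
  by rewrite slice0; apply: smooth_grad_p; exact: sS.
have y0 x : y (0, x) = x by rewrite /y slice0 gS rowK.
pose q (z : B 1) : B 1 := (z.1, y z).
have sq x : smooth_at q ((0, x) : B 1) by apply: smooth_at_pair => //; exact: smooth_at_lin.
have q0 x : q (0, x) = (0, x) by rewrite /q y0.
pose P (z : B 1) := (psi F z).1.
have sP x : smooth_at P ((0, x) : B 1) by apply: smooth_fst; exact: psi_smooth.
(* the first coordinate [p'] of the image, as a function of [(p, x)] *)
pose theta z := P (q z).
have [|x|x h|sg Hsg] := @param_inverse _ _ theta.
- by move=> x; apply: (smooth_at_comp (sq x)); rewrite q0; exact: sP.
- by rewrite /theta q0 /P psi0.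
- have dP : differentiable P (q (0, x)) by rewrite q0; apply: smooth_at_diff; exact: sP.
  rewrite [LHS](derive_comp (h, 0) (smooth_at_diff (sq x)) dP) q0.
  rewrite derive_pair /=; [|by apply: smooth_at_diff; exact: smooth_at_lin|exact: smooth_at_diff].
  rewrite (derive_lin (l := fun z : B 1 => z.1)) //=.
  have -> : (h, 'D_(h, 0) y (0, x)) = (h, 0) + (0, 'D_(h, 0) y (0, x)) :> B 1.
    by apply/pair_equal_spec; rewrite /= addr0 add0r.
  rewrite q0 in dP; rewrite deriveE // linearD -!deriveE // psi_derive_p //.
  rewrite derive_const_along ?addr0 // => t.
  by rewrite (_ : t *: _ + _ = (0, t *: 'D_(h, 0) y (0, x) + x)) /P ?psi0 //;
    apply/pair_equal_spec; rewrite /= scaler0 addr0.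
apply/(slice_germ 1 (-1) OS' s0 (fun=> erefl)) => x.
have [ssg sg0 Esg] := Hsg x.
have csg : (sg z, z.2) @[z --> ((0, x) : B 1)] --> ((0, x) : B 1).
  have c := smooth_at_cont ssg; rewrite /prop_for /continuous_at sg0 in c.
  by apply: cvg_both => //; exact: cvg_x (cvg_idt ((0, x) : B 1)).
have cq : q (sg z, z.2) @[z --> ((0, x) : B 1)] --> ((0, x) : B 1).
  by have := cvg_cont (smooth_at_cont (sq x)) csg; rewrite q0.
have cz : (0, z.2) @[z --> ((0, x) : B 1)] --> ((0, x) : B 1).
  by apply: cvg_both; [exact: cvg_cst|exact: cvg_x (cvg_idt ((0, x) : B 1))].
have n1 := push_lag OS OF cq (cvg_inv cq) cz.
have n2 := near_cvg csg (lagS x).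
have n3 := near_cvg cq (oF x).
apply: filterS3 (near_and n1 Esg) n2 n3 => z [h1 h2] /= h3 h4.
have {h1} := h1 h3; rewrite h4 (psi0 OF) => /lag2E.
have -> : (gpd_inv (psi F (q (sg z, z.2)))).1 = - z.1 by rewrite /gpd_inv /= -h2.
have -> : (psi F (q (sg z, z.2))).1 = z.1 by [].
rewrite slice1N /= => -[<- <- _]; have [-> _] := g0 z.
by rewrite scale1r scaleN1r subrr.
Qed.

Lemma conjugate_groupoid : odd_p F -> groupoid_gen S -> groupoid_gen S'.
Proof.
move=> oF [_ as_S r_S l_S i_S]; split.
- exact: OS'.
- exact: (conjugate_assoc OS OF as_S).
- by have [] := conjugate_right_unit r_S.
- by have [] := conjugate_left_unit l_S.
- exact: conjugate_inverse.
Qed.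
End Conj.
End Units.

(** * The isomorphism of symplectic groupoids *)

Section Iso.
Context {R : realType} {d : nat}.
Notation B n := (B R d n).
Notation rows n x := (\matrix_(i < n) x : 'M[R]_(n, d)).

Lemma addr_sub_swap (V : zmodType) (a b c e : V) : a + b = c + e -> b - e = c - a.
Proof. by move=> E; apply/eqP; rewrite subr_eq addrAC -E addrAC subrr add0r. Qed.

Section Symplectic.
Variable F : B 1 -> R.
Hypothesis OF : Ogen R d 1 F.

Lemma omegaE (v w : B 1) : omega v w = dot v.1 w.2 - dot w.1 v.2.
Proof. by rewrite /omega !dot1. Qed.

(** The pairing of [e] with the derivative of the gradient is a value of the Hessian. *)
Lemma dot_derive_grad (w : B 1) (e V : B 1) : smooth_at F w ->
  dot e.1 ('D_V (grad_p F) w) + dot e.2 ('D_V (grad_x F) w) = 'D_V ('D_e F) w.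
Proof.
move=> sF.
have dgp : differentiable (grad_p F) w by apply: smooth_at_diff; exact: smooth_grad_p.
have dgx : differentiable (grad_x F) w by apply: smooth_at_diff; exact: smooth_grad_x.
rewrite (near_eq_derive (f := 'D_e F) (g := fun z =>
  dot e.1 (grad_p F z) + dot e.2 (grad_x F z))); last first.
  apply: filterS (smooth_at_near sF) => z sz.
  by rewrite {1}[e]surjective_pairing derive_grad //; exact: smooth_at_diff.
have sdot n (c : 'M[R]_(n, d)) (g : B 1 -> 'M[R]_(n, d)) : smooth_at g w ->
    smooth_at (fun z => dot c (g z)) w /\ 'D_V (fun z => dot c (g z)) w = dot c ('D_V g w).
  move=> sg; split; first by apply: smooth_dot => //; exact: smooth_at_cst.
  rewrite (derive_dot (f := fun=> c)); [|exact: differentiable_cst|exact: smooth_at_diff].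
  by rewrite derive_cst dot0l addr0.
have [s1 D1] := sdot _ e.1 (grad_p F) (smooth_grad_p sF).
have [s2 D2] := sdot _ e.2 (grad_x F) (smooth_grad_x sF).
apply/esym/(etrans (derive_add V (smooth_at_diff s1) (smooth_at_diff s2))).
exact: (congr2 +%R D1 D2).
Qed.

(** Let [V v] be the derivative in the direction [v] of [z |-> (z.1, (psi F z).2)], the
    point at which the gradients of [F] are taken. Differentiating the equations of
    [psi F] expresses both symplectic forms by the Hessian of [F], and their
    difference is its value at [(V v, V w)] minus its value at [(V w, V v)]. *)
Lemma psi_omega x : \forall z \near ((0, x) : B 1), forall v w : B 1,
  omega ('D_v (psi F) z) ('D_w (psi F) z) = omega v w.
Proof.
have ci := cvg_idt ((0, x) : B 1); have cp := psi_cvg OF ci.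
pose q (z : B 1) : B 1 := (z.1, (psi F z).2).
have cq : q z @[z --> ((0, x) : B 1)] --> ((0, x) : B 1).
  by apply: cvg_both; [exact: cvg_p ci|exact: cvg_x cp].
apply: filterS3 (near_join (psi_lag OF x)) (smooth_at_near (psi_smooth OF x))
  (near_cvg cq (smooth_at_near (Ogen_smooth OF x))) => z lagz sz sF v w.
pose X := fun u => ('D_u (psi F) z).2; pose P := fun u => ('D_u (psi F) z).1.
pose V u : B 1 := (u.1, X u).
have dq : differentiable q z.
  apply: smooth_at_diff; apply: smooth_at_pair; first exact: smooth_at_lin.
  exact: smooth_snd.
have Dq u : 'D_u q z = V u.
  rewrite derive_pair; [|by apply: smooth_at_diff;
    exact: smooth_at_lin|by apply: smooth_at_diff; exact: smooth_snd].
  rewrite (derive_lin (l := fun z : B 1 => z.1)) //; congr (_, _).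
  by apply: (derive_lin_post (l := fun z : B 1 => z.2)) => //; exact: smooth_at_diff.
have E2 u : u.2 = 'D_(V u) (grad_p F) (q z).
  rewrite -Dq -derive_comp //; last by apply: smooth_at_diff; exact: smooth_grad_p.
  rewrite -(derive_lin (l := fun z : B 1 => z.2) z u) //.
  by apply: near_eq_derive; apply: filterS lagz => y [].
have E1 u : P u = 'D_(V u) (grad_x F) (q z).
  rewrite -Dq -derive_comp //; last by apply: smooth_at_diff; exact: smooth_grad_x.
  rewrite /P -(derive_lin_post (l := fun z : B 1 => z.1) (f := psi F) u) //;
    last exact: smooth_at_diff.
  by apply: near_eq_derive; apply: filterS lagz => y [].
have H1 (e u : B 1) : dot e.1 u.2 + dot e.2 (P u) = 'D_(V u) ('D_e F) (q z).
  by rewrite E1 {1}E2 dot_derive_grad.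
have sym : dot (V w).1 v.2 + dot (V w).2 (P v) = dot (V v).1 w.2 + dot (V v).2 (P w).
  apply: (etrans (H1 (V w) v)); apply: (etrans _ (esym (H1 (V v) w))).
  exact: smooth_schwarz.
apply: (etrans (omegaE _ _)); apply: (etrans _ (esym (omegaE v w))).
by apply: (etrans _ (addr_sub_swap sym)); congr (_ - _); exact: dotC.
Qed.

Lemma psi_symplecto : germ_symplecto (psi F).
Proof.
have OI := inverse_Ogen OF.
have B0psi G : Ogen R d 1 G -> forall z, B0 R d 1 z -> B0 R d 1 (psi G z).
  by move=> OG z /B0E[x ->]; rewrite (psi0 OG).
split.
- by apply/smoothB0P => x; exact: psi_smooth.
- exact: B0psi.
- exists (psi (inverse F)); split; [|exact: B0psi| |].
  + by apply/smoothB0P => x; exact: psi_smooth.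
  + by apply/nearB0P => x; exact: psiK.
  + by apply/nearB0P => x; exact: psiVK.
- by apply/nearB0P => x; exact: psi_omega.
Qed.
End Symplectic.

Lemma gpd_multE (S : B 2 -> R) t : gpd_mult S t <-> lag2 S t.1.1 t.1.2 t.2.
Proof.
rewrite lag2E; case: t => [[[p1 y1] [p2 y2]] [q x]] /=; split.
  by move=> [p1' [p2' [x' [-> -> -> -> -> ->]]]].
by move=> [-> -> ->]; exists p1, p2, x.
Qed.

Section Conj.
Variables (S : B 2 -> R) (F : B 1 -> R).
Hypotheses (GS : groupoid_gen S) (OF : Ogen R d 1 F) (oF : odd_p F).
Let OS : Ogen R d 2 S. Proof. by case: GS. Qed.
Let S' : B 2 -> R := ocomp2 (ocomp1 F S) (inverse F) (inverse F).
Let OS' : Ogen R d 2 S' := conjugate_Ogen OS OF.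
Let OI : Ogen R d 1 (inverse F) := inverse_Ogen OF.

Let source_eq x : \forall z \near ((0, x) : B 1), gpd_source S' (psi F z) = gpd_source S z.
Proof. by case: GS => _ _ rS _ _; have [_] := conjugate_right_unit OS OF rS; apply. Qed.

Let target_eq x : \forall z \near ((0, x) : B 1), gpd_target S' (psi F z) = gpd_target S z.
Proof. by case: GS => _ _ _ lS _; have [_] := conjugate_left_unit OS OF lS; apply. Qed.

Lemma psi_mult x : \forall t \near (((0, x), (0, x), (0, x)) : B 1 * B 1 * B 1),
  gpd_mult S t <-> gpd_mult S' (psi F t.1.1, psi F t.1.2, psi F t.2).
Proof.
set a : B 1 * B 1 * B 1 := ((0, x), (0, x), (0, x)).
have c12 : t.1 @[t --> a] --> (((0, x), (0, x)) : B 1 * B 1).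
  by apply: (cvg_fst2 (f := fun t => t) (c := (0, x))); exact: cvg_idt.
have c1 : t.1.1 @[t --> a] --> ((0, x) : B 1) by apply: (cvg_fst2 (f := fun t => t.1) (c := (0,
  x))).
have c2 : t.1.2 @[t --> a] --> ((0, x) : B 1) by apply: (cvg_snd2 (f := fun t => t.1) (b := (0,
  x))).
have c3 : t.2 @[t --> a] --> ((0, x) : B 1).
  by apply: (cvg_snd2 (f := fun t => t) (b := ((0, x), (0, x)))); exact: cvg_idt.
have n1 := push_lag OS OF c1 c2 c3.
have n2 := pull_lag OS OF (psi_cvg OF c1) (psi_cvg OF c2) (psi_cvg OF c3).
have n3 := near_and (near_cvg c1 (psiK OF x)) (near_and (near_cvg c2 (psiK OF x)) (near_cvg c3 (psiK OF x))).
apply: filterS3 n1 n2 n3 => t h1 h2 [e1 [e2 e3]]; rewrite !gpd_multE /=; split; first exact: h1.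
by move=> /h2; rewrite e1 e2 e3.
Qed.

Lemma psi_groupoid_iso : groupoid_iso (psi F) S S'.
Proof.
split.
- exact: psi_symplecto.
- by move=> x; exact: psi0.
- by apply/nearB0P => x; exact: (odd_psi OF).1.
- by apply/nearB0P => x; apply: filterS2 (source_eq x) (target_eq x) => z.
- by move=> t [x ->]; exact: psi_mult.
Qed.

(** Oddness makes the second component of [psi F] even in [p]. *)
Lemma psi_derive_p0 x h : 'D_(h, 0) (psi F) ((0, x) : B 1) = (h, 0).
Proof.
have sp := psi_smooth OF x; have dp := smooth_at_diff sp.
have lp1 : linear (fun z : B 1 => z.1) by [].
have lp2 : linear (fun z : B 1 => z.2) by [].
rewrite [LHS]surjective_pairing; congr (_, _).
  by rewrite -(derive_lin_post (h, 0) lp1 dp) psi_derive_p.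
rewrite -(derive_lin_post (h, 0) lp2 dp); set X := (fun z => (psi F z).2).
have dX : differentiable X (0, x) by apply: smooth_at_diff; exact: smooth_snd.
have linv : linear (@gpd_inv R d).
  by move=> a u v; apply: injective_projections => //=; rewrite opprD scalerN.
have i0 : gpd_inv (0, x) = (0, x) :> B 1 by rewrite /gpd_inv /= oppr0.
have dinv : differentiable (@gpd_inv R d) ((0, x) : B 1) by apply: smooth_at_diff;
  exact: smooth_at_lin.
have dX' : differentiable X (gpd_inv (0, x)) by rewrite i0.
have E : 'D_(h, 0) X (0, x) = 'D_(gpd_inv (h, 0)) X (0, x).
  apply: (etrans _ (etrans (derive_comp (h, 0) dinv dX') _)).
    by apply: near_eq_derive; apply: filterS ((odd_psi OF).1 oF x) => z E; rewrite /X /= E.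
  by rewrite i0 (derive_lin (l := @gpd_inv R d)).
have E' : gpd_inv (h, 0) = - (h, 0) :> B 1.
  by apply: injective_projections; [|exact: (esym (oppr0 _))].
have {}E : 'D_(h, 0) X (0, x) = - 'D_(h, 0) X (0, x).
  by apply: (etrans E); rewrite E' (deriveE _ dX) (deriveE _ dX) linearN.
move: ('D_(h, 0) X (0, x)) E => D /eqP.
by rewrite -addr_eq0 -mulr2n -scaler_nat scaler_eq0 pnatr_eq0 => /eqP.
Qed.

(** The source is a gradient in the second momentum taken at [(p, 0, x)]; its derivative
    in [p] is therefore a mixed derivative in the two momenta. *)
Lemma poisson_source (T : B 2 -> R) x k l : Ogen R d 2 T ->
  poisson T x k l = 2 * 'D_(delta_mx 0 k, 0) (fun z => gpd_source T z 0 l) ((0, x) : B 1).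
Proof.
move=> /OgenP[sT _ _]; rewrite mxE; congr (_ * _).
pose j (z : B 1) : B 2 := pt2 z.1 0 z.2.
have lj : linear j.
  move=> a u v; rewrite /j /pt2; apply: injective_projections => //=.
  apply: (@etrans _ _ (a *: col_mx u.1 0 + col_mx v.1 0)); last by [].
  by rewrite scale_col_mx add_col_mx scaler0 addr0.
have j0 : j (0, x) = (0, x) by rewrite /j /pt2 /= col_mx0.
have dj : differentiable j (0, x) by apply: smooth_at_diff; exact: smooth_at_lin.
pose g := 'D_(delta_mx 1 l, 0) T.
have dg : differentiable g (j (0, x)).
  by rewrite j0; apply: smooth_at_diff; exact: smooth_at_der.
have -> : (fun z => gpd_source T z 0 l) = g \o j.
  by apply/funext => z; rewrite /gpd_source !mxE.
have jd : j (delta_mx 0 k, 0) = (delta_mx 0 k, 0).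
  apply: injective_projections => //=; apply/matrixP => i i'; rewrite !mxE.
  by case: splitP => i'' ii; rewrite !mxE -!val_eqE /= ii ?(ord1 i'') //=.
apply/esym/(etrans (derive_comp (f := j) (g := g) (delta_mx 0 k, 0) dj dg)).
have Dj : 'D_(delta_mx 0 k, 0) j (0, x) = (delta_mx 0 k, 0).
  by rewrite -jd; apply: derive_lin.
rewrite Dj j0; reflexivity.
Qed.

(** The map [psi F] intertwines the sources, and along the zero section its differential
    fixes the directions of [p]. *)
Lemma poisson_conjugate x : poisson S' x = poisson S x.
Proof.
apply/matrixP => k l; apply: (etrans (poisson_source x k l OS')).
apply: (etrans _ (esym (poisson_source x k l OS))).
apply: (congr1 (fun t => 2 * t)).
have ss : smooth_at (fun z => gpd_source S' z 0 l) ((0, x) : B 1).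
  have [sT _ _] := (OgenP S').1 OS'; apply: smooth_at_entry.
  rewrite (_ : gpd_source S' = fun z => row 1 (grad_p S' (slice 1 0 z))); last first.
    by apply/funext => z; rewrite /gpd_source slice10.
  by apply: smooth_row; apply: (smooth_slice (f := grad_p S')); exact: smooth_grad_p.
have dp := smooth_at_diff (psi_smooth OF x).
have ds : differentiable (fun z => gpd_source S' z 0 l) (psi F (0, x)).
  by rewrite (psi0 OF); exact: smooth_at_diff.
have E : 'D_(delta_mx 0 k, 0) (fun z => gpd_source S z 0 l) ((0, x) : B 1) =
    'D_(delta_mx 0 k, 0) ((fun z => gpd_source S' z 0 l) \o psi F) ((0, x) : B 1).
  by apply: near_eq_derive; apply: filterS (source_eq x) => z /= ->.
apply/esym/(etrans E)/(etrans (derive_comp (delta_mx 0 k, 0) dp ds)).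
rewrite (psi_derive_p0 x (delta_mx 0 k)) (psi0 OF); reflexivity.
Qed.
End Conj.
End Iso.

Theorem proposition8 (R : realType) (d : nat) (hd : (0 < d)%N) :
  (forall (S : B R d 2 -> R) (F : B R d 1 -> R),
    groupoid_gen S -> Ogen R d 1 F -> odd_p F ->
    let S' := ocomp2 (ocomp1 F S) (inverse F) (inverse F) in
    [/\ groupoid_gen S',
        groupoid_iso (psi F) S S'
      & forall x, poisson S' x = poisson S x]) /\
  is_subgroup (@germ_eq R d 1) (Ogen R d 1) (@ocomp1 R d 1) (unitI R d)
    (@inverse R d) (Oodd R d).
Proof.
split; last exact: Oodd_subgroup.
move=> S F GS OF oF S'; have OS : Ogen R d 2 S by case: GS.
split; [exact: conjugate_groupoid|exact: psi_groupoid_iso|exact: poisson_conjugate].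
Qed.
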